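(* Let $\alpha,\beta\in\mathbb{C}$ satisfy $\alpha^2,\beta^2\neq 0,1$, $\alpha^2\neq\beta^2$, $\alpha^2\beta^2\neq 1$. For $i=1,2$ let $\psi_i^*\colon\operatorname{Jac}(E_i)\to\operatorname{Jac}(V)$ be the map defined in the context, and let $\pi\colon\mathbb{C}^2\to\operatorname{Jac}(V)$, $\pi_i\colon\mathbb{C}\to\operatorname{Jac}(E_i)$ be the natural projections. Consider the maps $$\widetilde{\psi}_i^*\colon\ \mathbb{C}\to\mathbb{C}^2,\qquad v\mapsto{}^t(c_iv,d_iv),\qquad i=1,2,$$ where $$c_1=\frac{1}{1-\alpha\beta},\quad d_1=\frac{1}{\alpha\beta(1-\alpha\beta)},\quad c_2=\frac{1}{1+\alpha\beta},\quad d_2=-\frac{1}{\alpha\beta(1+\alpha\beta)}.$$ Then $\psi_i^*\circ\pi_i=\pi\circ\widetilde{\psi}_i^*$ for $i=1,2$.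
   Context: For a complex number $z$, $\sqrt{z}$ denotes a (chosen) complex number whose square is $z$. Curves. $V$ is the nonsingular hyperelliptic curve of genus 2 with affine equation $y^2=x(x-1)(x-\alpha^2)(x-\beta^2)(x-\alpha^2\beta^2)$, together with its one point $\infty$ at infinity. $E_1$ and $E_2$ are the elliptic curves $$E_1:\ Y^2=X(X-1)\Big(X-\frac{(\alpha-\beta)^2}{(\alpha\beta-1)^2}\Big),\qquad E_2:\ Y^2=X(X-1)\Big(X-\frac{(\alpha+\beta)^2}{(\alpha\beta+1)^2}\Big),$$ each with its point $\infty$ at infinity, which is the identity of the group law. Morphisms of degree 2. $$\varphi_1\colon V\to E_1,\ (x,y)\mapsto\Big(\frac{(\alpha-\beta)^2x}{(x-\alpha\beta)^2},\frac{(\alpha-\beta)^2y}{(\alpha\beta-1)(x-\alpha\beta)^3}\Big),$$ $$\varphi_2\colon V\to E_2,\ (x,y)\mapsto\Big(\frac{(\alpha+\beta)^2x}{(x+\alpha\beta)^2},\frac{-(\alpha+\beta)^2y}{(\alpha\beta+1)(x+\alpha\beta)^3}\Big).$$ Jacobians. On $V$ put $\omega_1=-\frac{x}{2y}dx$, $\omega_3=-\frac{1}{2y}dx$, $\boldsymbol\omega={}^t(\omega_1,\omega_3)$; $\Lambda\subset\mathbb{C}^2$ is the lattice of periods of $\boldsymbol\omega$ over $H_1(V,\mathbb{Z})$ and $\operatorname{Jac}(V)=\mathbb{C}^2/\Lambda$. On $E_i$ put $\Omega_i=-\frac{dX}{2Y}$; $\Lambda_i\subset\mathbb{C}$ is the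 lattice of periods of $\Omega_i$ over $H_1(E_i,\mathbb{Z})$ and $\operatorname{Jac}(E_i)=\mathbb{C}/\Lambda_i$. Let $J_i\colon E_i\to\operatorname{Jac}(E_i)$, $S\mapsto\int_\infty^S\Omega_i$ (an isomorphism). Maps. Let $\chi\colon V\to V$, $(x,y)\mapsto(x,-y)$, and let $O_1=(\alpha\beta,\ \alpha\beta\sqrt{\alpha\beta}(\alpha\beta-1)(\alpha-\beta))$, $O_2=(-\alpha\beta,\ \alpha\beta\sqrt{-\alpha\beta}(\alpha\beta+1)(\alpha+\beta))$, points of $V$ with $\varphi_i(O_i)=\infty$. For $S\in E_i$ the preimage $\varphi_i^{-1}(S)=\{S_1,S_2\}$ consists of two points counted with multiplicity. Define $\varphi_i^*\colon E_i\to\operatorname{Jac}(V)$ by $$\varphi_i^*(S)=\int_{O_i}^{S_1}\boldsymbol\omega+\int_{\chi(O_i)}^{S_2}\boldsymbol\omega,$$ and $\psi_i^*=\varphi_i^*\circ J_i^{-1}\colon\operatorname{Jac}(E_i)\to\operatorname{Jac}(V)$. *)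

(* Defs.v *)
From Stdlib Require Import Reals List ClassicalEpsilon.
From Coquelicot Require Import Coquelicot.
Import ListNotations.
Open Scope R_scope.
Open Scope C_scope.

(* Everything below is over Coquelicot's complex numbers C. *)

(** * Hyperelliptic curves with one point at infinity *)

(* [Curve g es] is the projective nonsingular model of y^2 = prod_(e in es) (x - e),
   where es consists of 2g+1 distinct complex numbers. *)
Record curve := Curve { genus : nat; roots : list C }.

Definition fpol (X : curve) (x : C) : C :=
  fold_right (fun e p => (x - e) * p) 1 (roots X).

(* Equal to u^(2g+2) * fpol (1/u) for u <> 0 : with u = 1/x and w = y / x^(g+1), the curve
   is w^2 = fpol_inf u near the point at infinity (u, w) = (0, 0). *)
Definition fpol_inf (X : curve) (u : C) : C :=
  u * fold_right (fun e p => (1 - e * u) * p) 1 (roots X).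

Inductive point := Infinity | Affine (x y : C).

Definition on_curve (X : curve) (P : point) : Prop :=
  match P with
  | Infinity => True
  | Affine x y => y ^ 2 = fpol X x
  end.

(** * Piecewise C^1 paths *)

(* A C^1 map t |-> (ax t, ay t) from [0,1] to the plane curve y^2 = F x, with its derivative
   (dax t, day t).  Two-sided derivatives at 0 and 1 are no restriction, since a C^1 function
   on [0,1] extends to R. *)
Record arc (F : C -> C) := Arc {
  ax : R -> C;
  ay : R -> C;
  dax : R -> C;
  day : R -> C;
  arc_on : forall t : R, (0 <= t <= 1)%R -> ay t ^ 2 = F (ax t);
  arc_dax : forall t : R, (0 <= t <= 1)%R ->
    is_derive (K := R_AbsRing) (V := C_R_NormedModule) ax t (dax t);
  arc_day : forall t : R, (0 <= t <= 1)%R ->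
    is_derive (K := R_AbsRing) (V := C_R_NormedModule) ay t (day t);
  arc_cdax : forall t : R, (0 <= t <= 1)%R -> continuous dax t;
  arc_cday : forall t : R, (0 <= t <= 1)%R -> continuous day t }.

Arguments ax {F}. Arguments ay {F}. Arguments dax {F}. Arguments day {F}.

(* By compactness of [0,1], a piecewise C^1 path on the curve is a finite concatenation of
   C^1 arcs each of which lies in one of the two affine charts. *)
Inductive step (X : curve) :=
| Affine_arc (a : arc (fpol X))
| Infinite_arc (a : arc (fpol_inf X)).
Arguments Affine_arc {X}. Arguments Infinite_arc {X}.

Definition of_inf_chart (X : curve) (u w : C) : point :=
  if Ceq_dec u 0 then Infinity else Affine (/ u) (w / u ^ S (genus X)).

Definition step_at {X : curve} (s : step X) (t : R) : point :=
  match s with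
  | Affine_arc a => Affine (ax a t) (ay a t)
  | Infinite_arc a => of_inf_chart X (ax a t) (ay a t)
  end.

Definition path (X : curve) := list (step X).

Fixpoint joins {X : curve} (g : path X) (P Q : point) : Prop :=
  match g with
  | [] => on_curve X P /\ P = Q
  | s :: g' => step_at s 0%R = P /\ joins g' (step_at s 1%R) Q
  end.

(** * Integrals of holomorphic differentials *)

(* The value of dx/(2y) on the tangent vector (x', y') at the point (x, y) of y^2 = F x.  Since
   2y dy = F'(x) dx on the curve, dx/(2y) = dy/F'(x), which is the regular expression of this
   form at the points with y = 0. *)
Definition dx_over_2y (F : C -> C) (x y x' y' : C) : C :=
  if Ceq_dec y 0 then y' / C_derive F x else x' / (2 * y).

Definition arc_form {F : C -> C} (a : arc F) (t : R) : C :=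
  dx_over_2y F (ax a t) (ay a t) (dax a t) (day a t).

Definition CInt (f : R -> C) : C := RInt (V := C_R_CompleteNormedModule) f 0 1.

(* Integral of - x^k dx/(2y), for k < g.  In the chart at infinity, x = 1/u and
   y = w/u^(g+1) give - x^k dx/(2y) = u^(g-1-k) du/(2w). *)
Definition step_int {X : curve} (k : nat) (s : step X) : C :=
  match s with
  | Affine_arc a => CInt (fun t => - (ax a t ^ k * arc_form a t))
  | Infinite_arc a => CInt (fun t => ax a t ^ (genus X - 1 - k) * arc_form a t)
  end.

Definition path_int {X : curve} (k : nat) (g : path X) : C :=
  fold_right (fun s z => step_int k s + z) 0 g.

(** * Quotients of abelian groups, periods, Jacobians *)

Inductive generated {G : AbelianGroup} (A : G -> Prop) : G -> Prop :=
| generated_in z : A z -> generated A z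
| generated_zero : generated A zero
| generated_plus z z' : generated A z -> generated A z' -> generated A (plus z z')
| generated_opp z : generated A z -> generated A (opp z).

Definition coset {G : AbelianGroup} (L : G -> Prop) (z : G) : G -> Prop :=
  fun z' => L (minus z' z).

Definition quotient {G : AbelianGroup} (L : G -> Prop) : Type :=
  {A : G -> Prop | exists z, A = coset L z}.

Definition proj {G : AbelianGroup} (L : G -> Prop) (z : G) : quotient L :=
  exist _ (coset L z) (ex_intro _ z eq_refl).

(* [I] integrates a fixed vector of differentials along paths.  H_1(X, Z) is generated by the
   classes of closed paths. *)
Definition periods {X : curve} {G : AbelianGroup} (I : path X -> G) : G -> Prop :=
  generated (fun z => exists g P, joins g P P /\ z = I g).

Definition Jac {X : curve} {G : AbelianGroup} (I : path X -> G) : Type :=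
  quotient (periods I).

Definition path_between (X : curve) (P Q : point) : path X :=
  epsilon (inhabits []) (fun g => joins g P Q).

(* Integral from P to Q along a chosen path; only its class modulo the periods is used. *)
Definition integral {X : curve} {G : AbelianGroup} (I : path X -> G) (P Q : point) : G :=
  I (path_between X P Q).

(* The Abel-Jacobi map with base point at infinity, and its inverse. *)
Definition abel {X : curve} {G : AbelianGroup} (I : path X -> G) (S : point) : Jac I :=
  proj (periods I) (integral I Infinity S).

Definition abel_inv {X : curve} {G : AbelianGroup} (I : path X -> G) (p : Jac I) : point :=
  epsilon (inhabits Infinity) (fun S => on_curve X S /\ abel I S = p).

(** * Pullback of points along a morphism of degree 2 *)

Definition chi (P : point) : point :=
  match P with
  | Infinity => Infinity
  | Affine x y => Affine x (- y)
  end.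

(* The fibre of phi over S, as an (arbitrarily) ordered pair.  For a morphism of degree 2, a
   fibre with only one point consists of that point with multiplicity 2. *)
Definition fibre (X : curve) (phi : point -> point) (S : point) : point * point :=
  epsilon (inhabits (Infinity, Infinity)) (fun T =>
    on_curve X (fst T) /\ on_curve X (snd T) /\
    forall P, on_curve X P -> (phi P = S <-> P = fst T \/ P = snd T)).

Definition pullback {X : curve} {G : AbelianGroup} (I : path X -> G)
    (phi : point -> point) (O S : point) : Jac I :=
  let S1 := fst (fibre X phi S) in
  let S2 := snd (fibre X phi S) in
  proj (periods I) (plus (integral I O S1) (integral I (chi O) S2)).

(** * The curves V, E_1, E_2 and the maps between them *)

Section Curves.

Variables alpha beta : C.

Definition curve_V : curve :=
  Curve 2 [RtoC 0; RtoC 1; alpha ^ 2; beta ^ 2; alpha ^ 2 * beta ^ 2].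

Definition curve_E1 : curve :=
  Curve 1 [RtoC 0; RtoC 1; (alpha - beta) ^ 2 / (alpha * beta - 1) ^ 2].

Definition curve_E2 : curve :=
  Curve 1 [RtoC 0; RtoC 1; (alpha + beta) ^ 2 / (alpha * beta + 1) ^ 2].

(* At infinity x/(x -+ alpha beta)^2 and y/(x -+ alpha beta)^3 vanish; at the points with
   x = +- alpha beta they have poles. *)
Definition phi1 (P : point) : point :=
  match P with
  | Infinity => Affine 0 0
  | Affine x y =>
      if Ceq_dec x (alpha * beta) then Infinity else
      Affine ((alpha - beta) ^ 2 * x / (x - alpha * beta) ^ 2)
             ((alpha - beta) ^ 2 * y / ((alpha * beta - 1) * (x - alpha * beta) ^ 3))
  end.

Definition phi2 (P : point) : point :=
  match P with
  | Infinity => Affine 0 0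
  | Affine x y =>
      if Ceq_dec x (- (alpha * beta)) then Infinity else
      Affine ((alpha + beta) ^ 2 * x / (x + alpha * beta) ^ 2)
             (- ((alpha + beta) ^ 2 * y) / ((alpha * beta + 1) * (x + alpha * beta) ^ 3))
  end.

Definition C2 : AbelianGroup := prod_AbelianGroup C_AbelianGroup C_AbelianGroup.

(* omega = (omega_1, omega_3) = (- x dx/(2y), - dx/(2y)). *)
Definition omega (g : path curve_V) : C2 := (path_int 1 g, path_int 0 g).

Definition Omega1 (g : path curve_E1) : C_AbelianGroup := path_int 0 g.

Definition Omega2 (g : path curve_E2) : C_AbelianGroup := path_int 0 g.

Variable csqrt : C -> C.

Definition O1 : point :=
  Affine (alpha * beta)
    (alpha * beta * csqrt (alpha * beta) * (alpha * beta - 1) * (alpha - beta)).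

Definition O2 : point :=
  Affine (- (alpha * beta))
    (alpha * beta * csqrt (- (alpha * beta)) * (alpha * beta + 1) * (alpha + beta)).

Definition psi1_star (p : Jac Omega1) : Jac omega :=
  pullback omega phi1 O1 (abel_inv Omega1 p).

Definition psi2_star (p : Jac Omega2) : Jac omega :=
  pullback omega phi2 O2 (abel_inv Omega2 p).

Definition proj_V (z : C2) : Jac omega := proj (periods omega) z.

Definition proj_E1 (v : C) : Jac Omega1 := proj (periods Omega1) v.

Definition proj_E2 (v : C) : Jac Omega2 := proj (periods Omega2) v.

End Curves.

Definition psi_tilde (c d v : C) : C2 := (c * v, d * v).

(* Main.v *)
Require Import Defs.
From Stdlib Require Import Reals Lra Lia List ClassicalEpsilon.
From Stdlib Require Import FunctionalExtensionality PropExtensionality ProofIrrelevance.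
From Coquelicot Require Import Coquelicot.
Import ListNotations.
Open Scope R_scope.
Open Scope C_scope.

(** The map phi_1 is the quotient of V by the involution
    sigma (x, y) = (a^2/x, - a^3 y/x^3), where a = alpha beta.  Pointwise, omega + sigma^* omega
    is (c_1, d_1) times phi_1^* Omega_1.  So if a path on E_1 from P to Q lifts to a path g on V,
    then sigma g is the other lift, and integrating omega over g and over sigma g gives
    (c_1, d_1) times the integral of Omega_1 over the path ([transfers_of_lift]).  Hence the
    class of the pull-back of the divisor Q - P is the image under (c_1, d_1) of the integral of
    Omega_1 from P to Q; this relation is called [transfers].

    The relation has to be proved for every piecewise C^1 path on E_1, since such paths define
    the periods of Omega_1 and the Abel-Jacobi map.  It is additive in the path, so by real
    induction ([local_equivalence]) it is enough to prove it for short arcs issuing from a given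
    point.  The function field of V is generated over that of E_1 by
    s = (alpha - beta) (x + a)/(x - a), with s^2 = 4 a X + (alpha - beta)^2.  Where the radicand
    does not vanish, a short arc is lifted by a continuous square root ([lift_regular], and
    [lift_infinite] at infinity).  An arc which issues from a branch point may return to it
    infinitely often, and then it need not lift to a C^1 arc.  Translation by a point of order 2
    avoids this difficulty: it preserves Omega_1 and can be chosen to move the branch
    point to a point where lifting is possible.  A quadratic arc n with the same end points as
    the given arc lifts directly; the translates of n and of the given arc lift too and have the
    same end points, so that the integrals over n and over the given arc have the same image
    modulo the periods of omega ([nbhd_branch]).

    It follows that (c_1, d_1) maps the periods of Omega_1 to periods of omega
    ([psi_lift_periods]), and that the pull-back of a point S of E_1 is (c_1, d_1) times any
    integral of Omega_1 from infinity to S.  To conclude for all v one needs in addition that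
    the Abel-Jacobi map of E_1 is surjective ([all_integrals]).  For this one flows along the
    vector field dual to Omega_1: a polynomial vector field in each chart, whose integral
    curves are given by power series with a radius of convergence that is uniform on bounded
    sets ([quadratic_flow]).  Both curves are connected ([connected]), so that all the integrals
    in question are taken along actual paths.

    Finally phi_2 for (alpha, beta) is phi_1 for (alpha, - beta), which reduces the second half
    of the theorem to the first. *)

(** * Calculus of complex functions of a real variable *)

Local Notation in01 t := (0 <= t <= 1)%R (only parsing).

Definition cder (f : R -> C) (t : R) (l : C) : Prop :=
  is_derive (K := R_AbsRing) (V := C_R_NormedModule) f t l.

Lemma cder_iff (f : R -> C) (t : R) (l : C) :
  cder f t l <->
  is_derive (fun s => Re (f s)) t (Re l) /\ is_derive (fun s => Im (f s)) t (Im l).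
Proof.
  unfold cder, is_derive. split.
  - intros H. split.
    + apply (filterdiff_comp' (K := R_AbsRing) (U := R_NormedModule)
        (V := C_R_NormedModule) (W := R_NormedModule) f Re t
        (fun y => scal y l) Re H).
      apply filterdiff_linear. apply (is_linear_fst (K := R_AbsRing) (U := R_NormedModule) (V := R_NormedModule)).
    + apply (filterdiff_comp' (K := R_AbsRing) (U := R_NormedModule)
        (V := C_R_NormedModule) (W := R_NormedModule) f Im t
        (fun y => scal y l) Im H).
      apply filterdiff_linear. apply (is_linear_snd (K := R_AbsRing) (U := R_NormedModule) (V := R_NormedModule)).
  - intros [H1 H2].
    pose proof (filterdiff_comp'_2 (K := R_AbsRing) (T := R_NormedModule) (U := R_NormedModule)
      (V := R_NormedModule) (W := C_R_NormedModule) (fun s => Re (f s)) (fun s => Im (f s))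
      (fun a b => (a, b)) t (fun y => scal y (Re l)) (fun y => scal y (Im l))
      (fun a b => (a, b)) H1 H2) as H3.
    apply (filterdiff_ext (U := R_NormedModule) (V := C_R_NormedModule)
             (fun y => (Re (f y), Im (f y)))).
    { intros y. unfold Re, Im. symmetry. apply surjective_pairing. }
    apply H3.
    apply (filterdiff_ext (fun t : R * R => t)).
    { intros [u v]; reflexivity. }
    apply (filterdiff_ext_lin _ (fun t : R * R => t)).
    { apply filterdiff_id. }
    intros [u v]; reflexivity.
Qed.

Lemma ccont_iff {U : UniformSpace} (f : U -> C) (t : U) :
  continuous f t <->
  continuous (fun s => Re (f s)) t /\ continuous (fun s => Im (f s)) t.
Proof.
  split.
  - intros H. split.
    + apply (continuous_comp f Re); [exact H |]. destruct (f t). apply continuous_fst.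
    + apply (continuous_comp f Im); [exact H |]. destruct (f t). apply continuous_snd.
  - intros [H1 H2].
    apply (continuous_ext (fun s => (Re (f s), Im (f s)))).
    { intros y. unfold Re, Im. symmetry. apply surjective_pairing. }
    apply (continuous_comp_2 (fun s => Re (f s)) (fun s => Im (f s)) (fun a b => (a, b)) t H1 H2).
    apply (continuous_ext (fun t : R * R => t)).
    { intros [u v]; reflexivity. }
    apply continuous_id.
Qed.

Lemma cder_cont f t l : cder f t l -> continuous f t.
Proof.
  intros H. apply (ex_derive_continuous (K := R_AbsRing) (V := C_R_NormedModule)).
  exists l. exact H.
Qed.

Lemma cder_eq f t l l' : cder f t l -> l = l' -> cder f t l'.
Proof. intros H <-; exact H. Qed.

Lemma cder_unique f t l l' : cder f t l -> cder f t l' -> l = l'.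
Proof.
  intros H H'. apply cder_iff in H, H'. destruct H as [H1 H2], H' as [H3 H4].
  apply injective_projections.
  - apply is_derive_unique in H1, H3. unfold Re in *. congruence.
  - apply is_derive_unique in H2, H4. unfold Im in *. congruence.
Qed.

Lemma cder_const (c : C) t : cder (fun _ => c) t 0.
Proof. apply cder_iff; split; apply @is_derive_const. Qed.

Lemma cder_plus f g t l m : cder f t l -> cder g t m -> cder (fun s => f s + g s) t (l + m).
Proof. intros H H'; exact (is_derive_plus (V := C_R_NormedModule) f g t l m H H'). Qed.

Lemma cder_opp f t l : cder f t l -> cder (fun s => - f s) t (- l).
Proof. intros H; exact (is_derive_opp (V := C_R_NormedModule) f t l H). Qed.

Lemma is_derive_Rmult (u v : R -> R) (t du dv : R) :
  is_derive u t du -> is_derive v t dv ->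
  is_derive (fun s => (u s * v s)%R) t (du * v t + u t * dv)%R.
Proof. intros Hu Hv. apply (is_derive_mult u v t du dv Hu Hv). intros; apply Rmult_comm. Qed.

Lemma cder_mult f g t l m :
  cder f t l -> cder g t m -> cder (fun s => f s * g s) t (l * g t + f t * m).
Proof.
  intros H H'. apply cder_iff in H, H'. destruct H as [H1 H2], H' as [H3 H4].
  apply cder_iff; split.
  - eapply is_derive_ext; [intros s; reflexivity |].
    evar_last. { apply @is_derive_minus; apply is_derive_Rmult; eassumption. }
    unfold minus, plus, opp, Re, Im; simpl; ring.
  - eapply is_derive_ext; [intros s; reflexivity |].
    evar_last. { apply @is_derive_plus; apply is_derive_Rmult; eassumption. }
    unfold minus, plus, opp, Re, Im; simpl; ring.
Qed.

Lemma ccont_const {U : UniformSpace} (c : C) (t : U) : continuous (fun _ : U => c) t.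
Proof. apply continuous_const. Qed.

Lemma ccont_plus {U : UniformSpace} (f g : U -> C) (t : U) :
  continuous f t -> continuous g t -> continuous (fun s => f s + g s) t.
Proof.
  intros H H'; exact (continuous_plus (V := C_R_NormedModule) f g t H H').
Qed.

Lemma ccont_opp {U : UniformSpace} (f : U -> C) (t : U) : continuous f t -> continuous (fun s => - f s) t.
Proof. intros H; exact (continuous_opp (V := C_R_NormedModule) f t H). Qed.

Lemma ccont_mult {U : UniformSpace} (f g : U -> C) (t : U) :
  continuous f t -> continuous g t -> continuous (fun s => f s * g s) t.
Proof.
  intros H H'. apply ccont_iff in H, H'. destruct H as [H1 H2], H' as [H3 H4].
  apply ccont_iff; split; simpl.
  - apply (continuous_minus (V := R_NormedModule)); apply (continuous_mult (K := R_AbsRing)); assumption.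
  - apply (continuous_plus (V := R_NormedModule)); apply (continuous_mult (K := R_AbsRing)); assumption.
Qed.

Lemma norm2_pos (z : C) : z <> 0 -> (0 < Re z * Re z + Im z * Im z)%R.
Proof.
  intros Hz. destruct z as [a b]; unfold Re, Im; simpl.
  destruct (Req_dec a 0) as [-> | Ha].
  - destruct (Req_dec b 0) as [-> | Hb]; [exfalso; apply Hz; reflexivity |].
    assert (0 < b * b)%R by (apply Rsqr_pos_lt; assumption). lra.
  - assert (0 < a * a)%R by (apply Rsqr_pos_lt; assumption).
    assert (0 <= b * b)%R by apply Rle_0_sqr. lra.
Qed.

Lemma Cinv_parts (z : C) :
  / z = ((Re z / (Re z * Re z + Im z * Im z))%R, (- Im z / (Re z * Re z + Im z * Im z))%R).
Proof. unfold Cinv, Re, Im. simpl. rewrite !Rmult_1_r. reflexivity. Qed.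

(** Differentiability is read off from the formula for the real and imaginary parts of [/ z];
    the value of the derivative then follows by differentiating [f * / f = 1]. *)
Lemma cder_inv (f : R -> C) t l : f t <> 0 -> cder f t l -> cder (fun s => / f s) t (- (l / (f t * f t))).
Proof.
  intros Hf H. pose proof (norm2_pos _ Hf) as HN. pose proof H as H0.
  apply cder_iff in H. destruct H as [H1 H2].
  assert (E : exists m, cder (fun s => / f s) t m).
  { assert (HM : forall u v du dv, is_derive u t du -> is_derive v t dv ->
            is_derive (fun s => (u s * v s)%R) t (du * v t + u t * dv)%R).
    { intros u v du dv Hu Hv. apply (is_derive_mult u v t du dv Hu Hv).
      intros; apply Rmult_comm. }
    pose proof (@is_derive_plus R_AbsRing _ _ _ t _ _ (is_derive_Rmult _ _ _ _ _ H1 H1) (is_derive_Rmult _ _ _ _ _ H2 H2)) as HD.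
    assert (HI := is_derive_inv _ t _ HD).
    assert (HN' : plus (Re (f t) * Re (f t))%R (Im (f t) * Im (f t))%R <> 0%R).
    { unfold plus; simpl. lra. }
    specialize (HI HN').
    eexists. apply cder_iff. 
    split.
    - eapply is_derive_ext. { intros s. rewrite (Cinv_parts (f s)). reflexivity. }
      match goal with |- is_derive _ _ (Re ?m) => instantiate (1 := (_, _)) end.
      apply (is_derive_Rmult _ _ _ _ _ H1 HI).
    - eapply is_derive_ext. { intros s. rewrite (Cinv_parts (f s)). reflexivity. }
      apply (is_derive_Rmult _ _ _ _ _ (is_derive_opp _ _ _ H2) HI). }
  destruct E as [m Hm].
  assert (HP := cder_mult _ _ _ _ _ H0 Hm).
  assert (HC : cder (fun s => f s * / f s) t 0).
  { apply (is_derive_ext_loc (K := R_AbsRing) (V := C_R_NormedModule) (fun _ => RtoC 1)).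
    2: apply cder_const.
    assert (Hloc : locally t (fun s => (0 < Re (f s) * Re (f s) + Im (f s) * Im (f s))%R)).
    { assert (Hc : continuous (fun s => (Re (f s) * Re (f s) + Im (f s) * Im (f s))%R) t).
      { apply cder_cont in H0. apply ccont_iff in H0. destruct H0.
        apply (continuous_plus (V := R_NormedModule)); apply (continuous_mult (K := R_AbsRing)); assumption. }
      apply (Hc (fun r => (0 < r)%R)). apply (open_gt 0%R). exact HN. }
    eapply filter_imp; [| exact Hloc]. simpl. intros s Hs.
    symmetry. apply Cinv_r. intros E. rewrite E in Hs. unfold Re, Im in Hs; simpl in Hs. lra. }
  assert (E := cder_unique _ _ _ _ HP HC).
  eapply cder_eq; [exact Hm |].
  assert (E2 : m = (l * / f t + f t * m - l * / f t) / f t) by (field; exact Hf).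
  rewrite E2, E. field. exact Hf.
Qed.

(** The derivative is two-sided at 0 and 1, as it is for arcs. *)
Definition isC1 (f df : R -> C) : Prop :=
  forall t, in01 t -> cder f t (df t) /\ continuous df t.

Lemma C1_cont f df t : isC1 f df -> in01 t -> continuous f t.
Proof. intros H Ht. destruct (H t Ht) as [H1 _]. eapply cder_cont; eassumption. Qed.

Lemma C1_const c : isC1 (fun _ => c) (fun _ => 0).
Proof. intros t _; split; [apply cder_const | apply ccont_const]. Qed.

Lemma C1_plus f df g dg : isC1 f df -> isC1 g dg -> isC1 (fun t => f t + g t) (fun t => df t + dg t).
Proof.
  intros Hf Hg t Ht. destruct (Hf t Ht), (Hg t Ht). split.
  - apply cder_plus; assumption.
  - apply ccont_plus; assumption.
Qed.

Lemma C1_opp f df : isC1 f df -> isC1 (fun t => - f t) (fun t => - df t).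
Proof.
  intros Hf t Ht. destruct (Hf t Ht). split.
  - apply cder_opp; assumption.
  - apply ccont_opp; assumption.
Qed.

Lemma C1_minus f df g dg : isC1 f df -> isC1 g dg -> isC1 (fun t => f t - g t) (fun t => df t - dg t).
Proof. intros Hf Hg. apply (C1_plus _ _ _ _ Hf (C1_opp _ _ Hg)). Qed.

Lemma C1_mult f df g dg :
  isC1 f df -> isC1 g dg -> isC1 (fun t => f t * g t) (fun t => df t * g t + f t * dg t).
Proof.
  intros Hf Hg t Ht. destruct (Hf t Ht) as [H1 H2], (Hg t Ht) as [H3 H4]. split.
  - apply cder_mult; assumption.
  - apply ccont_plus; apply ccont_mult; try assumption; eapply cder_cont; eassumption.
Qed.

Lemma ccont_inv {U : UniformSpace} (f : U -> C) (t : U) : f t <> 0 -> continuous f t -> continuous (fun s => / f s) t.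
Proof.
  intros Hf H. pose proof (norm2_pos _ Hf) as HN.
  apply ccont_iff in H. destruct H as [H1 H2].
  assert (HD : continuous (fun s => (/ (Re (f s) * Re (f s) + Im (f s) * Im (f s)))%R) t).
  { apply (continuous_comp (fun s => (Re (f s) * Re (f s) + Im (f s) * Im (f s))%R) Rinv);
      [| apply continuous_Rinv; lra].
    apply (continuous_plus (V := R_NormedModule)); apply (continuous_mult (K := R_AbsRing)); assumption. }
  apply ccont_iff; split.
  - apply (continuous_ext (fun s => Re (f s) * / (Re (f s) * Re (f s) + Im (f s) * Im (f s)))%R).
    { intros s. rewrite (Cinv_parts (f s)). reflexivity. }
    apply (continuous_mult (K := R_AbsRing)); assumption.
  - apply (continuous_ext (fun s => - Im (f s) * / (Re (f s) * Re (f s) + Im (f s) * Im (f s)))%R).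
    { intros s. rewrite (Cinv_parts (f s)). reflexivity. }
    apply (continuous_mult (K := R_AbsRing)); [| assumption].
    apply (continuous_opp (V := R_NormedModule)). assumption.
Qed.

Lemma C1_inv (f df : R -> C) :
  isC1 f df -> (forall t, in01 t -> f t <> 0) ->
  isC1 (fun t => / f t) (fun t => - (df t / (f t * f t))).
Proof.
  intros Hf Hn t Ht. destruct (Hf t Ht) as [H1 H2]. split.
  - apply cder_inv; auto.
  - apply ccont_opp. unfold Cdiv. apply ccont_mult; [assumption |].
    assert (continuous f t) by (eapply cder_cont; eassumption).
    apply (ccont_inv (fun t => f t * f t)).
    + apply Cmult_neq_0; auto.
    + apply ccont_mult; assumption.
Qed.

Lemma C1_div (f df g dg : R -> C) :
  isC1 f df -> isC1 g dg -> (forall t, in01 t -> g t <> 0) ->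
  isC1 (fun t => f t / g t) (fun t => df t * / g t + f t * - (dg t / (g t * g t))).
Proof. intros Hf Hg Hn. apply (C1_mult _ _ _ _ Hf (C1_inv _ _ Hg Hn)). Qed.

Lemma C1_id : isC1 RtoC (fun _ => 1).
Proof.
  intros t _; split; [| apply ccont_const].
  apply cder_iff; split.
  - apply @is_derive_id.
  - apply (is_derive_const (V := R_NormedModule) 0%R).
Qed.

(** The principal square root, by its real and imaginary parts; it is used on the half-plane of
    positive real part, where it is smooth. *)
Definition psqrt (z : C) : C :=
  (sqrt ((Cmod z + Re z) / 2), (Im z / (2 * sqrt ((Cmod z + Re z) / 2)))%R).

Lemma psqrt_pos_aux z : (0 < Re z)%R -> (0 < (Cmod z + Re z) / 2)%R.
Proof. intros H. pose proof (Cmod_ge_0 z). lra. Qed.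

Lemma psqrt_sqr z : (0 < Re z)%R -> psqrt z * psqrt z = z.
Proof.
  intros H. pose proof (psqrt_pos_aux z H) as H0.
  pose proof (sqrt_lt_R0 _ H0) as H1. pose proof (sqrt_sqrt _ (Rlt_le _ _ H0)) as H2.
  unfold psqrt. set (r := sqrt ((Cmod z + Re z) / 2)) in *.
  assert (H3 : (Cmod z * Cmod z = Re z * Re z + Im z * Im z)%R).
  { pose proof (Cmod2_alt z) as E. simpl in E. rewrite !Rmult_1_r in E. exact E. }
  apply injective_projections; simpl.
  - change (fst z) with (Re z).
    assert (E : (Im z / (2 * r) * (Im z / (2 * r)) = (Im z * Im z) / (4 * (r * r)))%R) by (field; lra).
    rewrite E. replace (Im z * Im z)%R with ((Cmod z - Re z) * (Cmod z + Re z))%R by (ring_simplify; lra).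
    rewrite H2. field. lra.
  - change (snd z) with (Im z). field. lra.
Qed.

Lemma psqrt_re z : (0 < Re z)%R -> (0 < Re (psqrt z))%R.
Proof. intros H. unfold psqrt; simpl. apply sqrt_lt_R0, psqrt_pos_aux, H. Qed.

Lemma psqrt_neq0 z : (0 < Re z)%R -> psqrt z <> 0.
Proof. intros H E. pose proof (psqrt_re z H) as H1. rewrite E in H1. simpl in H1. lra. Qed.

Lemma re_pos_neq0 (z : C) : (0 < Re z)%R -> z <> 0.
Proof. intros H E. rewrite E in H. simpl in H. lra. Qed.

Lemma psqrt_unique z w : (0 < Re z)%R -> (0 < Re w)%R -> w * w = z -> w = psqrt z.
Proof.
  intros Hz Hw E. pose proof (psqrt_re z Hz) as Hp. pose proof (psqrt_sqr z Hz) as E2.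
  assert (E3 : (w - psqrt z) * (w + psqrt z) = 0).
  { replace ((w - psqrt z) * (w + psqrt z)) with (w * w - psqrt z * psqrt z) by ring.
    rewrite E, E2. ring. }
  assert (H4 : w + psqrt z <> 0).
  { apply re_pos_neq0. change (0 < Re w + Re (psqrt z))%R. lra. }
  replace w with ((w - psqrt z) * (w + psqrt z) / (w + psqrt z) + psqrt z) by (field; exact H4).
  rewrite E3. field. exact H4.
Qed.

Lemma ex_derive_psqrt_parts (u v : R -> R) (t : R) :
  ex_derive u t -> ex_derive v t -> (0 < u t)%R ->
  ex_derive (fun s => sqrt ((sqrt (u s * u s + v s * v s) + u s) / 2)) t.
Proof.
  intros X1 X2 Hp.
  assert (HN : (0 < u t * u t + v t * v t)%R).
  { pose proof (Rmult_lt_0_compat _ _ Hp Hp). pose proof (Rle_0_sqr (v t)). unfold Rsqr in *. lra. }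
  auto_derive. repeat split; auto.
  pose proof (sqrt_lt_R0 _ HN). lra.
Qed.

(** As for the inverse: differentiability comes from the explicit formula, and the value from
    differentiating the square. *)
Lemma cder_psqrt (f : R -> C) t l :
  (0 < Re (f t))%R -> cder f t l -> cder (fun s => psqrt (f s)) t (l / (2 * psqrt (f t))).
Proof.
  intros Hp H. pose proof H as H0. apply cder_iff in H. destruct H as [H1 H2].
  pose proof (norm2_pos _ (re_pos_neq0 _ Hp)) as HN.
  assert (E : exists m, cder (fun s => psqrt (f s)) t m).
  { assert (Er : ex_derive (fun s => sqrt ((sqrt (Re (f s) * Re (f s) + Im (f s) * Im (f s)) + Re (f s)) / 2)) t).
    { apply ex_derive_psqrt_parts; [eexists; eassumption | eexists; eassumption | exact Hp]. }
    assert (Em : forall z, Cmod z = sqrt (Re z * Re z + Im z * Im z)).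
    { intros z. unfold Cmod, Re, Im. f_equal. simpl. ring. }
    assert (Er' : ex_derive (fun s => sqrt ((Cmod (f s) + Re (f s)) / 2)) t).
    { eapply ex_derive_ext; [| exact Er]. intros s. simpl. rewrite Em. reflexivity. }
    destruct Er' as [m1 Hm1].
    assert (Er2 : ex_derive (fun s => Im (f s) / (2 * sqrt ((Cmod (f s) + Re (f s)) / 2)))%R t).
    { apply ex_derive_div. { eexists; eassumption. }
      - apply (ex_derive_scal (fun s => sqrt ((Cmod (f s) + Re (f s)) / 2))). eexists; eassumption.
      - pose proof (sqrt_lt_R0 _ (psqrt_pos_aux _ Hp)). lra. }
    destruct Er2 as [m2 Hm2].
    exists (m1, m2). apply cder_iff. split; assumption. }
  destruct E as [m Hm].
  assert (HP := cder_mult _ _ _ _ _ Hm Hm).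
  assert (HC : cder (fun s => psqrt (f s) * psqrt (f s)) t l).
  { apply (is_derive_ext_loc (K := R_AbsRing) (V := C_R_NormedModule) f); [| exact H0].
    assert (Hc : continuous (fun s => Re (f s)) t).
    { apply cder_cont in H0. apply ccont_iff in H0. apply H0. }
    assert (Hloc : locally t (fun s => (0 < Re (f s))%R)).
    { apply (Hc (fun r => (0 < r)%R)). apply (open_gt 0%R). exact Hp. }
    eapply filter_imp; [| exact Hloc]. simpl. intros s Hs. symmetry. apply psqrt_sqr, Hs. }
  assert (E := cder_unique _ _ _ _ HP HC). simpl in E.
  eapply cder_eq; [exact Hm |].
  rewrite <- E. field. apply psqrt_neq0, Hp.
Qed.

Lemma C1_psqrt (f df : R -> C) :
  isC1 f df -> (forall t, in01 t -> (0 < Re (f t))%R) ->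
  isC1 (fun t => psqrt (f t)) (fun t => df t / (2 * psqrt (f t))).
Proof.
  intros Hf Hp t Ht. destruct (Hf t Ht) as [H1 H2]. split.
  - apply cder_psqrt; auto.
  - unfold Cdiv. apply ccont_mult; [assumption |].
    apply (ccont_inv (fun s => 2 * psqrt (f s))).
    + apply Cmult_neq_0; [intros E; injection E; lra | apply psqrt_neq0; auto].
    + apply ccont_mult; [apply ccont_const |]. eapply cder_cont. apply cder_psqrt; eauto.
Qed.

Lemma C1_ext (f g df dg : R -> C) :
  (forall t, f t = g t) -> (forall t, in01 t -> df t = dg t) ->
  (forall t, in01 t -> continuous dg t) -> isC1 f df -> isC1 g dg.
Proof.
  intros E E' Hc H t Ht. destruct (H t Ht) as [H1 H2]. split; [| auto].
  rewrite <- E' by assumption. apply (is_derive_ext (V := C_R_NormedModule) f); assumption.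
Qed.

(** * Integrals over the unit interval and real induction *)

(** The integrands below are controlled on [0,1] only.  Composing with the retraction of the line
    onto [0,1] makes them continuous everywhere without changing their integrals. *)
Definition clamp (t : R) : R := Rmax 0 (Rmin 1 t).

Lemma clamp_range t : (0 <= clamp t <= 1)%R.
Proof. unfold clamp, Rmax, Rmin. repeat destruct Rle_dec; lra. Qed.

Lemma clamp_id t : in01 t -> clamp t = t.
Proof. intros H. unfold clamp, Rmax, Rmin. repeat destruct Rle_dec; lra. Qed.

Lemma clamp_cont t : continuous clamp t.
Proof.
  apply (filterlim_locally (F := locally t) clamp (clamp t)). intros eps. exists eps. intros s Hs.
  change (Rabs (clamp s - clamp t) < eps)%R. change (Rabs (s - t) < eps)%R in Hs.
  eapply Rle_lt_trans; [| exact Hs].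
  unfold clamp, Rmax, Rmin. repeat destruct Rle_dec; unfold Rabs; repeat destruct Rcase_abs; lra.
Qed.

Definition icont (f : R -> C) : Prop := forall t, continuous (fun s => f (clamp s)) t.

Lemma cont_icont (f : R -> C) : (forall t, in01 t -> continuous f t) -> icont f.
Proof.
  intros H t. apply (continuous_comp clamp f); [apply clamp_cont | apply H, clamp_range].
Qed.

Lemma icont_mult f g : icont f -> icont g -> icont (fun t => f t * g t).
Proof. intros H H' t. apply (ccont_mult (fun s => f (clamp s)) (fun s => g (clamp s))); auto. Qed.

Lemma icont_opp f : icont f -> icont (fun t => - f t).
Proof. intros H t. apply (ccont_opp (fun s => f (clamp s))); auto. Qed.

Lemma icont_const c : icont (fun _ => c).
Proof. intros t. apply ccont_const. Qed.

Lemma icont_pow f k : icont f -> icont (fun t => f t ^ k).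
Proof.
  intros H; induction k as [|k IH]; simpl; [apply icont_const | apply icont_mult; assumption].
Qed.

Definition IntC (f : R -> C) (a b : R) : C :=
  RInt (V := C_R_CompleteNormedModule) (fun t => f (clamp t)) a b.

Lemma icont_ex f a b : icont f -> ex_RInt (V := C_R_CompleteNormedModule) (fun t => f (clamp t)) a b.
Proof. intros H. apply (ex_RInt_continuous (V := C_R_CompleteNormedModule)). intros z _. apply H. Qed.

Lemma CInt_IntC f : CInt f = IntC f 0 1.
Proof.
  unfold CInt, IntC. apply (RInt_ext (V := C_R_CompleteNormedModule)). rewrite Rmin_left, Rmax_right by lra.
  intros x Hx. rewrite clamp_id by lra. reflexivity.
Qed.

Lemma CInt_ext f g : (forall t, in01 t -> f t = g t) -> CInt f = CInt g.
Proof.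
  intros E. unfold CInt. apply (RInt_ext (V := C_R_CompleteNormedModule)). rewrite Rmin_left, Rmax_right by lra.
  intros x Hx. apply E; lra.
Qed.

Lemma IntC_Chasles f a b c : icont f -> IntC f a b + IntC f b c = IntC f a c.
Proof.
  intros H. apply (RInt_Chasles (V := C_R_CompleteNormedModule)); apply icont_ex, H.
Qed.

Lemma IntC_point f a : IntC f a a = 0.
Proof. apply (RInt_point (V := C_R_CompleteNormedModule)). Qed.

Lemma IntC_swap f a b : icont f -> IntC f b a = - IntC f a b.
Proof.
  intros H. pose proof (IntC_Chasles f a b a H) as E. rewrite IntC_point in E.
  replace (IntC f b a) with (IntC f a b + IntC f b a - IntC f a b) by ring. rewrite E. ring.
Qed.

Lemma IntC_sub f p q : icont f -> in01 p -> in01 q ->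
  CInt (fun t => RtoC (q - p) * f (p + (q - p) * t)%R) = IntC f p q.
Proof.
  intros H Hp Hq. unfold CInt, IntC.
  pose proof (RInt_comp_lin (V := C_R_CompleteNormedModule) (fun t => f (clamp t)) (q - p) p 0 1) as E.
  replace ((q - p) * 0 + p)%R with p in E by ring.
  replace ((q - p) * 1 + p)%R with q in E by ring.
  rewrite <- E by (apply icont_ex, H).
  apply (RInt_ext (V := C_R_CompleteNormedModule)). rewrite Rmin_left, Rmax_right by lra. intros t Ht.
  rewrite clamp_id.
  2:{ split.
      - assert (0 <= (1-t)*p)%R by (apply Rmult_le_pos; lra).
        assert (0 <= t*q)%R by (apply Rmult_le_pos; lra). lra.
      - assert (0 <= (1-t)*(1-p))%R by (apply Rmult_le_pos; lra).
        assert (0 <= t*(1-q))%R by (apply Rmult_le_pos; lra). lra. }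
  replace ((q - p) * t + p)%R with (p + (q - p) * t)%R by ring.
  apply injective_projections; unfold scal; simpl; unfold scal; simpl; unfold mult; simpl; ring.
Qed.

Lemma CInt_plus f g : icont f -> icont g -> CInt (fun t => f t + g t) = CInt f + CInt g.
Proof.
  intros H H'. rewrite !CInt_IntC. unfold IntC.
  apply (RInt_plus (V := C_R_CompleteNormedModule)); apply icont_ex; assumption.
Qed.

Lemma CInt_const c : CInt (fun _ => c) = c.
Proof.
  unfold CInt. rewrite (RInt_const (V := C_R_CompleteNormedModule)). 
  apply injective_projections; unfold scal; simpl; unfold scal; simpl; unfold mult; simpl; ring.
Qed.

Lemma CInt_parts f : icont f ->
  CInt f = (RInt (fun t => Re (f (clamp t))) 0 1, RInt (fun t => Im (f (clamp t))) 0 1).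
Proof.
  intros H. rewrite CInt_IntC. unfold IntC. apply (is_RInt_unique (V := C_R_CompleteNormedModule)).
  pose proof (RInt_correct (V := C_R_CompleteNormedModule) _ _ _ (icont_ex f 0 1 H)) as HI.
  apply (is_RInt_fct_extend_pair (U := R_NormedModule) (V := R_NormedModule)).
  - apply (RInt_correct (V := R_CompleteNormedModule)).
    eexists. exact (is_RInt_fct_extend_fst (U := R_NormedModule) (V := R_NormedModule) _ _ _ _ HI).
  - apply (RInt_correct (V := R_CompleteNormedModule)).
    eexists. exact (is_RInt_fct_extend_snd (U := R_NormedModule) (V := R_NormedModule) _ _ _ _ HI).
Qed.

Lemma CInt_scal c f : icont f -> CInt (fun t => c * f t) = c * CInt f.
Proof.
  intros H.
  assert (HR : forall a b, ex_RInt (V := R_CompleteNormedModule) (fun t => Re (f (clamp t))) a b).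
  { intros a b. apply ex_RInt_continuous. intros z _. apply (proj1 (ccont_iff _ _) (H z)). }
  assert (HI : forall a b, ex_RInt (V := R_CompleteNormedModule) (fun t => Im (f (clamp t))) a b).
  { intros a b. apply ex_RInt_continuous. intros z _. apply (proj1 (ccont_iff _ _) (H z)). }
  rewrite (CInt_parts f H).
  rewrite CInt_parts by (apply icont_mult; [apply icont_const | exact H]).
  assert (SR : forall k, RInt (fun t => (k * Re (f (clamp t)))%R) 0 1 =
                (k * RInt (fun t => Re (f (clamp t))) 0 1)%R).
  { intros k. exact (RInt_scal (V := R_CompleteNormedModule) _ 0 1 k (HR 0%R 1%R)). }
  assert (SI : forall k, RInt (fun t => (k * Im (f (clamp t)))%R) 0 1 =
                (k * RInt (fun t => Im (f (clamp t))) 0 1)%R).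
  { intros k. exact (RInt_scal (V := R_CompleteNormedModule) _ 0 1 k (HI 0%R 1%R)). }
  apply injective_projections; simpl; rewrite <- SR, <- SI.
  - apply (RInt_minus (V := R_CompleteNormedModule)).
    + apply (ex_RInt_scal (V := R_CompleteNormedModule)), HR.
    + apply (ex_RInt_scal (V := R_CompleteNormedModule)), HI.
  - rewrite Rplus_comm. rewrite <- (RInt_plus (V := R_CompleteNormedModule)).
    + apply (RInt_ext (V := R_CompleteNormedModule)). intros t _. apply Rplus_comm.
    + apply (ex_RInt_scal (V := R_CompleteNormedModule)), HR.
    + apply (ex_RInt_scal (V := R_CompleteNormedModule)), HI.
Qed.

(** Real induction: the supremum of the points related to 0 is related to them by local
    constancy, and for the same reason it cannot be less than 1. *)
Lemma local_equivalence (R : R -> R -> Prop) :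
  (forall t, in01 t -> R t t) ->
  (forall s t, in01 s -> in01 t -> R s t -> R t s) ->
  (forall r s t, in01 r -> in01 s -> in01 t ->
     R r s -> R s t -> R r t) ->
  (forall t0, in01 t0 -> exists d, (0 < d)%R /\
     forall t, in01 t -> (Rabs (t - t0) < d)%R -> R t0 t) ->
  R 0%R 1%R.
Proof.
  intros Hr Hs Ht Hl.
  destruct (completeness (fun t => in01 t /\ R 0%R t)) as [m [Hm1 Hm2]].
  { exists 1%R. intros t [H _]; lra. }
  { exists 0%R. split; [lra | apply Hr; lra]. }
  assert (Hm : in01 m).
  { split; [apply Hm1; split; [lra | apply Hr; lra] | apply Hm2; intros t [H _]; lra]. }
  destruct (Hl m Hm) as [d [Hd HR]].
  assert (H0 : exists t, in01 t /\ R 0%R t /\ (m - d < t <= m)%R).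
  { destruct (classic (exists t, in01 t /\ R 0%R t /\ (m - d < t <= m)%R)) as [H | H]; [exact H |].
    exfalso. assert (m <= m - d)%R; [| lra]. apply Hm2. intros t [Ht1 Ht2].
    destruct (Rle_lt_dec t (m - d)) as [|Hlt]; [assumption |].
    exfalso. apply H. exists t. split; [assumption | split; [assumption | split; [assumption |]]].
    apply Hm1. split; assumption. }
  destruct H0 as [t [Ht1 [Ht2 Ht3]]].
  assert (HRm : R 0%R m).
  { apply (Ht 0%R t m); try lra; [assumption |]. apply Hs; [lra | lra |]. apply HR; [lra |].
    unfold Rabs; destruct Rcase_abs; lra. }
  destruct (Req_dec m 1) as [-> | Hm3]; [assumption |].
  exfalso.
  set (t' := Rmin 1 (m + d / 2)).
  assert (Ht' : (m < t' <= 1)%R /\ (t' <= m + d / 2)%R).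
  { unfold t', Rmin; destruct Rle_dec; lra. }
  assert (t' <= m)%R; [| lra]. apply Hm1. split; [lra |].
  apply (Ht 0%R m t'); try lra; [assumption |]. apply HR; [lra |].
  unfold Rabs; destruct Rcase_abs; lra.
Qed.

Lemma cont_near (f : R -> C) t (P : C -> Prop) :
  continuous f t -> locally (f t) P -> exists d, (0 < d)%R /\ forall s, (Rabs (s - t) < d)%R -> P (f s).
Proof.
  intros H HP. destruct (H P HP) as [d Hd]. exists d. split; [apply cond_pos |]. exact Hd.
Qed.

Lemma locally_neq0 (z : C) : z <> 0 -> locally z (fun w : C => w <> 0).
Proof.
  intros Hz. pose proof (norm2_pos z Hz) as HN.
  assert (H : continuous (fun w : C => (Re w * Re w + Im w * Im w)%R) z).
  { destruct z as [a b]. apply (continuous_plus (V := R_NormedModule)); apply (continuous_mult (K := R_AbsRing));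
      try apply continuous_fst; apply continuous_snd. }
  assert (HL := H (fun r => (0 < r)%R) (open_gt 0%R _ HN)).
  eapply filter_imp; [| exact HL]. simpl. intros w Hw E. rewrite E in Hw. simpl in Hw. lra.
Qed.

Lemma locally_re_pos (z : C) : (0 < Re z)%R -> locally z (fun w : C => (0 < Re w)%R).
Proof.
  intros Hz. assert (H : continuous (fun w : C => Re w) z).
  { destruct z as [a b]. apply continuous_fst. }
  exact (H (fun r => (0 < r)%R) (open_gt 0%R _ Hz)).
Qed.

(** * Products of linear factors *)

(** A pair (p, q) stands for the linear form p + q x.  Both [fpol] and [fpol_inf] are products of
    such forms, so that the two charts of a curve are treated together. *)
Definition lin (a : C * C) (x : C) : C := fst a + snd a * x.

Fixpoint lprod (l : list (C * C)) (x : C) : C :=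
  match l with [] => 1 | a :: l' => lin a x * lprod l' x end.

Fixpoint dlprod (l : list (C * C)) (x : C) : C :=
  match l with [] => 0 | a :: l' => snd a * lprod l' x + lin a x * dlprod l' x end.

Lemma C1_lin_at a f t l : cder f t l -> cder (fun s => lin a (f s)) t (snd a * l).
Proof.
  intros H. unfold lin. eapply cder_eq.
  - apply cder_plus; [apply cder_const |]. apply cder_mult; [apply cder_const | exact H].
  - simpl. ring.
Qed.

Lemma cder_lprod l f t m :
  cder f t m -> cder (fun s => lprod l (f s)) t (dlprod l (f t) * m).
Proof.
  intros H. induction l as [|a l IH]; simpl.
  - eapply cder_eq; [apply cder_const | ring].
  - eapply cder_eq.
    + apply cder_mult; [apply C1_lin_at, H | exact IH].
    + simpl. ring.
Qed.

Lemma ccont_lprod {U : UniformSpace} l (f : U -> C) (t : U) : continuous f t -> continuous (fun s => lprod l (f s)) t.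
Proof.
  intros H. induction l as [|a l IH]; simpl; [apply ccont_const |].
  apply ccont_mult; [| exact IH]. unfold lin. apply ccont_plus; [apply ccont_const |].
  apply ccont_mult; [apply ccont_const | exact H].
Qed.

Lemma ccont_dlprod {U : UniformSpace} l (f : U -> C) (t : U) : continuous f t -> continuous (fun s => dlprod l (f s)) t.
Proof.
  intros H. induction l as [|a l IH]; simpl; [apply ccont_const |].
  apply ccont_plus; apply ccont_mult.
  - apply ccont_const.
  - apply ccont_lprod, H.
  - unfold lin. apply ccont_plus; [apply ccont_const |].
    apply ccont_mult; [apply ccont_const | exact H].
  - exact IH.
Qed.

Lemma C1_lprod l f df : isC1 f df -> isC1 (fun t => lprod l (f t)) (fun t => dlprod l (f t) * df t).
Proof.
  intros H t Ht. destruct (H t Ht) as [H1 H2]. split; [apply cder_lprod, H1 |].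
  apply ccont_mult; [apply ccont_dlprod; eapply cder_cont; eassumption | exact H2].
Qed.

Lemma Lim_quot (g : R -> R) x l : is_derive g x l ->
  Lim (fun y => ((g y - g x) / (y - x))%R) x = Finite l.
Proof.
  intros H. apply is_derive_Reals in H.
  apply is_lim_unique. apply is_lim_spec. intros eps.
  destruct (H eps (cond_pos eps)) as [d Hd]. exists d. intros y Hy Hne.
  change (Rabs (y - x) < d)%R in Hy.
  specialize (Hd (y - x)%R ltac:(lra) Hy).
  assert (E : forall v : R, (x + (v - x))%R = v) by (intros; ring).
  rewrite E in Hd. exact Hd.
Qed.

(** [C_derive] is a limit of difference quotients along a horizontal line, so it is determined by
    the chain rule along that line. *)
Lemma C_derive_of_chain (F dF : C -> C) :
  (forall f t l, cder f t l -> cder (fun s => F (f s)) t (dF (f t) * l)) ->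
  forall z, C_derive F z = dF z.
Proof.
  intros H z. unfold C_derive, C_lim.
  assert (Hg : cder (fun x : R => F (x, snd z)) (fst z) (dF z)).
  { eapply cder_eq.
    - apply (H (fun x => (x, snd z)) (fst z) 1). apply cder_iff. split; simpl.
      + apply @is_derive_id.
      + apply (is_derive_const (V := R_NormedModule) (snd z)).
    - rewrite <- surjective_pairing. ring. }
  apply cder_iff in Hg. destruct Hg as [H1 H2].
  assert (E : forall (w : C) (r : R), r <> 0%R -> w / RtoC r = ((fst w / r)%R, (snd w / r)%R)).
  { intros [a b] r Hr. apply injective_projections; simpl; field; lra. }
  assert (E2 : forall x : R, (x, snd z) - z = RtoC (x - fst z)).
  { intros x. apply injective_projections; simpl; ring. }
  assert (EL : forall (g h : R -> R), (forall x, x <> fst z -> g x = h x) ->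
     Lim g (fst z) = Lim h (fst z)).
  { intros g h Hgh. apply Lim_ext_loc. exists (mkposreal 1 Rlt_0_1). intros y _ Hy. symmetry. apply Hgh. exact Hy. }
  apply injective_projections; cbn [fst snd].
  - rewrite (EL _ (fun x => ((Re (F (x, snd z)) - Re (F (fst z, snd z))) / (x - fst z))%R)).
    + exact (f_equal real (Lim_quot (fun x => Re (F (x, snd z))) _ _ H1)).
    + intros x Hx. rewrite E2, E by lra. cbn [fst snd]. rewrite <- surjective_pairing. reflexivity.
  - rewrite (EL _ (fun x => ((Im (F (x, snd z)) - Im (F (fst z, snd z))) / (x - fst z))%R)).
    + exact (f_equal real (Lim_quot (fun x => Im (F (x, snd z))) _ _ H2)).
    + intros x Hx. rewrite E2, E by lra. cbn [fst snd]. rewrite <- surjective_pairing. reflexivity.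
Qed.

Definition resultant2 (a b : C * C) : C := fst a * snd b - fst b * snd a.

Inductive distinct_roots : list (C * C) -> Prop :=
| distinct_roots_nil : distinct_roots []
| distinct_roots_cons (a : C * C) (l : list (C * C)) : fst a <> 0 \/ snd a <> 0 ->
    (forall b, In b l -> resultant2 a b <> 0) -> distinct_roots l -> distinct_roots (a :: l).

Lemma lprod_zero l x : lprod l x = 0 -> exists a, In a l /\ lin a x = 0.
Proof.
  induction l as [|a l IH]; simpl; intros H.
  - exfalso. injection H; lra.
  - destruct (classic (lin a x = 0)) as [Ha | Ha]; [exists a; auto |].
    destruct IH as [b [Hb1 Hb2]]; [| exists b; auto].
    apply NNPP. intros Hn. exact (Cmult_neq_0 _ _ Ha Hn H).
Qed.

(** Simple roots: at a root of one factor the other factors are nonzero, because two linear forms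
    with a common root have zero resultant. *)
Lemma dlprod_nonzero l x : distinct_roots l -> lprod l x = 0 -> dlprod l x <> 0.
Proof.
  intros Hi. induction Hi as [|a l Ha Hd Hi IH]; simpl; intros H.
  - exfalso. injection H; lra.
  - destruct (classic (lin a x = 0)) as [E | E].
    + rewrite E. rewrite Cmult_0_l, Cplus_0_r. apply Cmult_neq_0.
      * intros E2. destruct Ha as [Ha | Ha]; [| auto]. apply Ha.
        unfold lin in E. rewrite E2 in E. rewrite <- E. ring.
      * intros E2. destruct (lprod_zero _ _ E2) as [b [Hb Eb]].
        apply (Hd b Hb). unfold resultant2, lin in *.
        replace (fst a) with (fst a + snd a * x - snd a * x) by ring. rewrite E.
        replace (fst b) with (fst b + snd b * x - snd b * x) by ring. rewrite Eb. ring.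
    + assert (E2 : lprod l x = 0).
      { apply NNPP. intros Hn. exact (Cmult_neq_0 _ _ E Hn H). }
      rewrite E2, Cmult_0_r, Cplus_0_l. apply Cmult_neq_0; auto.
Qed.

Definition aff_factors (X : curve) : list (C * C) := map (fun e => (- e, RtoC 1)) (roots X).
Definition inf_factors (X : curve) : list (C * C) :=
  (RtoC 0, RtoC 1) :: map (fun e => (RtoC 1, - e)) (roots X).

Lemma fpol_lprod X : fpol X = lprod (aff_factors X).
Proof.
  apply functional_extensionality. intros x. unfold fpol, aff_factors.
  induction (roots X) as [|e l IH]; simpl; [reflexivity |].
  rewrite IH. unfold lin; simpl. ring.
Qed.

Lemma fpol_inf_lprod X : fpol_inf X = lprod (inf_factors X).
Proof.
  apply functional_extensionality. intros x. unfold fpol_inf, inf_factors. simpl.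
  unfold lin at 1; simpl. f_equal; [ring |].
  induction (roots X) as [|e l IH]; simpl; [reflexivity |].
  rewrite IH. unfold lin; simpl. ring.
Qed.

Lemma C1_neq_0 : RtoC 1 <> RtoC 0.
Proof. intros E; injection E; lra. Qed.

Lemma aff_indep X : NoDup (roots X) -> distinct_roots (aff_factors X).
Proof.
  unfold aff_factors. induction 1 as [|e l Hn Hd IH]; simpl; constructor; auto.
  - right. apply C1_neq_0.
  - intros b Hb. apply in_map_iff in Hb. destruct Hb as [e' [<- He']].
    unfold resultant2; simpl. intros E. apply Hn. replace e with e'; [assumption |].
    replace e' with (- e * 1 - - e' * 1 + e) by ring. rewrite E. ring.
Qed.

Lemma inf_indep X : NoDup (roots X) -> distinct_roots (inf_factors X).
Proof.
  intros H. unfold inf_factors. constructor.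
  - right. apply C1_neq_0.
  - intros b Hb. apply in_map_iff in Hb. destruct Hb as [e' [<- He']].
    unfold resultant2; simpl. intros E. apply C1_neq_0.
    replace (RtoC 1) with (- (0 * - e' - 1 * 1)) by ring. rewrite E. ring.
  - induction H as [|e l Hn Hd IH]; simpl; constructor; auto.
    + left. apply C1_neq_0.
    + intros b Hb. apply in_map_iff in Hb. destruct Hb as [e' [<- He']].
      unfold resultant2; simpl. intros E. apply Hn. replace e with e'; [assumption |].
      replace e' with (- (1 * - e' - 1 * - e) * -(1) + e + (1 * - e' - 1 * - e) * - (1) + (e' - e)) by ring.
      replace (e' - e) with (- (1 * - e' - 1 * - e)) by ring. rewrite E. ring.
Qed.

(** * Arcs and the form dx/(2y) *)

Lemma deriv_zero_on (g : R -> R) t m :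
  in01 t -> (forall s, in01 s -> g s = 0%R) -> is_derive g t m -> m = 0%R.
Proof.
  intros Ht Hg H. apply is_derive_Reals in H.
  destruct (Req_dec m 0) as [|Hm]; [assumption |]. exfalso.
  assert (Hp : (0 < Rabs m)%R) by (apply Rabs_pos_lt; assumption).
  destruct (H (Rabs m) Hp) as [d Hd]. pose proof (cond_pos d) as Hd0.
  assert (E : exists h, h <> 0%R /\ (Rabs h < d)%R /\ (0 <= t + h <= 1)%R).
  { set (e := Rmin (d / 2) (1 / 2)).
    assert (He : (0 < e)%R /\ (e <= d / 2)%R /\ (e <= 1/2)%R).
    { unfold e, Rmin; destruct Rle_dec; lra. }
    destruct (Rle_dec t (1/2)).
    - exists e. split; [lra |]. split; [rewrite Rabs_pos_eq; lra | lra].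
    - exists (- e)%R. split; [lra |]. split; [rewrite Rabs_Ropp, Rabs_pos_eq; lra | lra]. }
  destruct E as [h [H1 [H2 H3]]]. specialize (Hd h H1 H2).
  rewrite (Hg _ H3), (Hg _ Ht) in Hd.
  replace ((0 - 0) / h - m)%R with (- m)%R in Hd by (field; assumption).
  rewrite Rabs_Ropp in Hd. lra.
Qed.

Lemma cder_zero_on (g : R -> C) t m :
  in01 t -> (forall s, in01 s -> g s = 0) -> cder g t m -> m = 0.
Proof.
  intros Ht Hg H. apply cder_iff in H. destruct H as [H1 H2].
  apply injective_projections; simpl.
  - refine (deriv_zero_on _ t _ Ht _ H1). intros s Hs. rewrite Hg by assumption. reflexivity.
  - refine (deriv_zero_on _ t _ Ht _ H2). intros s Hs. rewrite Hg by assumption. reflexivity.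
Qed.

Lemma C2_neq_0 : RtoC 2 <> 0.
Proof. intros E; injection E; lra. Qed.

Lemma arcx_C1 F (a : arc F) : isC1 (ax a) (dax a).
Proof. intros t Ht; split; [exact (arc_dax _ a t Ht) | exact (arc_cdax _ a t Ht)]. Qed.

Lemma arcy_C1 F (a : arc F) : isC1 (ay a) (day a).
Proof. intros t Ht; split; [exact (arc_day _ a t Ht) | exact (arc_cday _ a t Ht)]. Qed.

Section ArcForm.
Variable l : list (C * C).
Hypothesis Hl : distinct_roots l.

Lemma C_derive_lprod z : C_derive (lprod l) z = dlprod l z.
Proof. apply C_derive_of_chain. intros f t m H. apply cder_lprod, H. Qed.

Lemma smooth_point x y : y ^ 2 = lprod l x -> y <> 0 \/ dlprod l x <> 0.
Proof.
  intros H. destruct (Ceq_dec y 0) as [E | E]; [| left; exact E].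
  right. apply dlprod_nonzero; [exact Hl |]. rewrite <- H, E. simpl. ring.
Qed.

(** The two expressions dx/(2y) and dy/F'(x) of the form are captured by one characterisation
    with no division, valid at all points of the curve. *)
Lemma dx_over_2y_char x y x' y' z :
  y ^ 2 = lprod l x -> x' = 2 * y * z -> y' = dlprod l x * z -> dx_over_2y (lprod l) x y x' y' = z.
Proof.
  intros H H1 H2. unfold dx_over_2y. destruct (Ceq_dec y 0) as [E | E].
  - rewrite C_derive_lprod, H2. destruct (smooth_point _ _ H) as [|Hd]; [contradiction |].
    field. exact Hd.
  - rewrite H1. field. exact E.
Qed.

(** Differentiating y^2 = F x gives 2 y y' = F'(x) x'; dividing by whichever of 2y and F'(x) is
    nonzero gives the claim.  At t = 0 and t = 1 the identity y^2 = F x holds on one side only,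
    which still determines the two-sided derivative. *)
Lemma arc_ode (a : arc (lprod l)) t : in01 t ->
  dax a t = 2 * ay a t * arc_form a t /\ day a t = dlprod l (ax a t) * arc_form a t.
Proof.
  intros Ht.
  assert (E : 2 * ay a t * day a t = dlprod l (ax a t) * dax a t).
  { assert (HD : cder (fun s => ay a s * ay a s - lprod l (ax a s)) t
        ((day a t * ay a t + ay a t * day a t) - dlprod l (ax a t) * dax a t)).
    { apply (cder_plus (fun s => ay a s * ay a s) (fun s => - lprod l (ax a s))).
      - apply cder_mult; exact (arc_day _ a t Ht).
      - apply cder_opp, cder_lprod. exact (arc_dax _ a t Ht). }
    assert (HZ : forall s, in01 s -> ay a s * ay a s - lprod l (ax a s) = 0).
    { intros s Hs. rewrite <- (arc_on _ a s Hs). simpl. ring. }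
    assert (HD0 := cder_zero_on _ _ _ Ht HZ HD).
    replace (2 * ay a t * day a t) with
      ((day a t * ay a t + ay a t * day a t - dlprod l (ax a t) * dax a t) + dlprod l (ax a t) * dax a t) by ring.
    rewrite HD0. ring. }
  unfold arc_form, dx_over_2y. destruct (Ceq_dec (ay a t) 0) as [Ey | Ey].
  - rewrite C_derive_lprod.
    destruct (smooth_point _ _ (arc_on _ a t Ht)) as [|Hd]; [contradiction |].
    split; [| field; exact Hd].
    rewrite Ey. rewrite Ey in E.
    replace (dax a t) with ((dlprod l (ax a t) * dax a t) / dlprod l (ax a t)) by (field; exact Hd).
    rewrite <- E. field. exact Hd.
  - split.
    + field. exact Ey.
    + replace (day a t) with ((2 * ay a t * day a t) / (2 * ay a t)).
      * rewrite E. field. exact Ey.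
      * field. exact Ey.
Qed.

Lemma arc_form_char (a : arc (lprod l)) t z : in01 t ->
  dax a t = 2 * ay a t * z -> day a t = dlprod l (ax a t) * z -> arc_form a t = z.
Proof. intros Ht H1 H2. apply dx_over_2y_char; [apply arc_on, Ht | exact H1 | exact H2]. Qed.

Lemma arc_icontx (a : arc (lprod l)) : icont (ax a).
Proof. apply cont_icont. intros t Ht. eapply C1_cont; [apply arcx_C1 | exact Ht]. Qed.

Lemma icont_near (f : R -> C) t : icont f -> f (clamp t) <> 0 ->
  locally t (fun s => f (clamp s) <> 0).
Proof.
  intros H Hn. exact (H t _ (locally_neq0 _ Hn)).
Qed.

(** Near each parameter the form is a quotient of continuous functions, with denominator 2y or
    F'(x). *)
Lemma arc_form_icont (a : arc (lprod l)) : icont (arc_form a).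
Proof.
  intros t.
  assert (Hx := arc_icontx a).
  assert (Hy : icont (ay a)).
  { apply cont_icont. intros s Hs. eapply C1_cont; [apply arcy_C1 | exact Hs]. }
  assert (Hdx : icont (dax a)) by (apply cont_icont; intros s Hs; exact (arc_cdax _ a s Hs)).
  assert (Hdy : icont (day a)) by (apply cont_icont; intros s Hs; exact (arc_cday _ a s Hs)).
  destruct (smooth_point _ _ (arc_on _ a _ (clamp_range t))) as [Hn | Hn].
  - apply (continuous_ext_loc _ (fun s => dax a (clamp s) / (2 * ay a (clamp s)))).
    + eapply filter_imp; [| exact (icont_near (ay a) t Hy Hn)].
      simpl. intros s Hs. destruct (arc_ode a _ (clamp_range s)) as [E _]. rewrite E.
      field. exact Hs.
    + unfold Cdiv. apply ccont_mult; [apply Hdx |].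
      apply (ccont_inv (fun s => 2 * ay a (clamp s))).
      * apply Cmult_neq_0; [apply C2_neq_0 | exact Hn].
      * apply ccont_mult; [apply ccont_const | apply Hy].
  - assert (Hd : icont (fun s => dlprod l (ax a s))).
    { intros s. apply ccont_dlprod, Hx. }
    apply (continuous_ext_loc _ (fun s => day a (clamp s) / dlprod l (ax a (clamp s)))).
    + eapply filter_imp; [| exact (icont_near _ t Hd Hn)].
      simpl. intros s Hs. destruct (arc_ode a _ (clamp_range s)) as [_ E]. rewrite E.
      field. exact Hs.
    + unfold Cdiv. apply ccont_mult; [apply Hdy |].
      apply (ccont_inv (fun s => dlprod l (ax a (clamp s)))); [exact Hn | apply Hd].
Qed.

End ArcForm.

Definition C1_arc (F : C -> C) (x dx y dy : R -> C) (Hx : isC1 x dx) (Hy : isC1 y dy)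
  (Ho : forall t, in01 t -> y t ^ 2 = F (x t)) : arc F :=
  Arc F x y dx dy Ho (fun t Ht => proj1 (Hx t Ht)) (fun t Ht => proj1 (Hy t Ht))
    (fun t Ht => proj2 (Hx t Ht)) (fun t Ht => proj2 (Hy t Ht)).

(** Both p < q and p > q are allowed: the latter reverses the direction. *)
Definition reparam (p q t : R) : R := (p + (q - p) * t)%R.

Lemma reparam_range p q t : in01 p -> in01 q -> in01 t ->
  (0 <= reparam p q t <= 1)%R.
Proof.
  intros Hp Hq Ht. unfold reparam. split.
  - assert (0 <= (1-t)*p)%R by (apply Rmult_le_pos; lra).
    assert (0 <= t*q)%R by (apply Rmult_le_pos; lra). lra.
  - assert (0 <= (1-t)*(1-p))%R by (apply Rmult_le_pos; lra).
    assert (0 <= t*(1-q))%R by (apply Rmult_le_pos; lra). lra.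
Qed.

Lemma C1_reparam f df p q : in01 p -> in01 q -> isC1 f df ->
  isC1 (fun t => f (reparam p q t)) (fun t => RtoC (q - p) * df (reparam p q t)).
Proof.
  intros Hp Hq H t Ht. destruct (H _ (reparam_range p q t Hp Hq Ht)) as [H1 H2].
  assert (HD : is_derive (reparam p q) t (q - p)%R).
  { unfold reparam. auto_derive; [auto | ring]. }
  split.
  - apply cder_iff in H1. destruct H1 as [H1 H3]. apply cder_iff. split.
    + evar_last.
      * exact (is_derive_comp (V := R_NormedModule) (fun s => Re (f s)) (reparam p q) t _ _ H1 HD).
      * unfold scal; simpl; unfold mult; simpl. unfold Re. ring.
    + evar_last.
      * exact (is_derive_comp (V := R_NormedModule) (fun s => Im (f s)) (reparam p q) t _ _ H3 HD).
      * unfold scal; simpl; unfold mult; simpl. unfold Im. ring.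
  - apply ccont_mult; [apply ccont_const |].
    apply (continuous_comp (reparam p q) df); [| exact H2].
    apply (ex_derive_continuous (V := R_NormedModule)). eexists; exact HD.
Qed.

Definition subarc {l} (a : arc (lprod l)) (p q : R) (Hp : in01 p) (Hq : in01 q) :
  arc (lprod l) :=
  C1_arc (lprod l) _ _ _ _ (C1_reparam _ _ p q Hp Hq (arcx_C1 _ a)) (C1_reparam _ _ p q Hp Hq (arcy_C1 _ a))
    (fun t Ht => arc_on _ a _ (reparam_range p q t Hp Hq Ht)).

Lemma subarc_form l (Hl : distinct_roots l) (a : arc (lprod l)) p q Hp Hq t : in01 t ->
  arc_form (subarc a p q Hp Hq) t = RtoC (q - p) * arc_form a (reparam p q t).
Proof.
  intros Ht. pose proof (arc_ode l Hl a _ (reparam_range p q t Hp Hq Ht)) as [E1 E2].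
  apply arc_form_char; [exact Hl | exact Ht | |]; simpl.
  - rewrite E1. ring.
  - rewrite E2. ring.
Qed.

(** * Paths, restriction and reversal *)

(** The factors are hidden, so that an explicit expression can be used for the derivative dF. *)
Definition regular (F dF : C -> C) : Prop :=
  exists l, distinct_roots l /\ F = lprod l /\ dF = dlprod l.

Section Regular.
Variables F dF : C -> C.
Hypothesis HF : regular F dF.

Lemma reg_char x y x' y' z :
  y ^ 2 = F x -> x' = 2 * y * z -> y' = dF x * z -> dx_over_2y F x y x' y' = z.
Proof. destruct HF as [l [Hl [-> ->]]]. apply dx_over_2y_char, Hl. Qed.

Lemma reg_arc_ode (a : arc F) t : in01 t ->
  dax a t = 2 * ay a t * arc_form a t /\ day a t = dF (ax a t) * arc_form a t.
Proof. destruct HF as [l [Hl [E1 E2]]]. subst. apply arc_ode, Hl. Qed.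

Lemma reg_arc_form (a : arc F) t z : in01 t ->
  dax a t = 2 * ay a t * z -> day a t = dF (ax a t) * z -> arc_form a t = z.
Proof. intros Ht H1 H2. apply reg_char; [apply arc_on, Ht | exact H1 | exact H2]. Qed.

Lemma reg_arc_form_icont (a : arc F) : icont (arc_form a).
Proof. destruct HF as [l [Hl [E1 E2]]]. subst. apply arc_form_icont, Hl. Qed.

Lemma reg_subarc (a : arc F) p q : in01 p -> in01 q ->
  exists a' : arc F, (forall t, ax a' t = ax a (reparam p q t)) /\
    (forall t, ay a' t = ay a (reparam p q t)) /\
    (forall t, in01 t -> arc_form a' t = RtoC (q - p) * arc_form a (reparam p q t)).
Proof.
  intros Hp Hq. destruct HF as [l [Hl [E1 E2]]]. subst.
  exists (subarc a p q Hp Hq). split; [reflexivity | split; [reflexivity |]].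
  apply subarc_form, Hl.
Qed.

Lemma reg_cder f t m : cder f t m -> cder (fun s => F (f s)) t (dF (f t) * m).
Proof. destruct HF as [l [Hl [E1 E2]]]. subst. apply cder_lprod. Qed.

End Regular.

Lemma regular_aff X : NoDup (roots X) -> regular (fpol X) (dlprod (aff_factors X)).
Proof.
  intros H. exists (aff_factors X). split; [apply aff_indep, H | split; [apply fpol_lprod | reflexivity]].
Qed.

Lemma regular_inf X : NoDup (roots X) -> regular (fpol_inf X) (dlprod (inf_factors X)).
Proof.
  intros H. exists (inf_factors X). split; [apply inf_indep, H | split; [apply fpol_inf_lprod | reflexivity]].
Qed.

Definition well_formed (X : curve) : Prop :=
  NoDup (roots X) /\ length (roots X) = (2 * genus X + 1)%nat.

Lemma fold_inf l (u : C) : u <> 0 ->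
  fold_right (fun e p => (1 - e * u) * p) 1 l =
  u ^ length l * fold_right (fun e p => (/ u - e) * p) 1 l.
Proof.
  intros Hu. induction l as [|e l IH]; simpl; [ring |].
  rewrite IH. field. exact Hu.
Qed.

Lemma on_curve_inf X u w : well_formed X -> w ^ 2 = fpol_inf X u -> on_curve X (of_inf_chart X u w).
Proof.
  intros [_ Hlen] H. unfold of_inf_chart. destruct (Ceq_dec u 0) as [E | E]; [exact I |].
  cbn [on_curve]. unfold fpol. unfold fpol_inf in H. rewrite fold_inf in H by exact E.
  set (P := fold_right _ _ _) in *. rewrite Hlen in H.
  assert (E2 : u * (u ^ (2 * genus X + 1) * P) = (u ^ S (genus X)) ^ 2 * P).
  { rewrite <- Cpow_mult_r. replace (S (genus X) * 2)%nat with (S (2 * genus X + 1)) by lia.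
    rewrite Cpow_S. ring. }
  rewrite E2 in H.
  assert (HN : u ^ S (genus X) <> 0) by (apply Cpow_nz, E).
  set (v := u ^ S (genus X)) in *.
  replace ((w / v) ^ 2) with (w ^ 2 / v ^ 2) by (simpl; field; exact HN).
  rewrite H. simpl. field. exact HN.
Qed.

Lemma step_on_curve X (s : step X) t : well_formed X -> in01 t -> on_curve X (step_at s t).
Proof.
  intros HX Ht. destruct s as [a | a]; simpl.
  - apply arc_on, Ht.
  - apply on_curve_inf; [exact HX | apply arc_on, Ht].
Qed.

Definition step_form {X : curve} (k : nat) (s : step X) (t : R) : C :=
  match s with
  | Affine_arc a => - (ax a t ^ k * arc_form a t)
  | Infinite_arc a => ax a t ^ (genus X - 1 - k) * arc_form a t
  end.

Lemma step_int_form X k (s : step X) : step_int k s = CInt (step_form k s).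
Proof. destruct s; reflexivity. Qed.

Lemma step_form_icont X k (s : step X) : well_formed X -> icont (step_form k s).
Proof.
  intros [HX _]. destruct s as [a | a]; simpl.
  - apply icont_opp, icont_mult.
    + apply icont_pow, cont_icont. intros t Ht. eapply C1_cont; [apply arcx_C1 | exact Ht].
    + apply (reg_arc_form_icont _ _ (regular_aff X HX)).
  - apply icont_mult.
    + apply icont_pow, cont_icont. intros t Ht. eapply C1_cont; [apply arcx_C1 | exact Ht].
    + apply (reg_arc_form_icont _ _ (regular_inf X HX)).
Qed.

Lemma sub_affine X (a : arc (fpol X)) p q : well_formed X -> in01 p -> in01 q ->
  exists a' : arc (fpol X), (forall t, ax a' t = ax a (reparam p q t)) /\
    (forall t, ay a' t = ay a (reparam p q t)) /\
    forall k, step_int k (Affine_arc a') = IntC (step_form k (Affine_arc a)) p q.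
Proof.
  intros HX Hp Hq. pose proof HX as [HX1 _].
  destruct (reg_subarc _ _ (regular_aff X HX1) a p q Hp Hq) as [a' [E1 [E2 E3]]].
  exists a'. split; [exact E1 | split; [exact E2 |]].
  intros k. rewrite <- IntC_sub by (try assumption; apply step_form_icont, HX).
  rewrite step_int_form. apply CInt_ext. intros t Ht. simpl.
  rewrite E3, E1 by exact Ht. unfold reparam. ring.
Qed.

Lemma sub_infinite X (a : arc (fpol_inf X)) p q : well_formed X -> in01 p -> in01 q ->
  exists a' : arc (fpol_inf X), (forall t, ax a' t = ax a (reparam p q t)) /\
    (forall t, ay a' t = ay a (reparam p q t)) /\
    forall k, step_int k (Infinite_arc a') = IntC (step_form k (Infinite_arc a)) p q.
Proof.
  intros HX Hp Hq. pose proof HX as [HX1 _].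
  destruct (reg_subarc _ _ (regular_inf X HX1) a p q Hp Hq) as [a' [E1 [E2 E3]]].
  exists a'. split; [exact E1 | split; [exact E2 |]].
  intros k. rewrite <- IntC_sub by (try assumption; apply step_form_icont, HX).
  rewrite step_int_form. apply CInt_ext. intros t Ht. simpl.
  rewrite E3, E1 by exact Ht. unfold reparam. ring.
Qed.

Lemma sub_step X (s : step X) p q : well_formed X -> in01 p -> in01 q ->
  exists s' : step X, (forall t, step_at s' t = step_at s (reparam p q t)) /\
    forall k, step_int k s' = IntC (step_form k s) p q.
Proof.
  intros HX Hp Hq. destruct s as [a | a].
  - destruct (sub_affine X a p q HX Hp Hq) as [a' [E1 [E2 E3]]].
    exists (Affine_arc a'). split; [intros t; simpl; rewrite E1, E2; reflexivity | exact E3].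
  - destruct (sub_infinite X a p q HX Hp Hq) as [a' [E1 [E2 E3]]].
    exists (Infinite_arc a'). split; [intros t; simpl; rewrite E1, E2; reflexivity | exact E3].
Qed.

Lemma joins_on_curve_r X (g : path X) P Q : joins g P Q -> on_curve X Q.
Proof.
  revert P. induction g as [|s g IH]; simpl; intros P H.
  - destruct H as [H <-]; exact H.
  - apply (IH _ (proj2 H)).
Qed.

Lemma joins_on_curve_l X (g : path X) P Q : well_formed X -> joins g P Q -> on_curve X P.
Proof.
  intros HX. destruct g as [|s g]; intros H.
  - apply H.
  - destruct H as [<- _]. apply step_on_curve; [exact HX | lra].
Qed.

Lemma joins_app X (g h : path X) P Q S : joins g P Q -> joins h Q S -> joins (g ++ h) P S.
Proof.
  revert P. induction g as [|s g IH]; simpl; intros P H H'.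
  - destruct H as [_ ->]; exact H'.
  - destruct H as [H1 H2]. split; auto.
Qed.

Lemma path_int_app X k (g h : path X) : path_int k (g ++ h) = path_int k g + path_int k h.
Proof.
  unfold path_int. induction g as [|s g IH]; simpl; [ring |]. rewrite IH. ring.
Qed.

Lemma path_int_single X k (s : step X) : path_int k [s] = step_int k s.
Proof. unfold path_int; simpl. ring. Qed.

Lemma joins_single X (s : step X) : well_formed X -> joins [s] (step_at s 0%R) (step_at s 1%R).
Proof. intros HX. simpl. repeat split. apply step_on_curve; [exact HX | lra]. Qed.

Lemma joins_single_at X (s : step X) P Q : well_formed X ->
  step_at s 0%R = P -> step_at s 1%R = Q -> joins [s] P Q.
Proof. intros HX <- <-. apply joins_single, HX. Qed.

Lemma path_rev X (g : path X) P Q : well_formed X -> on_curve X P -> joins g P Q ->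
  exists g' : path X, joins g' Q P /\ forall k, path_int k g' = - path_int k g.
Proof.
  intros HX. revert P. induction g as [|s g IH]; intros P HP H.
  - destruct H as [H ->]. exists []. split; [split; [exact H | reflexivity] |].
    intros k. unfold path_int; simpl. ring.
  - destruct H as [H1 H2].
    destruct (IH _ (step_on_curve X s 1 HX ltac:(lra)) H2) as [g' [Hg' Eg']].
    destruct (sub_step X s 1 0 HX ltac:(lra) ltac:(lra)) as [s' [Es Is]].
    exists (g' ++ [s']). split.
    + apply joins_app with (step_at s 1%R); [exact Hg' |].
      apply joins_single_at; [exact HX | |]; rewrite Es; unfold reparam.
      * f_equal; ring.
      * rewrite <- H1. f_equal; ring.
    + intros k. rewrite path_int_app, Eg', path_int_single, Is.
      rewrite (IntC_swap _ 0 1) by (apply step_form_icont, HX).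
      rewrite <- CInt_IntC, <- step_int_form. unfold path_int; simpl. ring.
Qed.

Definition conn (X : curve) (P Q : point) : Prop := exists g : path X, joins g P Q.

Lemma conn_refl X P : on_curve X P -> conn X P P.
Proof. intros H; exists []; split; [exact H | reflexivity]. Qed.

Lemma conn_trans X P Q S : conn X P Q -> conn X Q S -> conn X P S.
Proof. intros [g Hg] [h Hh]. exists (g ++ h). eapply joins_app; eassumption. Qed.

Lemma conn_sym X P Q : well_formed X -> on_curve X P -> conn X P Q -> conn X Q P.
Proof. intros HX HP [g Hg]. destruct (path_rev X g P Q HX HP Hg) as [g' [H _]]. exists g'; exact H. Qed.

(** * Short arcs over quadratic paths *)

Lemma exists_sqrt (z : C) : exists w : C, w ^ 2 = z.
Proof.
  assert (P : forall z, (0 < Re z)%R -> exists w : C, w ^ 2 = z).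
  { intros y Hy. exists (psqrt y). rewrite <- (psqrt_sqr y Hy) at 2. simpl. ring. }
  destruct (Rtotal_order 0 (Re z)) as [H | [H | H]].
  - apply P, H.
  - destruct z as [a b]. simpl in H. subst a.
    destruct (Rle_dec 0 b) as [Hb | Hb].
    + exists (RtoC (sqrt (b / 2)) * (1, 1)%R).
      pose proof (sqrt_sqrt (b / 2) ltac:(lra)) as E.
      set (r := sqrt (b / 2)) in *. clearbody r.
      assert (E2 : b = (2 * (r * r))%R) by lra. rewrite E2.
      apply injective_projections; simpl; ring.
    + apply Rnot_le_lt in Hb. exists (RtoC (sqrt (- b / 2)) * (1, -1)%R).
      pose proof (sqrt_sqrt (- b / 2) ltac:(lra)) as E.
      set (r := sqrt (- b / 2)) in *. clearbody r.
      assert (E2 : b = (- (2 * (r * r)))%R) by lra. rewrite E2.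
      apply injective_projections; simpl; ring.
  - destruct (P (- z)) as [w Hw].
    { simpl. unfold Re in *. lra. }
    exists (Ci * w). replace ((Ci * w) ^ 2) with (Ci * Ci * w ^ 2) by (simpl; ring).
    rewrite Hw. replace (Ci * Ci) with (- (1)); [ring |].
    apply injective_projections; simpl; ring.
Qed.

(** The quadratic parametrisation makes the square root of x - x0 smooth at t = 0, so that the same
    path lifts to a double covering whether or not x0 is a branch point. *)
Definition square_path (x0 x1 : C) (t : R) : C := x0 + RtoC t * RtoC t * (x1 - x0).
Definition d_square_path (x0 x1 : C) (t : R) : C := 2 * RtoC t * (x1 - x0).

Lemma square_path_C1 x0 x1 : isC1 (square_path x0 x1) (d_square_path x0 x1).
Proof.
  unfold square_path, d_square_path.
  refine (C1_ext _ _ _ _ (fun t => eq_refl) _ _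
    (C1_plus _ _ _ _ (C1_const x0) (C1_mult _ _ _ _ (C1_mult _ _ _ _ C1_id C1_id) (C1_const (x1 - x0))))).
  - intros t _. simpl. ring.
  - intros t _. apply ccont_mult; [apply ccont_mult |]; try apply ccont_const.
    apply (cder_cont RtoC t 1). apply cder_iff; split.
    + apply @is_derive_id.
    + apply (is_derive_const (V := R_NormedModule) 0%R).
Qed.

Lemma square_path_0 x0 x1 : square_path x0 x1 0 = x0.
Proof. unfold square_path. ring. Qed.

Lemma square_path_1 x0 x1 : square_path x0 x1 1 = x1.
Proof. unfold square_path. ring. Qed.

Lemma square_path_near x0 x1 t d : in01 t -> (Cmod (x1 - x0) < d)%R -> (Cmod (square_path x0 x1 t - x0) < d)%R.
Proof.
  intros Ht H. eapply Rle_lt_trans; [| exact H].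
  unfold square_path. replace (x0 + t * t * (x1 - x0) - x0) with (RtoC (t * t) * (x1 - x0)) by (rewrite RtoC_mult; ring).
  rewrite Cmod_mult, Cmod_R, Rabs_pos_eq by nra.
  pose proof (Cmod_ge_0 (x1 - x0)) as Hc.
  assert (Ht2 : (t * t <= 1)%R) by nra.
  rewrite <- (Rmult_1_l (Cmod (x1 - x0))) at 2. apply Rmult_le_compat_r; assumption.
Qed.

(** Near a nonzero value a continuous function turns by less than a right angle, which puts the
    ratio in the domain of [psqrt]. *)
Lemma ratio_near (G : C -> C) (x0 : C) : continuous G x0 -> G x0 <> 0 ->
  exists d, (0 < d)%R /\ forall x, (Cmod (x - x0) < d)%R -> (0 < Re (G x / G x0))%R.
Proof.
  intros Hc Hn.
  assert (H : continuous (fun x : C => G x / G x0) x0).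
  { unfold Cdiv. apply ccont_mult; [exact Hc | apply ccont_const]. }
  assert (HL : locally x0 (fun x : C => (0 < Re (G x / G x0))%R)).
  { apply (H (fun w : C => (0 < Re w)%R)). apply locally_re_pos.
    unfold Cdiv. rewrite Cinv_r by exact Hn. simpl. lra. }
  destruct HL as [d Hd]. exists d. split; [apply cond_pos |].
  intros x Hx. apply Hd. apply C_NormedModule_mixin_compat1. exact Hx.
Qed.

Lemma near_neq_0 (G : C -> C) (x0 : C) : continuous G x0 -> G x0 <> 0 ->
  exists d, (0 < d)%R /\ forall x, (Cmod (x - x0) < d)%R -> G x <> 0.
Proof.
  intros Hc Hn. destruct (ratio_near G x0 Hc Hn) as [d [Hd H]].
  exists d. split; [exact Hd |]. intros x Hx E. specialize (H x Hx).
  rewrite E in H. unfold Cdiv in H. rewrite Cmult_0_l in H. simpl in H. lra.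
Qed.

Lemma psqrt_1 : psqrt 1 = 1.
Proof. symmetry. apply psqrt_unique; simpl; try lra. ring. Qed.

Lemma lprod_cont l (x : C) : continuous (lprod l) x.
Proof. apply (ccont_lprod l (fun x : C => x)). apply continuous_id. Qed.

Lemma factor_out l x0 : lprod l x0 = 0 -> distinct_roots l ->
  exists l', (forall x, lprod l x = (x - x0) * lprod l' x) /\ lprod l' x0 <> 0.
Proof.
  intros H Hi.
  assert (E : exists l', (forall x, lprod l x = (x - x0) * lprod l' x) /\
    (forall x, dlprod l x = lprod l' x + (x - x0) * dlprod l' x)).
  { clear Hi. induction l as [|a l IH]; simpl in H.
    - exfalso. injection H; lra.
    - destruct (classic (lin a x0 = 0)) as [Ha | Ha].
      + assert (El : forall x, lin a x = snd a * (x - x0)).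
        { intros x. replace (lin a x) with (lin a x0 + snd a * (x - x0)) by (unfold lin; ring).
          rewrite Ha. ring. }
        exists ((snd a, RtoC 0) :: l). split; intros x; simpl; rewrite El; unfold lin; simpl; ring.
      + destruct IH as [l' [H1 H2]].
        { apply NNPP. intros Hn. exact (Cmult_neq_0 _ _ Ha Hn H). }
        exists (a :: l'). split; intros x; simpl; rewrite H1; [ring |]. rewrite H2. ring. }
  destruct E as [l' [H1 H2]]. exists l'. split; [exact H1 |].
  pose proof (dlprod_nonzero l x0 Hi H) as Hd. rewrite H2 in Hd.
  intros E. apply Hd. rewrite E. ring.
Qed.

(** Away from the zeros of the right-hand side, y is y0 times the principal square root of the
    ratio of the values. *)
Lemma arc_near_regular l x0 : lprod l x0 <> 0 ->
  exists d, (0 < d)%R /\ forall x1 y0, (Cmod (x1 - x0) < d)%R -> y0 ^ 2 = lprod l x0 ->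
    exists a : arc (lprod l), (forall t, ax a t = square_path x0 x1 t) /\
      (forall t, ay a t = y0 * psqrt (lprod l (square_path x0 x1 t) / lprod l x0)) /\
      (forall t, in01 t -> (0 < Re (lprod l (square_path x0 x1 t) / lprod l x0))%R).
Proof.
  intros Hn. destruct (ratio_near (lprod l) x0 (lprod_cont l x0) Hn) as [d [Hd H]].
  exists d. split; [exact Hd |]. intros x1 y0 Hx1 Hy0.
  assert (Hp : forall t, in01 t -> (0 < Re (lprod l (square_path x0 x1 t) / lprod l x0))%R).
  { intros t Ht. apply H. apply square_path_near; assumption. }
  assert (HC : isC1 (fun t => lprod l (square_path x0 x1 t) / lprod l x0)
     (fun t => dlprod l (square_path x0 x1 t) * d_square_path x0 x1 t * / lprod l x0 + lprod l (square_path x0 x1 t) * 0)).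
  { exact (C1_mult _ _ _ _ (C1_lprod l _ _ (square_path_C1 x0 x1)) (C1_const (/ lprod l x0))). }
  assert (HY := C1_mult _ _ _ _ (C1_const y0) (C1_psqrt _ _ HC Hp)). simpl in HY.
  unshelve eexists (C1_arc (lprod l) _ _ _ _ (square_path_C1 x0 x1) HY _).
  - intros t Ht. simpl.
    replace (y0 * psqrt (lprod l (square_path x0 x1 t) / lprod l x0) *
      (y0 * psqrt (lprod l (square_path x0 x1 t) / lprod l x0) * 1)) with
      (y0 ^ 2 * (psqrt (lprod l (square_path x0 x1 t) / lprod l x0) * psqrt (lprod l (square_path x0 x1 t) / lprod l x0)))
      by (simpl; ring).
    rewrite psqrt_sqr by auto. rewrite Hy0. field. exact Hn.
  - simpl. auto.
Qed.

Lemma reg_arc_near F dF x0 : regular F dF -> F x0 <> 0 ->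
  exists d, (0 < d)%R /\ forall x1 y0, (Cmod (x1 - x0) < d)%R -> y0 ^ 2 = F x0 ->
    exists a : arc F, (forall t, ax a t = square_path x0 x1 t) /\
      (forall t, ay a t = y0 * psqrt (F (square_path x0 x1 t) / F x0)) /\
      (forall t, in01 t -> (0 < Re (F (square_path x0 x1 t) / F x0))%R).
Proof. intros [l [Hl [-> ->]]]. apply arc_near_regular. Qed.

(** At a zero x0 write y^2 = (x - x0) G x.  Along the quadratic path this is t^2 (x1 - x0) G x, so
    y is t times a smooth square root. *)
Lemma arc_near_branch l x0 : distinct_roots l -> lprod l x0 = 0 ->
  exists d, (0 < d)%R /\ forall x1 y1, (Cmod (x1 - x0) < d)%R -> y1 ^ 2 = lprod l x1 ->
    exists a : arc (lprod l), ax a 0%R = x0 /\ ay a 0%R = 0 /\ ax a 1%R = x1 /\ ay a 1%R = y1.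
Proof.
  intros Hi H0. destruct (factor_out l x0 H0 Hi) as [l' [El Hn]].
  destruct (ratio_near (lprod l') x0 (lprod_cont l' x0) Hn) as [d [Hd H]].
  exists d. split; [exact Hd |]. intros x1 y1 Hx1 Hy1.
  assert (Hp : forall t, in01 t -> (0 < Re (lprod l' (square_path x0 x1 t) / lprod l' x0))%R).
  { intros t Ht. apply H. apply square_path_near; assumption. }
  assert (HC : isC1 (fun t => lprod l' (square_path x0 x1 t) / lprod l' x0)
     (fun t => dlprod l' (square_path x0 x1 t) * d_square_path x0 x1 t * / lprod l' x0 + lprod l' (square_path x0 x1 t) * 0)).
  { exact (C1_mult _ _ _ _ (C1_lprod l' _ _ (square_path_C1 x0 x1)) (C1_const (/ lprod l' x0))). }
  set (g := fun t => psqrt (lprod l' (square_path x0 x1 t) / lprod l' x0)).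
  assert (Hg1 : (0 < Re (lprod l' (square_path x0 x1 1) / lprod l' x0))%R) by (apply Hp; lra).
  assert (Hg0 : g 1%R <> 0) by (apply psqrt_neq0, Hg1).
  (* c is the square root of (x1 - x0) G x0 for which the arc ends at y1 and not at - y1 *)
  set (c := y1 / g 1%R).
  assert (HY := C1_mult _ _ _ _ (C1_mult _ _ _ _ C1_id (C1_const c)) (C1_psqrt _ _ HC Hp)). simpl in HY.
  assert (Ec : c * c = (x1 - x0) * lprod l' x0).
  { unfold c. replace (y1 / g 1%R * (y1 / g 1%R)) with (y1 ^ 2 / (g 1%R * g 1%R)) by (simpl; field; exact Hg0).
    unfold g. rewrite psqrt_sqr by exact Hg1. rewrite Hy1, El, square_path_1.
    field. split; [exact Hn |]. 
    rewrite square_path_1 in Hg1. intros E. rewrite E in Hg1. unfold Cdiv in Hg1. rewrite Cmult_0_l in Hg1. simpl in Hg1. lra. }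
  unshelve eexists (C1_arc (lprod l) _ _ _ _ (square_path_C1 x0 x1) HY _).
  - intros t Ht. simpl. rewrite El.
    replace (t * c * psqrt (lprod l' (square_path x0 x1 t) / lprod l' x0) *
      (t * c * psqrt (lprod l' (square_path x0 x1 t) / lprod l' x0) * 1)) with
      (t * t * (c * c) * (psqrt (lprod l' (square_path x0 x1 t) / lprod l' x0) * psqrt (lprod l' (square_path x0 x1 t) / lprod l' x0)))
      by ring.
    rewrite psqrt_sqr by auto. rewrite Ec. unfold square_path at 2. field. exact Hn.
  - simpl. rewrite square_path_0, square_path_1. split; [reflexivity |]. split; [ring |]. split; [reflexivity |].
    rewrite <- (square_path_1 x0 x1) at 1. fold (g 1%R). unfold c. field. exact Hg0.
Qed.

(** * Connectedness *)

Section Connected.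
Variable X : curve.
Hypothesis HX : well_formed X.

(** All points over x0 can be joined to the branch point (e, 0) if and only if this holds for the
    points over x1, when x1 is close to x0; real induction along a segment from e then reaches
    every x. *)
Lemma conn_near (e x0 : C) : fpol X e = 0 ->
  exists d, (0 < d)%R /\ forall x1, (Cmod (x1 - x0) < d)%R ->
   ((forall y, y ^ 2 = fpol X x0 -> conn X (Affine x0 y) (Affine e 0)) <->
    (forall y, y ^ 2 = fpol X x1 -> conn X (Affine x1 y) (Affine e 0))).
Proof.
  intros He. pose proof HX as [HX1 _].
  assert (S : forall (a : arc (lprod (aff_factors X))), exists s : step X, forall t, step_at s t = Affine (ax a t) (ay a t)).
  { rewrite <- fpol_lprod. intros a. exists (Affine_arc a). reflexivity. }
  rewrite fpol_lprod in *.
  destruct (Ceq_dec (lprod (aff_factors X) x0) 0) as [E | E].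
  - destruct (arc_near_branch _ x0 (aff_indep X HX1) E) as [d [Hd H]].
    exists d. split; [exact Hd |]. intros x1 Hx1.
    assert (HC : forall y, y ^ 2 = lprod (aff_factors X) x1 -> conn X (Affine x0 0) (Affine x1 y)).
    { intros y Hy. destruct (H x1 y Hx1 Hy) as [a [E1 [E2 [E3 E4]]]]. destruct (S a) as [s Hs].
      exists [s]. apply joins_single_at; [exact HX | |]; rewrite Hs; congruence. }
    split; intros HN y Hy.
    + apply conn_trans with (Affine x0 0); [| apply HN; rewrite E; simpl; ring].
      apply conn_sym; [exact HX | | apply HC, Hy]. cbn [on_curve]. rewrite fpol_lprod, E. simpl; ring.
    + assert (y = 0).
      { apply NNPP. intros Hn. rewrite E in Hy. simpl in Hy. rewrite Cmult_1_r in Hy.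
        exact (Cmult_neq_0 _ _ Hn Hn Hy). }
      subst y. destruct (exists_sqrt (lprod (aff_factors X) x1)) as [w Hw].
      apply conn_trans with (Affine x1 w); [apply HC, Hw | apply HN, Hw].
  - destruct (arc_near_regular _ x0 E) as [d [Hd H]].
    exists d. split; [exact Hd |]. intros x1 Hx1.
    assert (HC : forall y, y ^ 2 = lprod (aff_factors X) x0 ->
      conn X (Affine x0 y) (Affine x1 (y * psqrt (lprod (aff_factors X) x1 / lprod (aff_factors X) x0)))).
    { intros y Hy. destruct (H x1 y Hx1 Hy) as [a [E1 [E2 _]]]. destruct (S a) as [s Hs].
      exists [s]. apply joins_single_at; [exact HX | |]; rewrite Hs, E1, E2.
      - rewrite square_path_0. f_equal. unfold Cdiv. rewrite Cinv_r by exact E.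
        rewrite <- (psqrt_unique 1 1); simpl; try lra; ring.
      - rewrite square_path_1. reflexivity. }
    assert (Hp : (0 < Re (lprod (aff_factors X) x1 / lprod (aff_factors X) x0))%R).
    { destruct (exists_sqrt (lprod (aff_factors X) x0)) as [w Hw].
      destruct (H x1 w Hx1 Hw) as [a [_ [_ E3]]]. specialize (E3 1%R ltac:(lra)).
      rewrite square_path_1 in E3. exact E3. }
    pose proof (psqrt_sqr _ Hp) as Eq. pose proof (psqrt_neq0 _ Hp) as Hq.
    set (q := psqrt _) in *.
    split; intros HN y Hy.
    + assert (Hy0 : (y / q) ^ 2 = lprod (aff_factors X) x0).
      { replace ((y / q) ^ 2) with (y ^ 2 / (q * q)) by (simpl; field; exact Hq).
        rewrite Eq, Hy. field. split; [exact E |].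
        intros E0. rewrite E0 in Hp. unfold Cdiv in Hp. rewrite Cmult_0_l in Hp. simpl in Hp. lra. }
      apply conn_trans with (Affine x0 (y / q)); [| apply HN, Hy0].
      apply conn_sym; [exact HX | cbn [on_curve]; rewrite fpol_lprod; exact Hy0 |].
      replace y with (y / q * q) at 2 by (field; exact Hq). apply HC, Hy0.
    + apply conn_trans with (Affine x1 (y * q)); [apply HC, Hy |]. apply HN.
      replace ((y * q) ^ 2) with (y ^ 2 * (q * q)) by (simpl; ring).
      rewrite Hy, Eq. field. exact E.
Qed.

Lemma conn_affine (e x y : C) : fpol X e = 0 -> y ^ 2 = fpol X x -> conn X (Affine x y) (Affine e 0).
Proof.
  intros He.
  assert (H : forall y, y ^ 2 = fpol X (e + RtoC 1 * (x - e)) -> conn X (Affine (e + RtoC 1 * (x - e)) y) (Affine e 0)).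
  { set (p := fun t : R => e + RtoC t * (x - e)).
    apply (local_equivalence (fun s t =>
      (forall y, y ^ 2 = fpol X (p s) -> conn X (Affine (p s) y) (Affine e 0)) <->
      (forall y, y ^ 2 = fpol X (p t) -> conn X (Affine (p t) y) (Affine e 0)))).
    - tauto.
    - tauto.
    - tauto.
    - intros t0 _. destruct (conn_near e (p t0) He) as [d [Hd H]].
      assert (Hm : (0 < Cmod (x - e) + 1)%R) by (pose proof (Cmod_ge_0 (x - e)); lra).
      exists (d / (Cmod (x - e) + 1))%R. split; [apply Rdiv_lt_0_compat; assumption |].
      intros t _ Ht. apply H. unfold p.
      replace (e + t * (x - e) - (e + t0 * (x - e))) with (RtoC (t - t0) * (x - e)) by (rewrite RtoC_minus; ring).
      rewrite Cmod_mult, Cmod_R.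
      apply (Rmult_lt_compat_r _ _ _ Hm) in Ht.
      replace (d / (Cmod (x - e) + 1) * (Cmod (x - e) + 1))%R with d in Ht by (field; lra).
      pose proof (Rabs_pos (t - t0)). nra.
    - unfold p. intros w Hw.
      replace (e + 0 * (x - e)) with e in * by ring. rewrite He in Hw.
      assert (w = 0).
      { apply NNPP. intros Hn. simpl in Hw. rewrite Cmult_1_r in Hw. exact (Cmult_neq_0 _ _ Hn Hn Hw). }
      subst w. apply conn_refl. cbn [on_curve]. rewrite He. simpl; ring. }
  replace (e + RtoC 1 * (x - e)) with x in H by ring. apply H.
Qed.

Lemma conn_infinity (e : C) : fpol X e = 0 -> conn X Infinity (Affine e 0).
Proof.
  intros He. pose proof HX as [HX1 _].
  assert (H0 : lprod (inf_factors X) 0 = 0).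
  { rewrite <- fpol_inf_lprod. unfold fpol_inf. ring. }
  destruct (arc_near_branch _ 0 (inf_indep X HX1) H0) as [d [Hd H]].
  assert (S : forall (a : arc (lprod (inf_factors X))), exists s : step X, forall t, step_at s t = of_inf_chart X (ax a t) (ay a t)).
  { rewrite <- fpol_inf_lprod. intros a. exists (Infinite_arc a). reflexivity. }
  set (u := RtoC (d / 2)).
  assert (Hu : u <> 0) by (unfold u; intros E; injection E; lra).
  destruct (exists_sqrt (lprod (inf_factors X) u)) as [w Hw].
  destruct (H u w) as [a [E1 [E2 [E3 E4]]]].
  { unfold u. replace (RtoC (d / 2) - 0) with (RtoC (d / 2)) by ring. rewrite Cmod_R, Rabs_pos_eq; lra. }
  { exact Hw. }
  destruct (S a) as [s Hs].
  assert (HO : on_curve X (of_inf_chart X u w)).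
  { apply on_curve_inf; [exact HX |]. rewrite fpol_inf_lprod. exact Hw. }
  apply conn_trans with (of_inf_chart X u w).
  - exists [s]. apply joins_single_at; [exact HX | |]; rewrite Hs.
    + rewrite E1, E2. unfold of_inf_chart. destruct (Ceq_dec 0 0); [reflexivity | contradiction].
    + rewrite E3, E4. reflexivity.
  - unfold of_inf_chart in *. destruct (Ceq_dec u 0); [contradiction |].
    apply conn_affine; [exact He | exact HO].
Qed.

Lemma connected P Q : roots X <> [] -> on_curve X P -> on_curve X Q -> conn X P Q.
Proof.
  intros Hr HP HQ. destruct (roots X) as [|e l] eqn:Er; [contradiction |].
  assert (He : fpol X e = 0).
  { unfold fpol. rewrite Er. simpl. ring. }
  assert (HE : forall S, on_curve X S -> conn X S (Affine e 0)).
  { intros [|x y] HS; [apply conn_infinity, He | apply conn_affine; [exact He | exact HS]]. }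
  apply conn_trans with (Affine e 0); [apply HE, HP |].
  apply conn_sym; [exact HX | exact HQ | apply HE, HQ].
Qed.

End Connected.

(** * Integral curves by power series *)

Lemma RtoC_neq_0 (r : R) : r <> 0%R -> RtoC r <> 0.
Proof. intros H E. apply H. exact (f_equal Re E). Qed.

(** Series with complex coefficients in a real variable, treated by real and imaginary parts. *)
Definition cps (x : nat -> C) (t : R) (L : C) : Prop :=
  is_pseries (fun n => Re (x n)) t (Re L) /\ is_pseries (fun n => Im (x n)) t (Im L).

Definition cpsum (x : nat -> C) (t : R) : C :=
  (PSeries (fun n => Re (x n)) t, PSeries (fun n => Im (x n)) t).

Lemma cps_unique x t L : cps x t L -> cpsum x t = L.
Proof.
  intros [H1 H2]. unfold cpsum.
  apply injective_projections; simpl; apply is_pseries_unique; assumption.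
Qed.

Lemma cps_ext x y t L : (forall n, x n = y n) -> cps x t L -> cps y t L.
Proof.
  intros E [H1 H2]. split.
  - eapply is_pseries_ext; [| exact H1]. intros n; simpl. rewrite E; reflexivity.
  - eapply is_pseries_ext; [| exact H2]. intros n; simpl. rewrite E; reflexivity.
Qed.

Lemma rps_lin (a b : R) (u v : nat -> R) t lu lv :
  is_pseries u t lu -> is_pseries v t lv ->
  is_pseries (fun n => (a * u n + b * v n)%R) t (a * lu + b * lv)%R.
Proof.
  intros Hu Hv.
  apply (is_pseries_plus (V := R_NormedModule) (fun n => (a * u n)%R) (fun n => (b * v n)%R)).
  - apply (is_pseries_scal (V := R_NormedModule) a u t lu); [apply Rmult_comm | exact Hu].
  - apply (is_pseries_scal (V := R_NormedModule) b v t lv); [apply Rmult_comm | exact Hv].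
Qed.

Lemma cps_plus x y t L M : cps x t L -> cps y t M -> cps (fun n => x n + y n) t (L + M).
Proof.
  intros [H1 H2] [H3 H4]. split.
  - exact (is_pseries_plus (V := R_NormedModule) _ _ _ _ _ H1 H3).
  - exact (is_pseries_plus (V := R_NormedModule) _ _ _ _ _ H2 H4).
Qed.

Lemma cps_cmul c x t L : cps x t L -> cps (fun n => c * x n) t (c * L).
Proof.
  intros [H1 H2]. split.
  - pose proof (rps_lin (Re c) (- Im c) _ _ t _ _ H1 H2) as H.
    replace (Re (c * L)) with (Re c * Re L + - Im c * Im L)%R by (simpl; unfold Re, Im; ring).
    eapply is_pseries_ext; [| exact H]. intros n; simpl; unfold Re, Im; ring.
  - pose proof (rps_lin (Re c) (Im c) _ _ t _ _ H2 H1) as H.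
    replace (Im (c * L)) with (Re c * Im L + Im c * Re L)%R by (simpl; unfold Re, Im; ring).
    eapply is_pseries_ext; [| exact H]. intros n; simpl; unfold Re, Im; ring.
Qed.

Definition geo (x : nat -> C) (M : R) : Prop := forall n, (Cmod (x n) <= M * (/ 2) ^ n)%R.

Lemma im_le_Cmod (z : C) : (Rabs (Im z) <= Cmod z)%R.
Proof. eapply Rle_trans; [apply Rmax_r | apply Rmax_Cmod]. Qed.

Lemma geo_re x M n : geo x M -> (Rabs (Re (x n)) <= M * (/ 2) ^ n)%R.
Proof. intros H. eapply Rle_trans; [apply re_le_Cmod | apply H]. Qed.

Lemma geo_im x M n : geo x M -> (Rabs (Im (x n)) <= M * (/ 2) ^ n)%R.
Proof. intros H. eapply Rle_trans; [apply im_le_Cmod | apply H]. Qed.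

Lemma radius_of_geo (u : nat -> R) M t : (forall n, Rabs (u n) <= M * (/ 2) ^ n)%R ->
  in01 t -> Rbar_lt (Rabs t) (CV_radius u).
Proof.
  intros H Ht. apply Rbar_lt_le_trans with (Finite 2).
  - simpl. rewrite Rabs_pos_eq; lra.
  - apply (CV_radius_bounded u). exists M. intros n.
    rewrite Rabs_mult, <- RPow_abs, (Rabs_pos_eq 2) by lra.
    apply Rle_trans with (M * (/ 2) ^ n * 2 ^ n)%R.
    + apply Rmult_le_compat_r; [apply pow_le; lra | apply H].
    + rewrite Rmult_assoc, <- Rpow_mult_distr. replace (/ 2 * 2)%R with 1%R by field.
      rewrite pow1. lra.
Qed.

Lemma geo_cps x M t : geo x M -> in01 t -> cps x t (cpsum x t).
Proof.
  intros H Ht. split; apply PSeries_correct, CV_radius_inside.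
  - apply radius_of_geo with M; [intros n; apply geo_re, H | exact Ht].
  - apply radius_of_geo with M; [intros n; apply geo_im, H | exact Ht].
Qed.

Lemma geo_cder x M t : geo x M -> in01 t ->
  cder (cpsum x) t (cpsum (fun n => RtoC (INR (S n)) * x (S n)) t).
Proof.
  intros H Ht. apply cder_iff. unfold cpsum; split; simpl.
  - evar_last.
    + apply is_derive_PSeries. apply radius_of_geo with M; [intros n; apply geo_re, H | exact Ht].
    + apply PSeries_ext. intros n. unfold PS_derive. simpl. unfold Re. ring.
  - evar_last.
    + apply is_derive_PSeries. apply radius_of_geo with M; [intros n; apply geo_im, H | exact Ht].
    + apply PSeries_ext. intros n. unfold PS_derive. simpl. unfold Im. ring.
Qed.

Definition cdelta (c : C) (n : nat) : C := match n with O => c | S _ => 0 end.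

Lemma cps_delta c t : in01 t -> cps (cdelta c) t c.
Proof.
  intros Ht.
  assert (Hg : geo (cdelta c) (Cmod c)).
  { intros [|n]; simpl; [lra |]. rewrite Cmod_0. apply Rmult_le_pos; [apply Cmod_ge_0 |].
    apply Rmult_le_pos; [lra | apply pow_le; lra]. }
  pose proof (geo_cps _ _ _ Hg Ht) as H.
  replace c with (cpsum (cdelta c) t) at 2; [exact H |].
  destruct H as [H1 H2]. apply injective_projections; simpl.
  - rewrite PSeries_decr_1 by (eexists; exact H1).
    rewrite (PSeries_ext _ (fun _ => 0%R)) by (intros n; reflexivity).
    rewrite PSeries_const_0. simpl. unfold Re. ring.
  - rewrite PSeries_decr_1 by (eexists; exact H2).
    rewrite (PSeries_ext _ (fun _ => 0%R)) by (intros n; reflexivity).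
    rewrite PSeries_const_0. simpl. unfold Im. ring.
Qed.

(** The coefficients of the square of a series. *)
Definition qconv (x : nat -> C) (n : nat) : C :=
  ((PS_mult (fun n => Re (x n)) (fun n => Re (x n)) n -
    PS_mult (fun n => Im (x n)) (fun n => Im (x n)) n)%R,
   (PS_mult (fun n => Re (x n)) (fun n => Im (x n)) n +
    PS_mult (fun n => Im (x n)) (fun n => Re (x n)) n)%R).

Lemma cps_conv x M t : geo x M -> in01 t -> cps (qconv x) t (cpsum x t * cpsum x t).
Proof.
  intros H Ht. destruct (geo_cps x M t H Ht) as [H1 H2].
  pose proof (radius_of_geo _ _ _ (fun n => geo_re x M n H) Ht) as R1.
  pose proof (radius_of_geo _ _ _ (fun n => geo_im x M n H) Ht) as R2.
  split.
  - exact (is_pseries_minus (V := R_NormedModule) _ _ _ _ _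
      (is_pseries_mult _ _ _ _ _ H1 H1 R1 R1) (is_pseries_mult _ _ _ _ _ H2 H2 R2 R2)).
  - exact (is_pseries_plus (V := R_NormedModule) _ _ _ _ _
      (is_pseries_mult _ _ _ _ _ H1 H2 R1 R2) (is_pseries_mult _ _ _ _ _ H2 H1 R2 R1)).
Qed.

Lemma PS_mult_bound (u v : nat -> R) M n : (0 <= M)%R ->
  (forall k, (k <= n)%nat -> Rabs (u k) <= M * (/ 2) ^ k)%R ->
  (forall k, (k <= n)%nat -> Rabs (v k) <= M * (/ 2) ^ k)%R ->
  (Rabs (PS_mult u v n) <= INR (S n) * (M * M * (/ 2) ^ n))%R.
Proof.
  intros HM Hu Hv. unfold PS_mult.
  eapply Rle_trans; [apply Rsum_abs |].
  rewrite Rmult_comm, <- (sum_cte (M * M * (/ 2) ^ n) n).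
  apply sum_Rle. intros k Hk. rewrite Rabs_mult.
  replace (M * M * (/ 2) ^ n)%R with ((M * (/ 2) ^ k) * (M * (/ 2) ^ (n - k)))%R.
  - apply Rmult_le_compat; try apply Rabs_pos; [apply Hu; lia | apply Hv; lia].
  - replace n with (k + (n - k))%nat at 2 by lia. rewrite pow_add. ring.
Qed.

Lemma Cmod_le_parts (z : C) : (Cmod z <= Rabs (Re z) + Rabs (Im z))%R.
Proof.
  replace z with (RtoC (Re z) + Ci * RtoC (Im z)) at 1.
  - eapply Rle_trans; [apply Cmod_triangle |]. rewrite Cmod_mult, Cmod_Ci, !Cmod_R. lra.
  - destruct z; apply injective_projections; simpl; unfold Re, Im; simpl; ring.
Qed.

Lemma qconv_bound x M n : (0 <= M)%R ->
  (forall k, (k <= n)%nat -> (Cmod (x k) <= M * (/ 2) ^ k)%R) ->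
  (Cmod (qconv x n) <= INR (S n) * (4 * (M * M) * (/ 2) ^ n))%R.
Proof.
  intros HM H.
  assert (HR : forall k, (k <= n)%nat -> (Rabs (Re (x k)) <= M * (/ 2) ^ k)%R).
  { intros k Hk. eapply Rle_trans; [apply re_le_Cmod | apply H, Hk]. }
  assert (HI : forall k, (k <= n)%nat -> (Rabs (Im (x k)) <= M * (/ 2) ^ k)%R).
  { intros k Hk. eapply Rle_trans; [apply im_le_Cmod | apply H, Hk]. }
  eapply Rle_trans; [apply Cmod_le_parts |]. unfold qconv. simpl Re. simpl Im.
  pose proof (PS_mult_bound _ _ M n HM HR HR). pose proof (PS_mult_bound _ _ M n HM HI HI).
  pose proof (PS_mult_bound _ _ M n HM HR HI). pose proof (PS_mult_bound _ _ M n HM HI HR).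
  set (B := (INR (S n) * (M * M * (/ 2) ^ n))%R) in *.
  replace (INR (S n) * (4 * (M * M) * (/ 2) ^ n))%R with (B + B + (B + B))%R by (unfold B; ring).
  apply Rplus_le_compat.
  - unfold Rminus. eapply Rle_trans; [apply Rabs_triang |]. rewrite Rabs_Ropp. apply Rplus_le_compat; assumption.
  - eapply Rle_trans; [apply Rabs_triang |]. apply Rplus_le_compat; assumption.
Qed.

Lemma qconv_ext x y n : (forall k, (k <= n)%nat -> x k = y k) -> qconv x n = qconv y n.
Proof.
  intros E. unfold qconv, PS_mult.
  apply injective_projections; simpl; f_equal; apply sum_eq; intros k Hk;
    rewrite !E by lia; reflexivity.
Qed.

(** The system x' = a y, y' = b0 + b1 x + b2 x^2, which is the flow of the field dual to the
    invariant form of a cubic curve. *)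
Section Flow.
Variables a b0 b1 b2 x0 y0 : C.

Definition next (x y : nat -> C) (n : nat) : C * C :=
  (a * y n / RtoC (INR (S n)),
   (cdelta b0 n + b1 * x n + b2 * qconv x n) / RtoC (INR (S n))).

(** The recursion for the coefficients refers to all the previous ones; [table n] is correct up to
    index n. *)
Fixpoint table (n : nat) : nat -> C * C :=
  match n with
  | O => fun _ => (x0, y0)
  | S m => fun k => if Nat.leb k m then table m k
                    else next (fun i => fst (table m i)) (fun i => snd (table m i)) m
  end.

Definition cx (n : nat) : C := fst (table n n).
Definition cy (n : nat) : C := snd (table n n).

Lemma table_stable n k : (k <= n)%nat -> table n k = table k k.
Proof.
  induction n as [|n IH]; intros Hk.
  - replace k with 0%nat by lia. reflexivity.
  - destruct (Nat.eq_dec k (S n)) as [-> | Hne]; [reflexivity |].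
    simpl. destruct (Nat.leb_spec k n); [| lia]. apply IH. assumption.
Qed.

Lemma table_next n : table (S n) (S n) = next cx cy n.
Proof.
  cbn [table]. destruct (Nat.leb_spec (S n) n); [lia |]. unfold next.
  rewrite (qconv_ext (fun i => fst (table n i)) cx n); [reflexivity |].
  intros k Hk. unfold cx. rewrite table_stable by exact Hk. reflexivity.
Qed.

Lemma INR_S_neq n : RtoC (INR (S n)) <> 0.
Proof. apply RtoC_neq_0. pose proof (lt_0_INR (S n) ltac:(lia)). lra. Qed.

Lemma cx_next n : RtoC (INR (S n)) * cx (S n) = a * cy n.
Proof.
  unfold cx at 1. rewrite table_next. cbn [fst next].  unfold next; cbn [fst].
  field. apply INR_S_neq.
Qed.

Lemma cy_next n : RtoC (INR (S n)) * cy (S n) = cdelta b0 n + b1 * cx n + b2 * qconv cx n.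
Proof.
  unfold cy at 1. rewrite table_next. unfold next; cbn [snd].
  field. apply INR_S_neq.
Qed.

Variable M : R.
Hypothesis Hx0 : (Cmod x0 <= M)%R.
Hypothesis Hy0 : (Cmod y0 <= M)%R.
Hypothesis Ha : (Cmod a <= / 2)%R.
Hypothesis Hb : (Cmod b0 + Cmod b1 * M + Cmod b2 * (4 * (M * M)) <= M / 2)%R.

(** The convolution of order n has n + 1 terms, each at most a constant times 2^(-n), and this
    factor n + 1 is cancelled by the division by n + 1 which comes from integrating. *)
Lemma coef_bound n : forall k, (k <= n)%nat ->
  (Cmod (cx k) <= M * (/ 2) ^ k)%R /\ (Cmod (cy k) <= M * (/ 2) ^ k)%R.
Proof.
  assert (HM : (0 <= M)%R) by (eapply Rle_trans; [apply Cmod_ge_0 | exact Hx0]).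
  induction n as [|n IH]; intros k Hk.
  - replace k with 0%nat by lia. simpl. unfold cx, cy; simpl. lra.
  - destruct (Nat.eq_dec k (S n)) as [-> | Hne]; [| apply IH; lia].
    destruct (IH n (Nat.le_refl n)) as [Bx By].
    pose proof (qconv_bound cx M n HM (fun k Hk => proj1 (IH k Hk))) as Bq.
    assert (HS : (1 <= INR (S n))%R).
    { rewrite S_INR. pose proof (pos_INR n). lra. }
    assert (Hp : (0 <= (/ 2) ^ n)%R) by (apply pow_le; lra).
    assert (EM : forall z, (Cmod (RtoC (INR (S n)) * z) = INR (S n) * Cmod z)%R).
    { intros z. rewrite Cmod_mult, Cmod_R, Rabs_pos_eq; lra. }
    assert (Hdiv : forall z B, (Cmod (RtoC (INR (S n)) * z) <= INR (S n) * B)%R -> (Cmod z <= B)%R).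
    { intros z B Hz. rewrite EM in Hz. apply Rmult_le_reg_l in Hz; [exact Hz | lra]. }
    assert (Hup : forall B, (0 <= B)%R -> (B <= INR (S n) * B)%R).
    { intros B HB. rewrite <- (Rmult_1_l B) at 1. apply Rmult_le_compat_r; assumption. }
    assert (HMp : (0 <= M * (/ 2) ^ n)%R) by (apply Rmult_le_pos; assumption).
    split.
    + apply Hdiv. rewrite cx_next, Cmod_mult.
      replace (M * (/ 2) ^ S n)%R with (/ 2 * (M * (/ 2) ^ n))%R by (simpl; ring).
      apply Rle_trans with (/ 2 * (M * (/ 2) ^ n))%R; [| apply Hup; lra].
      apply Rmult_le_compat; try apply Cmod_ge_0; assumption.
    + apply Hdiv. rewrite cy_next.
      assert (B0 : (Cmod (cdelta b0 n) <= Cmod b0 * (/ 2) ^ n)%R).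
      { destruct n; simpl; [lra |]. rewrite Cmod_0. apply Rmult_le_pos; [apply Cmod_ge_0 | exact Hp]. }
      apply Rle_trans with (INR (S n) * ((Cmod b0 + Cmod b1 * M + Cmod b2 * (4 * (M * M))) * (/ 2) ^ n))%R.
      * eapply Rle_trans; [apply Cmod_triangle |].
        replace (INR (S n) * ((Cmod b0 + Cmod b1 * M + Cmod b2 * (4 * (M * M))) * (/ 2) ^ n))%R with
          (INR (S n) * (Cmod b0 * (/2)^n + Cmod b1 * (M * (/2)^n)) + Cmod b2 * (INR (S n) * (4 * (M * M) * (/ 2) ^ n)))%R by ring.
        apply Rplus_le_compat.
        -- assert (B1 : (Cmod (b1 * cx n) <= Cmod b1 * (M * (/2)^n))%R).
           { rewrite Cmod_mult. apply Rmult_le_compat_l; [apply Cmod_ge_0 | exact Bx]. }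
           eapply Rle_trans; [apply Cmod_triangle |].
           eapply Rle_trans; [| apply Hup].
           ++ apply Rplus_le_compat; assumption.
           ++ pose proof (Cmod_ge_0 (cdelta b0 n)). pose proof (Cmod_ge_0 (b1 * cx n)). lra.
        -- rewrite Cmod_mult. apply Rmult_le_compat_l; [apply Cmod_ge_0 | exact Bq].
      * apply Rmult_le_compat_l; [lra |].
        replace (M * (/ 2) ^ S n)%R with (M / 2 * (/ 2) ^ n)%R by (simpl; field).
        apply Rmult_le_compat_r; assumption.
Qed.

Lemma quadratic_flow : exists x y : R -> C,
  x 0%R = x0 /\ y 0%R = y0 /\ isC1 x (fun t => a * y t) /\
  isC1 y (fun t => b0 + b1 * x t + b2 * (x t * x t)).
Proof.
  assert (Gx : geo cx M) by (intros n; apply (coef_bound n n (Nat.le_refl n))).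
  assert (Gy : geo cy M) by (intros n; apply (coef_bound n n (Nat.le_refl n))).
  exists (cpsum cx), (cpsum cy).
  assert (Dx : forall t, in01 t -> cder (cpsum cx) t (a * cpsum cy t)).
  { intros t Ht. eapply cder_eq; [apply (geo_cder _ M); assumption |].
    apply cps_unique. apply (cps_ext (fun n => a * cy n)).
    - intros n. symmetry. apply cx_next.
    - apply cps_cmul. apply geo_cps with M; assumption. }
  assert (Dy : forall t, in01 t ->
    cder (cpsum cy) t (b0 + b1 * cpsum cx t + b2 * (cpsum cx t * cpsum cx t))).
  { intros t Ht. eapply cder_eq; [apply (geo_cder _ M); assumption |].
    apply cps_unique. apply (cps_ext (fun n => cdelta b0 n + b1 * cx n + b2 * qconv cx n)).
    - intros n. symmetry. apply cy_next.
    - apply cps_plus; [apply cps_plus |].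
      + apply cps_delta, Ht.
      + apply cps_cmul. apply geo_cps with M; assumption.
      + apply cps_cmul. apply cps_conv with M; assumption. }
  split; [| split; [| split]].
  - unfold cpsum. rewrite !PSeries_0. unfold cx; simpl. symmetry. apply surjective_pairing.
  - unfold cpsum. rewrite !PSeries_0. unfold cy; simpl. symmetry. apply surjective_pairing.
  - intros t Ht. split; [apply Dx, Ht |]. apply ccont_mult; [apply ccont_const |].
    eapply cder_cont, Dy, Ht.
  - intros t Ht. split; [apply Dy, Ht |].
    assert (Cx : continuous (cpsum cx) t) by (eapply cder_cont, Dx, Ht).
    apply ccont_plus; [apply ccont_plus; [apply ccont_const |] |].
    + apply ccont_mult; [apply ccont_const | exact Cx].
    + apply ccont_mult; [apply ccont_const | apply ccont_mult; exact Cx].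
Qed.
End Flow.

Lemma constant_on (f : R -> C) t : (forall s, in01 s -> cder f s 0) -> in01 t -> f t = f 0%R.
Proof.
  intros H Ht. destruct (Req_dec t 0) as [-> | Hn]; [reflexivity |].
  symmetry. apply (eq_is_derive (V := C_R_NormedModule) f 0 t); [| lra].
  intros s Hs. apply H. lra.
Qed.

(** The flow preserves y^2 - F x, so a solution which starts on the curve stays on it.  The bound
    eps on the constant depends on the starting point through M only. *)
Lemma constant_form_arc F dF (HF : regular F dF) (k0 k1 k2 : C) (M : R) : (0 < M)%R ->
  (forall x, dF x = k0 + k1 * x + k2 * (x * x)) ->
  exists eps, (0 < eps)%R /\ forall x0 y0 z, (Cmod x0 <= M)%R -> (Cmod y0 <= M)%R ->
    y0 ^ 2 = F x0 -> (Cmod z <= eps)%R ->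
    exists a : arc F, ax a 0%R = x0 /\ ay a 0%R = y0 /\
      forall t, in01 t -> arc_form a t = z.
Proof.
  intros HM EdF.
  set (K := (Cmod k0 + Cmod k1 * M + Cmod k2 * (4 * (M * M)))%R).
  assert (HK : (0 <= K)%R).
  { unfold K. pose proof (Cmod_ge_0 k0).
    pose proof (Rmult_le_pos _ _ (Cmod_ge_0 k1) (Rlt_le _ _ HM)).
    assert (0 <= 4 * (M * M))%R by nra.
    pose proof (Rmult_le_pos _ _ (Cmod_ge_0 k2) H1). lra. }
  set (eps := Rmin (/ 4) (M / 2 / (K + 1))).
  assert (HE : (0 < eps)%R /\ (eps <= / 4)%R /\ (eps * K <= M / 2)%R).
  { assert (H1 : (0 < M / 2 / (K + 1))%R) by (apply Rdiv_lt_0_compat; lra).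
    split; [unfold eps, Rmin; destruct Rle_dec; lra |].
    split; [apply Rmin_l |].
    apply Rle_trans with (M / 2 / (K + 1) * K)%R; [apply Rmult_le_compat_r; [exact HK | apply Rmin_r] |].
    apply Rle_trans with (M / 2 / (K + 1) * (K + 1))%R; [apply Rmult_le_compat_l; lra |].
    right. field. lra. }
  destruct HE as [He1 [He2 He3]].
  exists eps. split; [exact He1 |]. intros x0 y0 z Hx0 Hy0 Hon Hz.
  destruct (quadratic_flow (2 * z) (z * k0) (z * k1) (z * k2) x0 y0 M Hx0 Hy0) as [x [y [Ex [Ey [Cx Cy]]]]].
  { rewrite Cmod_mult, Cmod_R, Rabs_pos_eq by lra. lra. }
  { rewrite !Cmod_mult.
    replace (Cmod z * Cmod k0 + Cmod z * Cmod k1 * M + Cmod z * Cmod k2 * (4 * (M * M)))%R with (Cmod z * K)%R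
      by (unfold K; ring).
    apply Rle_trans with (eps * K)%R; [apply Rmult_le_compat_r; assumption | exact He3]. }
  assert (HO : forall t, in01 t -> y t ^ 2 = F (x t)).
  { intros t Ht.
    assert (E : y t * y t - F (x t) = y 0%R * y 0%R - F (x 0%R)).
    { apply (constant_on (fun t => y t * y t - F (x t))); [| exact Ht].
      intros s Hs. destruct (Cx s Hs) as [D1 _], (Cy s Hs) as [D2 _].
      eapply cder_eq.
      - apply (cder_plus (fun s => y s * y s) (fun s => - F (x s))).
        + apply cder_mult; exact D2.
        + apply cder_opp. apply (reg_cder F dF HF), D1.
      - simpl. rewrite EdF. ring. }
    rewrite Ex, Ey in E.
    replace (y0 * y0) with (y0 ^ 2) in E by (simpl; ring). rewrite Hon in E.
    replace (y t ^ 2) with (y t * y t - F (x t) + F (x t)) by (simpl; ring).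
    rewrite E. ring. }
  exists (C1_arc F x _ y _ Cx Cy HO). simpl. split; [exact Ex | split; [exact Ey |]].
  intros t Ht. apply (reg_arc_form F dF HF); [exact Ht | |]; simpl.
  - ring.
  - rewrite EdF. ring.
Qed.

(** * Surjectivity of the Abel-Jacobi map of an elliptic curve *)

Section Surjective.
Variable lam : C.
Hypothesis HX : NoDup [RtoC 0; RtoC 1; lam].

Definition ell : curve := Curve 1 [RtoC 0; RtoC 1; lam].

Lemma ell_wf : well_formed ell.
Proof. split; [exact HX | reflexivity]. Qed.

Lemma cubic_bound (y p q r : C) : (Cmod p <= 1)%R -> (Cmod q <= 2)%R -> (Cmod r <= 1 + Cmod lam)%R ->
  y ^ 2 = p * (q * r) -> (Cmod y <= 2 + 2 * Cmod lam)%R.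
Proof.
  intros Hp Hq Hr E. pose proof (Cmod_ge_0 y) as H0. pose proof (Cmod_ge_0 lam) as H1.
  assert (E2 : (Cmod y * Cmod y = Cmod p * (Cmod q * Cmod r))%R).
  { rewrite <- !Cmod_mult. rewrite <- E. f_equal. simpl. ring. }
  assert (H2 : (Cmod p * (Cmod q * Cmod r) <= 1 * (2 * (1 + Cmod lam)))%R).
  { apply Rmult_le_compat; try apply Cmod_ge_0; [apply Rmult_le_pos; apply Cmod_ge_0 | exact Hp |].
    apply Rmult_le_compat; try apply Cmod_ge_0; assumption. }
  destruct (Rle_lt_dec (Cmod y) (2 + 2 * Cmod lam)) as [|Hlt]; [assumption |].
  exfalso. assert ((2 + 2 * Cmod lam) * (2 + 2 * Cmod lam) < Cmod y * Cmod y)%R by nra. nra.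
Qed.

Lemma Cmod_minus_le (u v : C) : (Cmod (u - v) <= Cmod u + Cmod v)%R.
Proof. unfold Cminus. eapply Rle_trans; [apply Cmod_triangle |]. rewrite Cmod_opp. lra. Qed.

(** Every point has |x| <= 1 in the affine chart or |u| <= 1 in the chart at infinity, and there
    the coordinates have a common bound; hence a step size that serves for all points. *)
Lemma small_step : exists eps, (0 < eps)%R /\ forall P z, on_curve ell P -> (Cmod z <= eps)%R ->
  exists s : step ell, step_at s 0%R = P /\ step_int 0 s = z.
Proof.
  set (M := (2 + 2 * Cmod lam)%R).
  assert (HM : (2 <= M)%R) by (unfold M; pose proof (Cmod_ge_0 lam); lra).
  destruct (constant_form_arc _ _ (regular_aff ell HX) lam (- (2) * (1 + lam)) 3 M) as [e1 [He1 H1]]; [lra | |].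
  { intros x. simpl. unfold lin; simpl. ring. }
  destruct (constant_form_arc _ _ (regular_inf ell HX) 1 (- (2) * (1 + lam)) (3 * lam) M) as [e2 [He2 H2]]; [lra | |].
  { intros x. simpl. unfold lin; simpl. ring. }
  exists (Rmin e1 e2). split; [apply Rmin_glb_lt; assumption |].
  assert (HI : forall u w z, (Cmod u <= 1)%R -> w ^ 2 = fpol_inf ell u -> (Cmod z <= e2)%R ->
    exists s : step ell, step_at s 0%R = of_inf_chart ell u w /\ step_int 0 s = z).
  { intros u w z Hu Hw Hz. destruct (H2 u w z) as [a [Ax [Ay Af]]]; [lra | | exact Hw | exact Hz |].
    - apply (cubic_bound w u (1 - u) (1 - lam * u)); [exact Hu | | |].
      + eapply Rle_trans; [apply Cmod_minus_le |]. rewrite Cmod_1. lra.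
      + eapply Rle_trans; [apply Cmod_minus_le |]. rewrite Cmod_1, Cmod_mult.
        pose proof (Cmod_ge_0 lam). pose proof (Cmod_ge_0 u). nra.
      + rewrite Hw. unfold fpol_inf. simpl. ring.
    - exists (Infinite_arc a). split; [simpl; rewrite Ax, Ay; reflexivity |].
      simpl. rewrite (CInt_ext _ (fun _ => z)); [apply CInt_const |].
      intros t Ht. rewrite Af by exact Ht. ring. }
  intros P z HP Hz.
  assert (Hz1 : (Cmod z <= e1)%R) by (eapply Rle_trans; [exact Hz | apply Rmin_l]).
  assert (Hz2 : (Cmod z <= e2)%R) by (eapply Rle_trans; [exact Hz | apply Rmin_r]).
  destruct P as [|x y].
  - destruct (HI 0 0 z) as [s [Es Is]]; [rewrite Cmod_0; lra | unfold fpol_inf; simpl; ring | exact Hz2 |].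
    exists s. split; [| exact Is]. rewrite Es. unfold of_inf_chart. destruct (Ceq_dec 0 0); [reflexivity | contradiction].
  - destruct (Rle_lt_dec (Cmod x) 1) as [Hx | Hx].
    + destruct (H1 x y (- z)) as [a [Ax [Ay Af]]]; [lra | | exact HP | rewrite Cmod_opp; exact Hz1 |].
      * apply (cubic_bound y x (x - 1) (x - lam)); [exact Hx | | |].
        -- eapply Rle_trans; [apply Cmod_minus_le |]. rewrite Cmod_1. lra.
        -- eapply Rle_trans; [apply Cmod_minus_le |]. lra.
        -- cbn [on_curve] in HP. rewrite HP. unfold fpol. simpl. ring.
      * exists (Affine_arc a). split; [simpl; rewrite Ax, Ay; reflexivity |].
        simpl. rewrite (CInt_ext _ (fun _ => z)); [apply CInt_const |].
        intros t Ht. rewrite Af by exact Ht. ring.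
    + assert (Hn : x <> 0) by (intros E; rewrite E, Cmod_0 in Hx; lra).
      destruct (HI (/ x) (y / x ^ 2) z) as [s [Es Is]]; [| | exact Hz2 |].
      * rewrite Cmod_inv by exact Hn. rewrite <- Rinv_1. apply Rinv_le_contravar; lra.
      * cbn [on_curve] in HP. replace ((y / x ^ 2) ^ 2) with (y ^ 2 / x ^ 4) by (simpl; field; exact Hn).
        rewrite HP. unfold fpol, fpol_inf. simpl. field. exact Hn.
      * exists s. split; [| exact Is]. rewrite Es. unfold of_inf_chart.
        destruct (Ceq_dec (/ x) 0) as [E | E].
        -- exfalso. apply C1_neq_0. rewrite <- (Cinv_r x Hn), E. ring.
        -- simpl. f_equal; field; exact Hn.
Qed.

Lemma all_integrals (v : C) : exists (g : path ell) S, joins g Infinity S /\ path_int 0 g = v.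
Proof.
  destruct small_step as [eps [He H]].
  assert (HN : exists n, (Cmod v <= eps * INR (S n))%R).
  { destruct (nfloor_ex (Cmod v / eps)) as [n [_ Hn]].
    - apply Rle_div_r; [exact He |]. rewrite Rmult_0_l. apply Cmod_ge_0.
    - exists n. rewrite S_INR. apply Rlt_le in Hn. apply Rle_div_l in Hn; [| exact He]. lra. }
  destruct HN as [n Hn].
  pose proof (lt_0_INR (S n) ltac:(lia)) as Hp.
  set (z := v / RtoC (INR (S n))).
  assert (Hz : (Cmod z <= eps)%R).
  { unfold z. rewrite Cmod_div by (apply RtoC_neq_0; lra).
    rewrite Cmod_R, Rabs_pos_eq by lra. apply Rle_div_l; assumption. }
  assert (HI : forall m, exists (g : path ell) S, joins g Infinity S /\ path_int 0 g = RtoC (INR m) * z).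
  { induction m as [|m [g [S [Hg Ig]]]].
    - exists [], Infinity. split; [split; [exact I | reflexivity] |]. unfold path_int; simpl. ring.
    - destruct (H S z (joins_on_curve_r _ _ _ _ Hg) Hz) as [s [Es Is]].
      exists (g ++ [s]), (step_at s 1%R). split.
      + apply joins_app with S; [exact Hg |]. apply joins_single_at; [apply ell_wf | exact Es | reflexivity].
      + rewrite path_int_app, path_int_single, Ig, Is, S_INR, RtoC_plus. ring. }
  destruct (HI (S n)) as [g [Q [Hg Ig]]]. exists g, Q. split; [exact Hg |].
  rewrite Ig. unfold z. field. apply RtoC_neq_0; lra.
Qed.
End Surjective.

(** * Integrals modulo periods *)

Section Periods.
Context {X : curve} {G : AbelianGroup}.
Variable I : path X -> G.
Hypothesis HX : well_formed X.
Hypothesis I_app : forall g h, I (g ++ h) = plus (I g) (I h).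
Hypothesis I_rev : forall (g g' : path X), (forall k, path_int k g' = - path_int k g) -> I g' = opp (I g).

Definition cong (z z' : G) : Prop := periods I (minus z z').

Lemma cong_refl z : cong z z.
Proof. unfold cong. rewrite minus_eq_zero. apply generated_zero. Qed.

Lemma cong_eq z z' : z = z' -> cong z z'.
Proof. intros ->; apply cong_refl. Qed.

Lemma cong_sym z z' : cong z z' -> cong z' z.
Proof. unfold cong. intros H. rewrite <- opp_minus. apply generated_opp, H. Qed.

Lemma cong_trans z z' z'' : cong z z' -> cong z' z'' -> cong z z''.
Proof. unfold cong. intros H H'. rewrite (minus_trans z'). apply generated_plus; assumption. Qed.

Lemma minus_plus_plus (a b c d : G) : minus (plus a b) (plus c d) = plus (minus a c) (minus b d).
Proof.
  unfold minus. rewrite opp_plus. rewrite <- !plus_assoc. f_equal.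
  rewrite !plus_assoc. f_equal. apply plus_comm.
Qed.

Lemma cong_plus a b c d : cong a c -> cong b d -> cong (plus a b) (plus c d).
Proof. unfold cong. intros H H'. rewrite minus_plus_plus. apply generated_plus; assumption. Qed.

Lemma cong_opp a b : cong a b -> cong (opp a) (opp b).
Proof.
  unfold cong. intros H. replace (minus (opp a) (opp b)) with (opp (minus a b)).
  - apply generated_opp, H.
  - unfold minus. apply opp_plus.
Qed.

Lemma cong_minus a b c d : cong a c -> cong b d -> cong (minus a b) (minus c d).
Proof. intros H H'. apply cong_plus; [exact H | apply cong_opp, H']. Qed.

Lemma proj_cong z z' : cong z z' -> proj (periods I) z = proj (periods I) z'.
Proof.
  intros H. unfold proj.
  assert (E : coset (periods I) z = coset (periods I) z').
  { apply functional_extensionality. intros w. apply propositional_extensionality.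
    split; intros Hw.
    - exact (cong_trans _ _ _ Hw H).
    - exact (cong_trans _ _ _ Hw (cong_sym _ _ H)). }
  apply subset_eq_compat. exact E.
Qed.

Lemma cong_proj z z' : proj (periods I) z = proj (periods I) z' -> cong z z'.
Proof.
  intros H. apply (f_equal (@proj1_sig _ _)) in H. simpl in H.
  assert (Hz : coset (periods I) z z) by apply cong_refl.
  rewrite H in Hz. exact Hz.
Qed.

Lemma path_independence (g h : path X) P Q :
  on_curve X P -> joins g P Q -> joins h P Q -> cong (I g) (I h).
Proof.
  intros HP Hg Hh. destruct (path_rev X h P Q HX HP Hh) as [h' [Hh' Eh]].
  unfold cong, minus. rewrite <- (I_rev _ _ Eh), <- I_app.
  apply generated_in. exists (g ++ h'), P. split; [| reflexivity].
  apply joins_app with Q; assumption.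
Qed.

Lemma path_between_joins P Q : conn X P Q -> joins (path_between X P Q) P Q.
Proof. intros H. unfold path_between. apply epsilon_spec. exact H. Qed.

Lemma integral_joins (g : path X) P Q : on_curve X P -> joins g P Q -> cong (integral I P Q) (I g).
Proof.
  intros HP Hg. apply path_independence with P Q; [exact HP | | exact Hg].
  apply path_between_joins. exists g; exact Hg.
Qed.

Lemma integral_chasles P Q S : on_curve X P -> conn X P Q -> conn X Q S ->
  cong (integral I P S) (plus (integral I P Q) (integral I Q S)).
Proof.
  intros HP H1 H2. unfold integral at 2 3. rewrite <- I_app. apply integral_joins; [exact HP |].
  apply joins_app with Q; apply path_between_joins; assumption.
Qed.

End Periods.

Lemma loop_integral {X : curve} {G : AbelianGroup} (I : path X -> G) P : well_formed X ->
  (forall g h, I (g ++ h) = plus (I g) (I h)) ->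
  (forall (g g' : path X), (forall k, path_int k g' = - path_int k g) -> I g' = opp (I g)) ->
  on_curve X P -> cong I (integral I P P) zero.
Proof.
  intros HX H1 H2 HP. 
  assert (E : I [] = zero).
  { pose proof (H1 [] []) as E. simpl in E. apply (plus_reg_l (I [])). rewrite <- E. symmetry. apply plus_zero_r. }
  rewrite <- E. apply integral_joins; try assumption. split; [exact HP | reflexivity].
Qed.

Lemma Csqr_eq (u v : C) : u * u = v * v -> u = v \/ u = - v.
Proof.
  intros E. destruct (classic (u - v = 0)) as [H | H].
  - left. replace u with (u - v + v) by ring. rewrite H. ring.
  - right. assert (E2 : u + v = 0).
    { apply NNPP. intros H2. apply (Cmult_neq_0 _ _ H H2).
      replace ((u - v) * (u + v)) with (u * u - v * v) by ring. rewrite E. ring. }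
    replace u with (u + v - v) by ring. rewrite E2. ring.
Qed.

Lemma Csub_neq (u v : C) : u <> v -> u - v <> 0.
Proof. intros H E. apply H. replace u with (u - v + v) by ring. rewrite E. ring. Qed.

Lemma Cinv_neq_0 (u : C) : u <> 0 -> / u <> 0.
Proof. intros H E. apply C1_neq_0. rewrite <- (Cinv_r u H), E. ring. Qed.

Lemma Affine_inj (x y x' y' : C) : Affine x y = Affine x' y' -> x = x' /\ y = y'.
Proof. intros E. inversion E. split; reflexivity. Qed.

(** * The curves V and E_1 and the involution of V over E_1 *)

Section Geometry.
Variables alpha beta : C.
Hypothesis ha0 : alpha <> 0.
Hypothesis hb0 : beta <> 0.
Hypothesis ha1 : alpha ^ 2 <> 1.
Hypothesis hb1 : beta ^ 2 <> 1.
Hypothesis hm : alpha - beta <> 0.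
Hypothesis hp : alpha + beta <> 0.
Hypothesis hab : alpha * beta - 1 <> 0.
Hypothesis hab' : alpha * beta + 1 <> 0.

Local Notation V := (curve_V alpha beta).
Local Notation ab := (alpha * beta).
Local Notation d := (alpha - beta).
Local Notation lam := ((alpha - beta) ^ 2 / (alpha * beta - 1) ^ 2).
Local Notation E1 := (curve_E1 alpha beta).

Lemma hab0 : ab <> 0.
Proof. apply Cmult_neq_0; assumption. Qed.

Lemma V_wf : well_formed V.
Proof.
  assert (H1 : alpha ^ 2 <> 0) by (apply Cpow_nz, ha0).
  assert (H2 : beta ^ 2 <> 0) by (apply Cpow_nz, hb0).
  split; [| reflexivity]. cbn [roots curve_V].
  repeat constructor; cbn [In]; intros H; repeat destruct H as [H | H]; try contradiction.
  - apply C1_neq_0; assumption.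
  - apply (Cmult_neq_0 _ _ H1 H2); auto.
  - apply (Cmult_neq_0 _ _ hab hab').
    replace ((ab - 1) * (ab + 1)) with (alpha ^ 2 * beta ^ 2 - 1) by ring. rewrite H. ring.
  - apply (Cmult_neq_0 _ _ hm hp). replace (d * (alpha + beta)) with (alpha ^ 2 - beta ^ 2) by (simpl; ring).
    rewrite H. ring.
  - apply hb1. replace (beta ^ 2) with (alpha ^ 2 * beta ^ 2 / alpha ^ 2) by (field; exact ha0).
    rewrite H. field. exact ha0.
  - apply ha1. replace (alpha ^ 2) with (alpha ^ 2 * beta ^ 2 / beta ^ 2) by (field; exact hb0).
    rewrite H. field. exact hb0.
Qed.

Lemma lam_neq_0 : lam <> 0.
Proof.
  unfold Cdiv. apply Cmult_neq_0; [apply Cpow_nz, hm | apply Cinv_neq_0, Cpow_nz, hab].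
Qed.

Lemma lam_neq_1 : 1 - lam <> 0.
Proof.
  intros H.
  assert (H1 : (1 - alpha ^ 2) * (1 - beta ^ 2) <> 0).
  { apply Cmult_neq_0; apply Csub_neq; auto. }
  apply H1. replace ((1 - alpha ^ 2) * (1 - beta ^ 2)) with ((1 - lam) * (ab - 1) ^ 2).
  - rewrite H. ring.
  - field. exact hab.
Qed.

Lemma lam_NoDup : NoDup [RtoC 0; RtoC 1; lam].
Proof.
  repeat constructor; cbn [In]; intros H; repeat destruct H as [H | H]; try contradiction.
  - apply C1_neq_0; assumption.
  - apply lam_neq_0; assumption.
  - apply lam_neq_1. rewrite H. ring.
Qed.

Lemma E1_wf : well_formed E1.
Proof. split; [exact lam_NoDup | reflexivity]. Qed.

Lemma fpolE (x : C) : fpol E1 x = x * (x - 1) * (x - lam).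
Proof. unfold fpol. simpl. ring. Qed.

Lemma fpolV (x : C) : fpol V x = x * (x - 1) * (x - alpha ^ 2) * (x - beta ^ 2) * (x - alpha ^ 2 * beta ^ 2).
Proof. unfold fpol. simpl. ring. Qed.

Lemma fpolEi (u : C) : fpol_inf E1 u = u * (1 - u) * (1 - lam * u).
Proof. unfold fpol_inf. cbn [roots curve_E1 fold_right]. ring. Qed.

Lemma fpolVi (u : C) : fpol_inf V u = u * (1 - u) * (1 - alpha ^ 2 * u) * (1 - beta ^ 2 * u) * (1 - alpha ^ 2 * beta ^ 2 * u).
Proof. unfold fpol_inf. cbn [roots curve_V fold_right]. ring. Qed.

Definition dE (x : C) : C := 3 * x * x - 2 * (1 + lam) * x + lam.
Definition dEi (u : C) : C := 3 * lam * u * u - 2 * (1 + lam) * u + 1.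
Definition dV (x : C) : C :=
  let A := alpha ^ 2 in let B := beta ^ 2 in let D := alpha ^ 2 * beta ^ 2 in
  (x - 1) * (x - A) * (x - B) * (x - D) + x * (x - A) * (x - B) * (x - D) +
  x * (x - 1) * (x - B) * (x - D) + x * (x - 1) * (x - A) * (x - D) + x * (x - 1) * (x - A) * (x - B).
Definition dVi (u : C) : C :=
  let A := alpha ^ 2 in let B := beta ^ 2 in let D := alpha ^ 2 * beta ^ 2 in
  (1 - u) * (1 - A * u) * (1 - B * u) * (1 - D * u) - u * (1 - A * u) * (1 - B * u) * (1 - D * u)
  - A * (u * (1 - u) * (1 - B * u) * (1 - D * u)) - B * (u * (1 - u) * (1 - A * u) * (1 - D * u))
  - D * (u * (1 - u) * (1 - A * u) * (1 - B * u)).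

Lemma regular_E : regular (fpol E1) dE.
Proof.
  replace dE with (dlprod (aff_factors E1)); [apply regular_aff, lam_NoDup |].
  apply functional_extensionality. intros x. unfold dE. cbn [aff_factors roots curve_E1 map dlprod lprod].
  unfold lin; cbn [fst snd]. ring.
Qed.

Lemma regular_Ei : regular (fpol_inf E1) dEi.
Proof.
  replace dEi with (dlprod (inf_factors E1)); [apply regular_inf, lam_NoDup |].
  apply functional_extensionality. intros x. unfold dEi. cbn [inf_factors roots curve_E1 map dlprod lprod].
  unfold lin; cbn [fst snd]. ring.
Qed.

Lemma regular_V : regular (fpol V) dV.
Proof.
  replace dV with (dlprod (aff_factors V)); [apply regular_aff, V_wf |].
  apply functional_extensionality. intros x. unfold dV. cbn [aff_factors roots curve_V map dlprod lprod].
  unfold lin; cbn [fst snd]. cbv zeta. ring.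
Qed.

Lemma regular_Vi : regular (fpol_inf V) dVi.
Proof.
  replace dVi with (dlprod (inf_factors V)); [apply regular_inf, V_wf |].
  apply functional_extensionality. intros x. unfold dVi. cbn [inf_factors roots curve_V map dlprod lprod].
  unfold lin; cbn [fst snd]. cbv zeta. ring.
Qed.

(** With u = x/a^2 and w = - y/a^3 as coordinates in the chart at infinity, this is
    (x, y) |-> (a^2/x, - a^3 y/x^3), where a = alpha beta.  In these terms it maps affine arcs
    to arcs at infinity by scaling the coordinates, whether or not x vanishes. *)
Definition sigma (P : point) : point :=
  match P with
  | Infinity => Affine 0 0
  | Affine x y => of_inf_chart V (x / ab ^ 2) (- y / ab ^ 3)
  end.

Lemma sigma_affine (x y : C) : x <> 0 -> sigma (Affine x y) = Affine (ab ^ 2 / x) (- (y * ab ^ 3) / x ^ 3).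
Proof.
  intros Hx. unfold sigma, of_inf_chart. pose proof hab0 as H0.
  destruct (Ceq_dec (x / ab ^ 2) 0) as [E | E].
  - exfalso. apply Hx. replace x with (x / ab ^ 2 * ab ^ 2) by (field; auto). rewrite E. ring.
  - cbn [genus curve_V]. f_equal; field; auto.
Qed.

Lemma sigma_zero (y : C) : sigma (Affine 0 y) = Infinity.
Proof.
  unfold sigma, of_inf_chart. destruct (Ceq_dec (0 / ab ^ 2) 0) as [E | E]; [reflexivity |].
  exfalso. apply E. unfold Cdiv. ring.
Qed.

Lemma sigma_inf_eq (x y : C) : y ^ 2 = fpol V x -> (- y / ab ^ 3) ^ 2 = fpol_inf V (x / ab ^ 2).
Proof.
  intros H. replace ((- y / ab ^ 3) ^ 2) with (y ^ 2 / ab ^ 6) by (field; auto).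
  rewrite H, fpolV, fpolVi. field. auto.
Qed.

Lemma sigma_on P : on_curve V P -> on_curve V (sigma P).
Proof.
  destruct P as [|x y]; intros H.
  - cbn [sigma on_curve]. rewrite fpolV. ring.
  - apply on_curve_inf; [apply V_wf |]. apply sigma_inf_eq, H.
Qed.

Lemma zero_y (x y : C) : y ^ 2 = fpol V x -> fpol V x = 0 -> y = 0.
Proof.
  intros H E. apply NNPP. intros Hn. rewrite E in H. apply (Cmult_neq_0 _ _ Hn Hn). rewrite <- H. ring.
Qed.

Lemma sigma_sigma P : on_curve V P -> sigma (sigma P) = P.
Proof.
  pose proof hab0 as H0. destruct P as [|x y]; intros H.
  - cbn [sigma]. apply sigma_zero.
  - destruct (Ceq_dec x 0) as [-> | Hx].
    + rewrite sigma_zero. cbn [sigma]. f_equal. symmetry. apply (zero_y 0); [exact H |]. rewrite fpolV. ring.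
    + rewrite sigma_affine by exact Hx. rewrite sigma_affine.
      * f_equal; field; auto.
      * unfold Cdiv. apply Cmult_neq_0; [apply Cpow_nz, H0 | apply Cinv_neq_0, Hx].
Qed.

Lemma phi1_affine (x y : C) : x <> ab ->
  phi1 alpha beta (Affine x y) = Affine (d ^ 2 * x / (x - ab) ^ 2) (d ^ 2 * y / ((ab - 1) * (x - ab) ^ 3)).
Proof. intros H. unfold phi1. destruct (Ceq_dec x ab); [contradiction | reflexivity]. Qed.

Lemma phi1_ab (y : C) : phi1 alpha beta (Affine ab y) = Infinity.
Proof. unfold phi1. destruct (Ceq_dec ab ab); [reflexivity | contradiction]. Qed.

Lemma phi1_sigma P : on_curve V P -> phi1 alpha beta (sigma P) = phi1 alpha beta P.
Proof.
  pose proof hab0 as H0. destruct P as [|x y]; intros H.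
  - cbn [sigma]. rewrite phi1_affine by auto. cbn [phi1]. f_equal; field; auto.
  - destruct (Ceq_dec x 0) as [-> | Hx].
    + rewrite sigma_zero, phi1_affine by auto.
      rewrite (zero_y 0 y) by (try exact H; rewrite fpolV; ring).
      cbn [phi1]. f_equal; field; auto.
    + rewrite sigma_affine by exact Hx. destruct (Ceq_dec x ab) as [-> | Hn].
      * rewrite phi1_ab. replace (ab ^ 2 / ab) with ab by (field; auto). apply phi1_ab.
      * assert (Hs : ab - x <> 0) by (apply Csub_neq; auto).
        assert (Hs' : x - ab <> 0) by (apply Csub_neq; auto).
        assert (Hs3 : ab ^ 2 - ab * x <> 0).
        { replace (ab ^ 2 - ab * x) with (ab * (ab - x)) by ring. apply Cmult_neq_0; assumption. }
        rewrite !phi1_affine; [f_equal; field; auto | exact Hn |].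
        { intros E. apply Hn.
          replace x with (ab ^ 2 / (ab ^ 2 / x)) by (field; auto). rewrite E. field; auto. }
Qed.

(** Equality of the first coordinates of phi_1 means (x - x')(x x' - a^2) = 0, and then the second
    coordinates fix the sign of y'. *)
Lemma fibre_phi1 P Q : on_curve V P -> on_curve V Q ->
  phi1 alpha beta P = phi1 alpha beta Q -> Q = P \/ Q = sigma P.
Proof.
  pose proof hab0 as H0.
  assert (Z : forall x y, on_curve V (Affine x y) -> phi1 alpha beta (Affine x y) = Affine 0 0 -> Affine x y = Affine 0 0).
  { intros x y H E. destruct (Ceq_dec x ab) as [-> | Hn]; [rewrite phi1_ab in E; discriminate |].
    assert (Hs' : x - ab <> 0) by (apply Csub_neq; auto).
    rewrite phi1_affine in E by exact Hn. apply Affine_inj in E. destruct E as [E1 E2].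
    assert (x = 0).
    { replace x with (d ^ 2 * x / (x - ab) ^ 2 * ((x - ab) ^ 2 / d ^ 2)) by (field; auto).
      rewrite E1. ring. }
    subst x. f_equal. apply (zero_y 0); [exact H | rewrite fpolV; ring]. }
  destruct P as [|x y], Q as [|x' y']; intros HP HQ E.
  - left; reflexivity.
  - right. cbn [sigma]. apply Z; [exact HQ | symmetry; exact E].
  - right. rewrite (Z x y HP E). symmetry. apply sigma_zero.
  - destruct (Ceq_dec x ab) as [-> | Hn], (Ceq_dec x' ab) as [-> | Hn'].
    + rewrite sigma_affine by exact H0.
      destruct (Csqr_eq y' y) as [-> | ->].
      * cbn [on_curve] in HP, HQ. replace (y' * y') with (y' ^ 2) by ring. replace (y * y) with (y ^ 2) by ring.
        congruence.
      * left; reflexivity.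
      * right. f_equal; field; auto.
    + rewrite phi1_ab, phi1_affine in E by exact Hn'. discriminate.
    + rewrite phi1_ab, phi1_affine in E by exact Hn. discriminate.
    + assert (Hs : x - ab <> 0) by (apply Csub_neq; auto).
      assert (Hs' : x' - ab <> 0) by (apply Csub_neq; auto).
      rewrite !phi1_affine in E by assumption. apply Affine_inj in E. destruct E as [E1 E2].
      assert (F : (x - x') * (x * x' - ab ^ 2) = 0).
      { replace ((x - x') * (x * x' - ab ^ 2)) with
          ((d ^ 2 * x' / (x' - ab) ^ 2 - d ^ 2 * x / (x - ab) ^ 2) * ((x - ab) ^ 2 * (x' - ab) ^ 2 / d ^ 2))
          by (field; auto).
        rewrite E1. ring. }
      assert (Ey : y' = y * (x' - ab) ^ 3 / (x - ab) ^ 3).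
      { replace y' with (d ^ 2 * y' / ((ab - 1) * (x' - ab) ^ 3) * ((ab - 1) * (x' - ab) ^ 3 / d ^ 2)) by (field; auto).
        rewrite <- E2. field; auto. }
      destruct (Ceq_dec x x') as [<- | Hne].
      * left. f_equal. rewrite Ey. field. auto.
      * right. assert (F2 : x * x' = ab ^ 2).
        { replace (x * x') with ((x - x') * (x * x' - ab ^ 2) / (x - x') + ab ^ 2).
          - rewrite F. field. apply Csub_neq, Hne.
          - field. apply Csub_neq, Hne. }
        assert (Hx : x <> 0).
        { intros Ex. rewrite Ex in F2. apply (Cpow_nz ab 2 H0). rewrite <- F2. ring. }
        rewrite sigma_affine by exact Hx.
        assert (Ex' : x' = ab ^ 2 / x).
        { rewrite <- F2. field. exact Hx. }
        f_equal; [exact Ex' |]. rewrite Ey, Ex'. field. auto.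
Qed.

(** The coordinates of V in terms of X, Y and s = d (x + a)/(x - a), a square root of
    4 a X + d^2, where d = alpha - beta; the involution changes the sign of s. *)
Definition lift_x (s : C) : C := ab * (s + d) / (s - d).
Definition lift_y (s Y : C) : C := 8 * ab ^ 3 * d * (ab - 1) * Y / (s - d) ^ 3.

Lemma X_of_s (X s : C) : s * s = 4 * ab * X + d ^ 2 -> X = (s * s - d ^ 2) / (4 * ab).
Proof. intros ->. field. split; auto. Qed.

Lemma lift_on (X Y s : C) : s - d <> 0 -> s * s = 4 * ab * X + d ^ 2 -> Y ^ 2 = fpol E1 X ->
  lift_y s Y ^ 2 = fpol V (lift_x s).
Proof.
  intros Hs HX HY. unfold lift_y, lift_x.
  replace ((8 * ab ^ 3 * d * (ab - 1) * Y / (s - d) ^ 3) ^ 2) with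
    (64 * ab ^ 6 * d ^ 2 * (ab - 1) ^ 2 / (s - d) ^ 6 * Y ^ 2) by (field; auto).
  rewrite HY, fpolE, fpolV. rewrite (X_of_s _ _ HX). field. auto.
Qed.

Lemma lift_x_neq (s : C) : s - d <> 0 -> lift_x s - ab <> 0.
Proof.
  intros Hs. unfold lift_x. replace (ab * (s + d) / (s - d) - ab) with (2 * ab * d / (s - d)) by (field; auto).
  unfold Cdiv. repeat apply Cmult_neq_0; auto. 2: apply Cinv_neq_0, Hs. apply RtoC_neq_0; lra.
Qed.

Lemma lift_phi (X Y s : C) : s - d <> 0 -> s * s = 4 * ab * X + d ^ 2 ->
  phi1 alpha beta (Affine (lift_x s) (lift_y s Y)) = Affine X Y.
Proof.
  intros Hs HX. pose proof (lift_x_neq s Hs) as Hn. pose proof hab0 as H0.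
  assert (Ed : lift_x s - ab = 2 * ab * d / (s - d)) by (unfold lift_x; field; auto).
  rewrite phi1_affine.
  2:{ intros E. apply Hn. rewrite E. ring. }
  rewrite Ed. f_equal.
  - unfold lift_x. rewrite (X_of_s _ _ HX). field. auto.
  - unfold lift_y. field. auto.
Qed.

Lemma phi1_surj S : on_curve E1 S -> exists P, on_curve V P /\ phi1 alpha beta P = S.
Proof.
  pose proof hab0 as H0. destruct S as [|X Y]; intros HS.
  - destruct (exists_sqrt (fpol V ab)) as [y Hy]. exists (Affine ab y). split; [exact Hy | apply phi1_ab].
  - destruct (exists_sqrt (4 * ab * X + d ^ 2)) as [s0 Hs0].
    assert (Hs : exists s, s * s = 4 * ab * X + d ^ 2 /\ s - d <> 0).
    { destruct (Ceq_dec s0 d) as [E | E].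
      - exists (- s0). split; [rewrite <- Hs0; ring |]. rewrite E.
        replace (- d - d) with (- (2) * d) by ring. apply Cmult_neq_0; [| exact hm].
        intros E2. apply C2_neq_0. replace (RtoC 2) with (- - RtoC 2) by ring. rewrite E2. ring.
      - exists s0. split; [rewrite <- Hs0; ring | apply Csub_neq, E]. }
    destruct Hs as [s [Hs1 Hs2]]. exists (Affine (lift_x s) (lift_y s Y)). split.
    + cbn [on_curve]. apply (lift_on X); assumption.
    + apply lift_phi; assumption.
Qed.

(** * Transfer from E_1 to V *)

Variable base : point.
Hypothesis Hbase : on_curve V base.
Hypothesis Hbase_phi : phi1 alpha beta base = Infinity.

Local Notation om := (@omega alpha beta).

Lemma om_app g h : om (g ++ h) = plus (G := C2) (om g) (om h).
Proof. unfold omega. rewrite !path_int_app. reflexivity. Qed.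

Lemma om_rev (g g' : path V) : (forall k, path_int k g' = - path_int k g) -> om g' = opp (G := C2) (om g).
Proof. intros E. unfold omega. rewrite !E. reflexivity. Qed.

Local Notation "z ~~ z'" := (@cong V C2 om z z') (at level 70).

Lemma V_conn P Q : on_curve V P -> on_curve V Q -> conn V P Q.
Proof. intros HP HQ. apply connected; [exact V_wf | discriminate | exact HP | exact HQ]. Qed.

Lemma sigma_base_on : on_curve V (sigma base).
Proof. apply sigma_on, Hbase. Qed.

(** When phi_1 A = S, this is the integral which defines the pull-back of S. *)
Definition fibre_integral (A : point) : C2 := plus (integral om base A) (integral om (sigma base) (sigma A)).

Definition psi_lift (z : C) : C2 := (1 / (1 - ab) * z, 1 / (ab * (1 - ab)) * z).

Lemma C2_plus_comm_mid (a b c d : C2) : plus (plus a b) (plus c d) = plus (plus a c) (plus b d).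
Proof. apply injective_projections; simpl; unfold plus; simpl; ring. Qed.

(** The two sums differ by the integral from A to [sigma A] and back. *)
Lemma fibre_integral_sigma A : on_curve V A -> fibre_integral (sigma A) ~~ fibre_integral A.
Proof.
  intros HA. pose proof (sigma_on _ HA) as HsA. pose proof sigma_base_on as HsO.
  unfold fibre_integral. rewrite sigma_sigma by exact HA.
  set (a := integral om base A). set (b := integral om (sigma base) (sigma A)).
  set (m := integral om A (sigma A)). set (m' := integral om (sigma A) A).
  assert (H1 : integral om base (sigma A) ~~ plus a m).
  { apply integral_chasles; auto using V_wf, om_app, om_rev, V_conn. }
  assert (H2 : integral om (sigma base) A ~~ plus b m').
  { apply integral_chasles; auto using V_wf, om_app, om_rev, V_conn. }
  assert (H3 : plus m m' ~~ zero).
  { eapply cong_trans; [apply cong_sym; apply integral_chasles; auto using V_wf, om_app, om_rev, V_conn |].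
    apply loop_integral; auto using V_wf, om_app, om_rev. }
  eapply cong_trans; [apply cong_plus; [exact H1 | exact H2] |].
  rewrite C2_plus_comm_mid. rewrite <- (plus_zero_r (plus a b)) at 2.
  apply cong_plus; [apply cong_refl | exact H3].
Qed.

Lemma fibre_integral_fibre A B : on_curve V A -> on_curve V B -> phi1 alpha beta A = phi1 alpha beta B ->
  fibre_integral B ~~ fibre_integral A.
Proof.
  intros HA HB E. destruct (fibre_phi1 A B HA HB E) as [-> | ->]; [apply cong_refl | apply fibre_integral_sigma, HA].
Qed.

(** The class of the pull-back of the divisor Q - P is the image of z. *)
Definition transfers (P Q : point) (z : C) : Prop :=
  forall A B, on_curve V A -> on_curve V B -> phi1 alpha beta A = P -> phi1 alpha beta B = Q ->
    minus (G := C2) (fibre_integral B) (fibre_integral A) ~~ psi_lift z.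

Lemma psi_lift_plus z z' : psi_lift (z + z') = plus (G := C2) (psi_lift z) (psi_lift z').
Proof. unfold psi_lift. apply injective_projections; simpl; unfold plus; simpl; ring. Qed.

Lemma psi_lift_opp z : psi_lift (- z) = opp (G := C2) (psi_lift z).
Proof. unfold psi_lift. apply injective_projections; simpl; unfold opp; simpl; ring. Qed.

Lemma psi_lift_zero : psi_lift 0 = zero (G := C2).
Proof. unfold psi_lift. apply injective_projections; simpl; unfold zero; simpl; ring. Qed.

Lemma transfers_refl P : transfers P P 0.
Proof.
  intros A B HA HB E E'. rewrite psi_lift_zero.
  eapply cong_trans; [| apply cong_eq; apply (minus_eq_zero (fibre_integral A))].
  apply cong_minus; [| apply cong_refl]. apply fibre_integral_fibre; congruence.
Qed.

Lemma transfers_sym P Q z : transfers P Q z -> transfers Q P (- z).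
Proof.
  intros H A B HA HB E E'. rewrite psi_lift_opp, <- opp_minus. apply cong_opp. apply H; assumption.
Qed.

Lemma transfers_trans P Q S z w : on_curve E1 Q -> transfers P Q z -> transfers Q S w -> transfers P S (z + w).
Proof.
  intros HQ H1 H2 A B HA HB E E'. destruct (phi1_surj Q HQ) as [D [HD ED]].
  rewrite psi_lift_plus, plus_comm. rewrite (minus_trans (fibre_integral D)).
  apply cong_plus; [apply H2 | apply H1]; assumption.
Qed.

Lemma transfers_unique P Q z w : on_curve E1 P -> on_curve E1 Q -> transfers P Q z -> transfers P Q w -> psi_lift z ~~ psi_lift w.
Proof.
  intros HP HQ H1 H2. destruct (phi1_surj P HP) as [A [HA EA]]. destruct (phi1_surj Q HQ) as [B [HB EB]].
  eapply cong_trans; [apply cong_sym, (H1 A B) | apply (H2 A B)]; assumption.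
Qed.

Lemma transfers_cong P Q z w : psi_lift z ~~ psi_lift w -> transfers P Q z -> transfers P Q w.
Proof. intros E H A B HA HB EA EB. eapply cong_trans; [apply H; assumption | exact E]. Qed.

Lemma transfers_of_paths A B (g h : path V) z :
  on_curve V A -> joins g A B -> joins h (sigma A) (sigma B) ->
  plus (om g) (om h) = psi_lift z -> transfers (phi1 alpha beta A) (phi1 alpha beta B) z.
Proof.
  intros HA Hg Hh E A' B' HA' HB' EA EB.
  assert (HB : on_curve V B) by (eapply joins_on_curve_r; exact Hg).
  eapply cong_trans.
  { apply cong_minus; [apply (fibre_integral_fibre B B') | apply (fibre_integral_fibre A A')]; congruence. }
  rewrite <- E.
  pose proof (sigma_on _ HA) as HsA. pose proof (sigma_on _ HB) as HsB. pose proof sigma_base_on as HsO.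
  unfold fibre_integral.
  eapply cong_trans.
  { apply cong_minus; [apply cong_plus | apply cong_refl].
    - apply (integral_chasles om V_wf om_app om_rev base A B); auto using V_conn.
    - apply (integral_chasles om V_wf om_app om_rev (sigma base) (sigma A) (sigma B)); auto using V_conn. }
  set (a := integral om base A). set (b := integral om (sigma base) (sigma A)).
  rewrite C2_plus_comm_mid.
  replace (minus (plus (plus a b) (plus (integral om A B) (integral om (sigma A) (sigma B)))) (plus a b))
    with (plus (integral om A B) (integral om (sigma A) (sigma B))).
  - apply cong_plus; apply integral_joins; auto using V_wf, om_app, om_rev.
  - apply injective_projections; simpl; unfold minus, plus, opp; simpl; unfold plus, opp; simpl; ring.
Qed.

Lemma sigma_arc (g : arc (fpol V)) : exists h : arc (fpol_inf V),
  (forall t, step_at (Infinite_arc (X := V) h) t = sigma (step_at (Affine_arc (X := V) g) t)) /\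
  (forall t, ax h t = ax g t / ab ^ 2) /\
  forall t, in01 t -> arc_form h t = - ab * arc_form g t.
Proof.
  pose proof hab0 as H0.
  assert (CX := C1_mult _ _ _ _ (arcx_C1 _ g) (C1_const (/ ab ^ 2))).
  assert (CY := C1_mult _ _ _ _ (C1_opp _ _ (arcy_C1 _ g)) (C1_const (/ ab ^ 3))). cbv beta in CX, CY.
  unshelve eexists (C1_arc (fpol_inf V) _ _ _ _ CX CY _).
  - intros t Ht. apply sigma_inf_eq. apply arc_on, Ht.
  - split; [reflexivity | split; [reflexivity |]].
    intros t Ht. destruct (reg_arc_ode _ _ regular_V g t Ht) as [D1 D2].
    apply (reg_arc_form _ _ regular_Vi); [exact Ht | |]; cbn [C1_arc ax ay dax day].
    + rewrite D1. field. auto.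
    + rewrite D2. unfold dV, dVi. cbv zeta. field. auto.
Qed.

(** The identity omega + sigma^* omega = (c_1, d_1) phi_1^* Omega_1, with the form dx/(2y) of a lift
    written as [arc_form g]: the components of the left-hand side are - (x + a) dx/(2y) and
    - (x + a)/a dx/(2y). *)
Lemma transfers_of_lift (s : step E1) (g : arc (fpol V)) :
  phi1 alpha beta (Affine (ax g 0%R) (ay g 0%R)) = step_at s 0%R ->
  phi1 alpha beta (Affine (ax g 1%R) (ay g 1%R)) = step_at s 1%R ->
  (forall t, in01 t ->
     (1 - ab) * ((ax g t + ab) * arc_form g t) = - step_form 0 s t) ->
  transfers (step_at s 0%R) (step_at s 1%R) (step_int 0 s).
Proof.
  intros E0 E1' EF. pose proof hab0 as H0.
  assert (Hab1 : 1 - ab <> 0).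
  { intros E. apply hab. replace (ab - 1) with (- (1 - ab)) by ring. rewrite E. ring. }
  destruct (sigma_arc g) as [h [Hh [Ex Ef]]].
  rewrite <- E0, <- E1'.
  apply (transfers_of_paths _ _ [Affine_arc (X := V) g] [Infinite_arc (X := V) h]).
  - apply (step_on_curve V (Affine_arc g)); [exact V_wf | lra].
  - apply joins_single_at; [exact V_wf | reflexivity | reflexivity].
  - apply joins_single_at; [exact V_wf | |]; apply Hh.
  - assert (HI : forall k, icont (step_form k (Affine_arc (X := V) g))) by (intros k; apply step_form_icont, V_wf).
    assert (HJ : forall k, icont (step_form k (Infinite_arc (X := V) h))) by (intros k; apply step_form_icont, V_wf).
    assert (HS : icont (step_form 0 s)) by (apply step_form_icont, E1_wf).
    unfold omega, psi_lift. rewrite !path_int_single, !step_int_form.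
    rewrite <- !CInt_scal by exact HS.
    apply injective_projections; cbn [fst snd].
    + transitivity (CInt (step_form 1 (Affine_arc (X := V) g)) + CInt (step_form 1 (Infinite_arc (X := V) h))); [reflexivity |].
      rewrite <- CInt_plus by auto. apply CInt_ext. intros t Ht.
      replace (step_form 0 s t) with (- ((1 - ab) * ((ax g t + ab) * arc_form g t))) by (rewrite EF by exact Ht; ring).
      cbn [step_form genus curve_V Nat.sub Cpow]. rewrite Ef by exact Ht. field. exact Hab1.
    + transitivity (CInt (step_form 0 (Affine_arc (X := V) g)) + CInt (step_form 0 (Infinite_arc (X := V) h))); [reflexivity |].
      rewrite <- CInt_plus by auto. apply CInt_ext. intros t Ht.
      replace (step_form 0 s t) with (- ((1 - ab) * ((ax g t + ab) * arc_form g t))) by (rewrite EF by exact Ht; ring).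
      cbn [step_form genus curve_V Nat.sub Cpow]. rewrite Ef, Ex by exact Ht. field. auto.
Qed.

(** * Lifting arcs of E_1 *)

Local Notation astep a := (Affine_arc (X := E1) a).
Local Notation istep a := (Infinite_arc (X := E1) a).

Lemma C4_neq_0 : RtoC 4 <> 0.
Proof. apply RtoC_neq_0; lra. Qed.

(** The function eta is the quotient of the form by s; it is given as data because s may vanish
    together with the form at a branch point.  The condition on s keeps the lift in the affine
    chart of V. *)
Lemma lift_affine (a : arc (fpol E1)) (s ds eta : R -> C) : isC1 s ds ->
  (forall t, in01 t -> s t * s t = 4 * ab * ax a t + d ^ 2) ->
  (forall t, in01 t -> s t <> d) ->
  (forall t, in01 t -> ds t = 4 * ab * ay a t * eta t) ->
  (forall t, in01 t -> s t * eta t = arc_form a t) ->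
  transfers (step_at (astep a) 0%R) (step_at (astep a) 1%R) (step_int 0 (astep a)).
Proof.
  intros Cs Es Hsd Eds Eeta. pose proof hab0 as H0.
  assert (Hn : forall t, in01 t -> s t - d <> 0) by (intros t Ht; apply Csub_neq, Hsd, Ht).
  assert (Hn3 : forall t, in01 t -> (s t - d) * (s t - d) * (s t - d) <> 0).
  { intros t Ht. repeat apply Cmult_neq_0; apply Hn, Ht. }
  assert (CD := C1_minus _ _ _ _ Cs (C1_const d)).
  assert (CX := C1_div _ _ _ _ (C1_mult _ _ _ _ (C1_const ab) (C1_plus _ _ _ _ Cs (C1_const d))) CD Hn).
  assert (CY := C1_div _ _ _ _ (C1_mult _ _ _ _ (C1_const (8 * ab ^ 3 * d * (ab - 1))) (arcy_C1 _ a))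
     (C1_mult _ _ _ _ (C1_mult _ _ _ _ CD CD) CD) Hn3).
  cbv beta in CX, CY.
  assert (EY : forall t, in01 t -> 8 * ab ^ 3 * d * (ab - 1) * ay a t / ((s t - d) * (s t - d) * (s t - d)) = lift_y (s t) (ay a t)).
  { intros t Ht. unfold lift_y. f_equal. ring. }
  unshelve eset (g := C1_arc (fpol V) _ _ _ _ CX CY _).
  { intros t Ht. cbv beta. rewrite EY by exact Ht. apply (lift_on (ax a t)); auto. exact (arc_on _ a t Ht). }
  assert (Ef : forall t, in01 t -> arc_form g t = - (s t - d) * eta t / (2 * ab * (ab - 1))).
  { intros t Ht. destruct (reg_arc_ode _ _ regular_E a t Ht) as [D1 D2].
    pose proof (Hn t Ht) as Hnt.
    pose proof (X_of_s _ _ (Es t Ht)) as EX. pose proof (arc_on _ a t Ht) as EO. rewrite fpolE in EO.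
    apply (reg_arc_form _ _ regular_V); [exact Ht | |]; cbn [C1_arc g ax ay dax day]; subst g; cbn [C1_arc ax ay dax day].
    - rewrite Eds by exact Ht. field. auto.
    - rewrite D2, Eds by exact Ht. rewrite <- (Eeta t Ht).
      transitivity (8 * ab ^ 3 * d * (ab - 1) * (dE (ax a t) * s t * eta t / (s t - d) ^ 3
         - 12 * ab * (ay a t ^ 2) * eta t / (s t - d) ^ 4)); [field; auto |].
      rewrite EO. unfold dE, dV. cbv zeta. rewrite EX. field. auto. }
  apply (transfers_of_lift (astep a) g).
  - subst g. cbn [C1_arc ax ay dax day]. rewrite EY by lra. apply lift_phi; [apply Hn; lra | apply Es; lra].
  - subst g. cbn [C1_arc ax ay dax day]. rewrite EY by lra. apply lift_phi; [apply Hn; lra | apply Es; lra].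
  - intros t Ht. rewrite Ef by exact Ht. cbn [step_form Cpow]. rewrite <- (Eeta t Ht).
    subst g. cbn [C1_arc ax ay dax day]. pose proof (Hn t Ht) as Hnt. field. auto.
Qed.

Definition radicand (x : C) : C := 4 * ab * x + d ^ 2.

Lemma radicand_C1 f df : isC1 f df -> isC1 (fun t => radicand (f t)) (fun t => 4 * ab * df t).
Proof.
  intros H. unfold radicand.
  refine (C1_ext _ _ _ _ (fun t => eq_refl) _ _
    (C1_plus _ _ _ _ (C1_mult _ _ _ _ (C1_const (4 * ab)) H) (C1_const (d ^ 2)))).
  - intros t _. cbv beta. ring.
  - intros t Ht. apply ccont_mult; [apply ccont_const |]. apply (H t Ht).
Qed.

(** At a point with X = 0 the square root of the radicand is d or - d, and only the second value
    lifts to the affine chart of V. *)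
Lemma lift_regular (a : arc (fpol E1)) : radicand (ax a 0%R) <> 0 ->
  (forall t, in01 t -> (0 < Re (radicand (ax a t) / radicand (ax a 0%R)))%R) ->
  (ax a 0%R = 0 \/ forall t, in01 t -> ax a t <> 0) ->
  transfers (step_at (astep a) 0%R) (step_at (astep a) 1%R) (step_int 0 (astep a)).
Proof.
  intros Hn Hp Hx. pose proof hab0 as H0.
  set (r0 := radicand (ax a 0%R)) in *.
  assert (Hs0 : exists s0, s0 * s0 = r0 /\ (ax a 0%R = 0 -> s0 = - d)).
  { destruct (Ceq_dec (ax a 0%R) 0) as [E | E].
    - exists (- d). split; [| auto]. unfold r0, radicand. rewrite E. ring.
    - destruct (exists_sqrt r0) as [w Hw]. exists w. split; [rewrite <- Hw; ring | contradiction]. }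
  destruct Hs0 as [s0 [Es0 Hs0]].
  assert (Hs0n : s0 <> 0) by (intros E; apply Hn; rewrite <- Es0, E; ring).
  set (q := fun t => radicand (ax a t) / r0).
  assert (CQ : isC1 q (fun t => 4 * ab * dax a t * / r0 + radicand (ax a t) * 0)).
  { exact (C1_mult _ _ _ _ (radicand_C1 _ _ (arcx_C1 _ a)) (C1_const (/ r0))). }
  assert (CS := C1_mult _ _ _ _ (C1_const s0) (C1_psqrt _ _ CQ Hp)). cbv beta in CS.
  assert (Hq : forall t, in01 t -> psqrt (q t) <> 0) by (intros t Ht; apply psqrt_neq0, Hp, Ht).
  assert (Es : forall t, in01 t -> (s0 * psqrt (q t)) * (s0 * psqrt (q t)) = 4 * ab * ax a t + d ^ 2).
  { intros t Ht. replace (s0 * psqrt (q t) * (s0 * psqrt (q t))) with (s0 * s0 * (psqrt (q t) * psqrt (q t))) by ring.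
    rewrite psqrt_sqr by (apply Hp, Ht). rewrite Es0. unfold q, radicand. field. exact Hn. }
  apply (lift_affine a _ _ (fun t => arc_form a t / (s0 * psqrt (q t))) CS).
  - exact Es.
  - intros t Ht E.
    destruct Hx as [Hx | Hx].
    + specialize (Hs0 Hx). rewrite Hs0 in E. pose proof (psqrt_re _ (Hp t Ht)) as Hre.
      fold (q t) in Hre.
      assert (Eq : psqrt (q t) = - (1)).
      { replace (psqrt (q t)) with (- d * psqrt (q t) / - d) by (field; exact hm). rewrite E. field. exact hm. }
      rewrite Eq in Hre. simpl in Hre. lra.
    + apply (Hx t Ht). pose proof (Es t Ht) as E2. rewrite E in E2.
      replace (ax a t) with ((4 * ab * ax a t + d ^ 2 - d * d) / (4 * ab)) by (field; auto).
      rewrite <- E2. field; auto.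
  - intros t Ht. destruct (reg_arc_ode _ _ regular_E a t Ht) as [D1 _]. rewrite D1.
    pose proof (Hq t Ht). 
    assert (Er : r0 = s0 * s0) by auto.
    assert (Hn2 : s0 * s0 <> 0) by (apply Cmult_neq_0; assumption).
    rewrite Er. field. auto.
  - intros t Ht. pose proof (Hq t Ht). field. auto.
Qed.

(** The zero of the radicand; for the quadratic path from it, s is a multiple of t. *)
Definition X_branch : C := - d ^ 2 / (4 * ab).

Lemma lift_branch (a : arc (fpol E1)) X1 :
  (forall t, ax a t = square_path X_branch X1 t) ->
  (forall t, in01 t -> ax a t <> 0) ->
  (forall t, in01 t -> ay a t <> 0) ->
  transfers (step_at (astep a) 0%R) (step_at (astep a) 1%R) (step_int 0 (astep a)).
Proof.
  intros Ex Hx Hy. pose proof hab0 as H0.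
  destruct (exists_sqrt (4 * ab * (X1 - X_branch))) as [w Hw].
  assert (Ew : w * w = 4 * ab * (X1 - X_branch)) by (rewrite <- Hw; ring).
  assert (CS := C1_mult _ _ _ _ C1_id (C1_const w)). cbv beta in CS.
  assert (Es : forall t, in01 t -> (RtoC t * w) * (RtoC t * w) = 4 * ab * ax a t + d ^ 2).
  { intros t Ht. replace (t * w * (t * w)) with (t * t * (w * w)) by ring. rewrite Ew, Ex.
    unfold square_path, X_branch. field. auto. }
  apply (lift_affine a _ _ (fun t => w / (4 * ab * ay a t)) CS).
  - exact Es.
  - intros t Ht E. apply (Hx t Ht). pose proof (Es t Ht) as E2. rewrite E in E2.
    replace (ax a t) with ((4 * ab * ax a t + d ^ 2 - d * d) / (4 * ab)) by (field; auto).
    rewrite <- E2. field; auto.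
  - intros t Ht. pose proof (Hy t Ht). field. auto.
  - intros t Ht. pose proof (Hy t Ht) as Hyt.
    destruct (reg_arc_ode _ _ regular_E a t Ht) as [D1 _].
    assert (D2 : dax a t = d_square_path X_branch X1 t).
    { apply (cder_unique (ax a) t); [exact (arc_dax _ a t Ht) |].
      apply (is_derive_ext (V := C_R_NormedModule) (square_path X_branch X1)); [intros u; symmetry; apply Ex |].
      apply (square_path_C1 X_branch X1 t Ht). }
    rewrite D1 in D2. unfold d_square_path in D2.
    replace (arc_form a t) with (2 * ay a t * arc_form a t / (2 * ay a t)) by (field; exact Hyt).
    rewrite D2. replace (X1 - X_branch) with (w * w / (4 * ab)) by (rewrite Ew; field; auto).
    field. auto.
Qed.

(** Translation by the point (e, 0) of order 2, for a root e of the cubic: (X - e) is replaced by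
    F'(e)/(X - e).  It preserves the invariant form. *)
Definition trans_x (e x : C) : C := e + dE e / (x - e).
Definition trans_y (e x y : C) : C := - (dE e * y) / (x - e) ^ 2.

Lemma translate e (He : e = 0 \/ e = 1) (a : arc (fpol E1)) :
  (forall t, in01 t -> ax a t <> e) ->
  exists b : arc (fpol E1), (forall t, ax b t = trans_x e (ax a t)) /\ (forall t, ay b t = trans_y e (ax a t) (ay a t)) /\
    step_int 0 (astep b) = step_int 0 (astep a).
Proof.
  intros Hne.
  assert (Hn : forall t, in01 t -> ax a t - e <> 0) by (intros t Ht; apply Csub_neq, Hne, Ht).
  assert (Hn2 : forall t, in01 t -> (ax a t - e) ^ 2 <> 0) by (intros t Ht; apply Cpow_nz, Hn, Ht).
  assert (CD := C1_minus _ _ _ _ (arcx_C1 _ a) (C1_const e)).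
  assert (CX := C1_plus _ _ _ _ (C1_const e) (C1_div _ _ _ _ (C1_const (dE e)) CD Hn)).
  assert (CY := C1_div _ _ _ _ (C1_opp _ _ (C1_mult _ _ _ _ (C1_const (dE e)) (arcy_C1 _ a)))
     (C1_mult _ _ _ _ CD (C1_mult _ _ _ _ CD (C1_const 1))) Hn2).
  cbv beta in CX, CY.
  unshelve eexists (C1_arc (fpol E1) _ _ _ _ CX CY _).
  - intros t Ht. pose proof (arc_on _ a t Ht) as HO'. pose proof (Hn t Ht) as Hnt. cbv beta.
    replace ((- (dE e * ay a t) / ((ax a t - e) * ((ax a t - e) * 1))) ^ 2) with
      (dE e ^ 2 * ay a t ^ 2 / (ax a t - e) ^ 4) by (field; auto).
    rewrite HO', !fpolE. unfold dE. destruct He as [-> | ->]; field; auto.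
  - split; [intros t; reflexivity | split; [intros t; reflexivity |]].
    cbn [step_int]. apply CInt_ext. intros t Ht. cbn [Cpow]. f_equal. f_equal.
    destruct (reg_arc_ode _ _ regular_E a t Ht) as [D1 D2].
    pose proof (Hn t Ht) as Hnt. pose proof (arc_on _ a t Ht) as HO'. rewrite fpolE in HO'.
    apply (reg_arc_form _ _ regular_E); [exact Ht | |]; cbn [C1_arc ax ay dax day].
    + rewrite D1. field. auto.
    + rewrite D1, D2.
      transitivity (- dE e * (dE (ax a t) / (ax a t - e) ^ 2 - 4 * ay a t ^ 2 / (ax a t - e) ^ 3) * arc_form a t);
        [field; auto |].
      rewrite HO'. unfold dE. destruct He as [-> | ->]; field; auto.
Qed.

Lemma X_branch_neq_0 : X_branch <> 0.
Proof.
  unfold X_branch, Cdiv. apply Cmult_neq_0.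
  - intros E. apply (Cpow_nz d 2 hm). replace (d ^ 2) with (- - d ^ 2) by ring. rewrite E. ring.
  - apply Cinv_neq_0, Cmult_neq_0; [apply C4_neq_0 | apply hab0].
Qed.

Lemma X_branch_neq_1 : X_branch - 1 <> 0.
Proof.
  intros E. apply (Cpow_nz _ 2 hp).
  replace ((alpha + beta) ^ 2) with (- (4 * ab) * (X_branch - 1)) by (unfold X_branch; field; auto).
  rewrite E. ring.
Qed.

Lemma X_branch_neq_lam : X_branch - lam <> 0.
Proof.
  intros E. apply (Cmult_neq_0 _ _ (Cpow_nz _ 2 hm) (Cpow_nz _ 2 hab')).
  replace (d ^ 2 * (ab + 1) ^ 2) with (- (4 * ab * (ab - 1) ^ 2) * (X_branch - lam)) by (unfold X_branch; field; auto).
  rewrite E. ring.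
Qed.

Lemma radicand_eq x : radicand x = 4 * ab * (x - X_branch).
Proof. unfold radicand, X_branch. field. auto. Qed.

Lemma radicand_neq_0 x : x <> X_branch -> radicand x <> 0.
Proof.
  intros H. rewrite radicand_eq. repeat apply Cmult_neq_0; auto; [apply C4_neq_0 | apply Csub_neq, H].
Qed.

(** If both translations fixed the branch value b, then b^2 = lambda and (b - 1)^2 = 1 - lambda,
    hence b = lambda; but b is not a root of the cubic. *)
Lemma good_translation : exists e, (e = 0 \/ e = 1) /\ X_branch - e <> 0 /\ trans_x e X_branch <> 0 /\ trans_x e X_branch <> X_branch.
Proof.
  pose proof X_branch_neq_0 as N0. pose proof X_branch_neq_1 as N1. pose proof X_branch_neq_lam as Nl.
  destruct (Ceq_dec (trans_x 0 X_branch) X_branch) as [E | E].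
  - exists 1. split; [auto | split; [exact N1 |]].
    assert (T1 : trans_x 1 X_branch = (X_branch - lam) / (X_branch - 1)) by (unfold trans_x, dE; field; auto).
    split.
    + rewrite T1. unfold Cdiv. apply Cmult_neq_0; [exact Nl | apply Cinv_neq_0, N1].
    + intros E'. rewrite T1 in E'.
      assert (F1 : X_branch - lam = X_branch * (X_branch - 1)).
      { rewrite <- E' at 2. field. auto. }
      assert (F0 : lam = X_branch * X_branch).
      { rewrite <- E at 1. unfold trans_x, dE. field. auto. }
      apply lam_neq_1.
      assert (F2 : lam = X_branch). 
      { assert (F3 : 2 * (X_branch - X_branch * X_branch) = 0).
        { replace (2 * (X_branch - X_branch * X_branch)) with ((X_branch - X_branch * X_branch) - X_branch * (X_branch - 1)) by ring.
          rewrite <- F1, F0. ring. }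
        rewrite F0. replace (X_branch * X_branch) with (X_branch - 2 * (X_branch - X_branch * X_branch) / 2) by field.
        rewrite F3. field. }
      exfalso. apply Nl. rewrite F2. ring.
  - exists 0. split; [auto |]. split; [| split; [| exact E]].
    + intros E'. apply N0. rewrite <- E'. ring.
    + unfold trans_x, dE. replace (0 + _) with (lam * / X_branch); [| field; auto].
      apply Cmult_neq_0; [apply lam_neq_0 | apply Cinv_neq_0, N0].
Qed.

Lemma trans_x_cont e x : x - e <> 0 -> continuous (trans_x e) x.
Proof.
  intros H. unfold trans_x. apply ccont_plus; [apply ccont_const |].
  unfold Cdiv. apply ccont_mult; [apply ccont_const |].
  apply (ccont_inv (fun y : C => y - e)); [exact H |].
  unfold Cminus. apply ccont_plus; [apply continuous_id | apply ccont_const].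
Qed.

Lemma radicand_cont {U : UniformSpace} (f : U -> C) x : continuous f x -> continuous (fun y => radicand (f y)) x.
Proof.
  intros H. unfold radicand. apply ccont_plus; [| apply ccont_const].
  apply ccont_mult; [apply ccont_const | exact H].
Qed.

Lemma nbhd_regular X0 : radicand X0 <> 0 ->
  exists eps, (0 < eps)%R /\ forall a : arc (fpol E1), ax a 0%R = X0 ->
    (forall t, in01 t -> (Cmod (ax a t - X0) < eps)%R) ->
    transfers (step_at (astep a) 0%R) (step_at (astep a) 1%R) (step_int 0 (astep a)).
Proof.
  intros Hn.
  destruct (ratio_near radicand X0) as [e1 [He1 H1]].
  { apply (radicand_cont (fun x : C => x)). apply continuous_id. }
  { exact Hn. }
  destruct (Ceq_dec X0 0) as [E | E].
  - exists e1. split; [exact He1 |]. intros a E0 Ha. apply lift_regular; rewrite E0.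
    + exact Hn.
    + intros t Ht. apply H1, Ha, Ht.
    + left; exact E.
  - destruct (near_neq_0 (fun x => x) X0) as [e2 [He2 H2]]; [apply continuous_id | exact E |].
    exists (Rmin e1 e2). split; [apply Rmin_glb_lt; assumption |].
    intros a E0 Ha. apply lift_regular; rewrite E0.
    + exact Hn.
    + intros t Ht. apply H1. eapply Rlt_le_trans; [apply Ha, Ht | apply Rmin_l].
    + right. intros t Ht. apply H2. eapply Rlt_le_trans; [apply Ha, Ht | apply Rmin_r].
Qed.

Lemma fpol_X_branch : fpol E1 X_branch <> 0.
Proof.
  rewrite fpolE. apply Cmult_neq_0; [apply Cmult_neq_0 |]; [apply X_branch_neq_0 | apply X_branch_neq_1 | apply X_branch_neq_lam].
Qed.

(** Only arcs n over the quadratic path are lifted directly at a branch point.  A given short arc a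
    with the same end points as n is compared with n after a translation, where both lift: they
    transfer the same divisor, so their integrals have the same image modulo periods. *)
Lemma nbhd_branch Yb : Yb ^ 2 = fpol E1 X_branch ->
  exists eps, (0 < eps)%R /\ forall a : arc (fpol E1), ax a 0%R = X_branch -> ay a 0%R = Yb ->
    (forall t, in01 t -> (Cmod (ax a t - X_branch) < eps)%R) ->
    (Cmod (ay a 1%R - Yb) < eps)%R ->
    transfers (step_at (astep a) 0%R) (step_at (astep a) 1%R) (step_int 0 (astep a)).
Proof.
  intros HY. pose proof fpol_X_branch as HF.
  assert (HYn : Yb <> 0) by (intros E; apply HF; rewrite <- HY, E; ring).
  destruct good_translation as [e [He [Hne [Ht0 Htb]]]].
  assert (Hrt : radicand (trans_x e X_branch) <> 0) by (apply radicand_neq_0, Htb).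
  destruct (reg_arc_near _ _ X_branch regular_E HF) as [e1 [He1 H1]].
  destruct (near_neq_0 (fun x => x - e) X_branch) as [e2 [He2 H2]].
  { unfold Cminus. apply ccont_plus; [apply continuous_id | apply ccont_const]. }
  { exact Hne. }
  destruct (near_neq_0 (fun x => x) X_branch) as [e3 [He3 H3]]; [apply continuous_id | apply X_branch_neq_0 |].
  destruct (ratio_near (fun x => radicand (trans_x e x)) X_branch) as [e4 [He4 H4]].
  { apply radicand_cont, trans_x_cont, Hne. }
  { exact Hrt. }
  destruct (near_neq_0 (trans_x e) X_branch) as [e5 [He5 H5]]; [apply trans_x_cont, Hne | exact Ht0 |].
  destruct (ratio_near (fun y => y) Yb) as [e6 [He6 H6]]; [apply continuous_id | exact HYn |].
  set (eps := Rmin e1 (Rmin e2 (Rmin e3 (Rmin e4 (Rmin e5 e6))))).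
  assert (Heps : (0 < eps /\ eps <= e1 /\ eps <= e2 /\ eps <= e3 /\ eps <= e4 /\ eps <= e5 /\ eps <= e6)%R).
  { unfold eps. repeat split; unfold Rmin; repeat destruct Rle_dec; lra. }
  destruct Heps as [Hp [L1 [L2 [L3 [L4 [L5 L6]]]]]]. clearbody eps.
  exists eps. split; [exact Hp |]. intros a Ex Ey Hx Hy.
  set (X1 := ax a 1%R).
  assert (HX1 : (Cmod (X1 - X_branch) < eps)%R) by (apply Hx; lra).
  (* the arc over the quadratic path ends at the same point as a, and not at its opposite,
     because y has stayed close to Yb *)
  destruct (H1 X1 Yb) as [n [Nx [Ny Np]]]; [lra | exact HY |].
  assert (Hnx : forall t, in01 t -> (Cmod (ax n t - X_branch) < eps)%R).
  { intros t Ht. rewrite Nx. apply square_path_near; assumption. }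
  assert (N0 : step_at (astep n) 0%R = step_at (astep a) 0%R).
  { cbn [step_at]. rewrite Nx, Ny, square_path_0, Ex, Ey. f_equal.
    unfold Cdiv. rewrite Cinv_r by exact HF. rewrite psqrt_1. ring. }
  assert (N1 : step_at (astep n) 1%R = step_at (astep a) 1%R).
  { cbn [step_at]. pose proof (Np 1%R ltac:(lra)) as Hq. rewrite Nx, Ny. rewrite square_path_1 in *. f_equal.
    rewrite <- (psqrt_unique (fpol E1 X1 / fpol E1 X_branch) (ay a 1%R / Yb)).
    - field. exact HYn.
    - exact Hq.
    - apply H6. lra.
    - replace (ay a 1%R / Yb * (ay a 1%R / Yb)) with (ay a 1%R ^ 2 / Yb ^ 2) by (field; exact HYn).
      rewrite HY. rewrite (arc_on _ a 1%R) by lra. reflexivity. }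
  assert (HTn : transfers (step_at (astep n) 0%R) (step_at (astep n) 1%R) (step_int 0 (astep n))).
  { apply (lift_branch n X1 Nx).
    - intros t Ht. apply H3. specialize (Hnx t Ht). lra.
    - intros t Ht. rewrite Ny. apply Cmult_neq_0; [exact HYn | apply psqrt_neq0, Np, Ht]. }
  assert (HT : forall b : arc (fpol E1), ax b 0%R = X_branch ->
    (forall t, in01 t -> (Cmod (ax b t - X_branch) < eps)%R) ->
    transfers (Affine (trans_x e (ax b 0%R)) (trans_y e (ax b 0%R) (ay b 0%R)))
       (Affine (trans_x e (ax b 1%R)) (trans_y e (ax b 1%R) (ay b 1%R))) (step_int 0 (astep b)) /\
    on_curve E1 (Affine (trans_x e (ax b 0%R)) (trans_y e (ax b 0%R) (ay b 0%R))) /\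
    on_curve E1 (Affine (trans_x e (ax b 1%R)) (trans_y e (ax b 1%R) (ay b 1%R)))).
  { intros b E0 Hb. destruct (translate e He b) as [b' [Bx [By Bi]]].
    { intros t Ht E. apply (H2 (ax b t)); [specialize (Hb t Ht); lra |]. rewrite E. ring. }
    rewrite <- Bi, <- !Bx, <- !By. split; [| split].
    - apply (lift_regular b').
      + rewrite Bx, E0. exact Hrt.
      + intros t Ht. rewrite !Bx, E0. apply H4. specialize (Hb t Ht). lra.
      + right. intros t Ht. rewrite Bx. apply H5. specialize (Hb t Ht). lra.
    - apply (step_on_curve E1 (astep b') 0%R E1_wf). lra.
    - apply (step_on_curve E1 (astep b') 1%R E1_wf). lra. }
  destruct (HT a Ex Hx) as [Ta [Oa0 Oa1]].
  destruct (HT n) as [Tn _]; [rewrite Nx; apply square_path_0 | exact Hnx |].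
  apply Affine_inj in N0. destruct N0 as [N0x N0y]. apply Affine_inj in N1. destruct N1 as [N1x N1y].
  rewrite N0x, N0y, N1x, N1y in Tn.
  apply (transfers_cong _ _ (step_int 0 (astep n))).
  - apply (transfers_unique _ _ _ _ Oa0 Oa1 Tn Ta).
  - cbn [step_at] in HTn |- *. rewrite N0x, N0y, N1x, N1y in HTn. exact HTn.
Qed.

Lemma nbhd_affine X0 Y0 : Y0 ^ 2 = fpol E1 X0 ->
  exists eps, (0 < eps)%R /\ forall a : arc (fpol E1), ax a 0%R = X0 -> ay a 0%R = Y0 ->
    (forall t, in01 t -> (Cmod (ax a t - X0) < eps)%R /\ (Cmod (ay a t - Y0) < eps)%R) ->
    transfers (step_at (astep a) 0%R) (step_at (astep a) 1%R) (step_int 0 (astep a)).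
Proof.
  intros HY. destruct (Ceq_dec X0 X_branch) as [-> | Hn].
  - destruct (nbhd_branch Y0 HY) as [eps [He H]]. exists eps. split; [exact He |].
    intros a Ex Ey Ha. apply H; [exact Ex | exact Ey | intros t Ht; apply Ha, Ht | apply Ha; lra].
  - destruct (nbhd_regular X0 (radicand_neq_0 _ Hn)) as [eps [He H]]. exists eps. split; [exact He |].
    intros a Ex Ey Ha. apply H; [exact Ex | intros t Ht; apply Ha, Ht].
Qed.

Lemma chart_change (a : arc (fpol_inf E1)) : (forall t, in01 t -> ax a t <> 0) ->
  exists b : arc (fpol E1), (forall t, ax b t = / ax a t) /\ (forall t, ay b t = ay a t / ax a t ^ 2) /\
    step_int 0 (astep b) = step_int 0 (istep a).
Proof.
  intros Hn.
  assert (Hn2 : forall t, in01 t -> ax a t ^ 2 <> 0) by (intros t Ht; apply Cpow_nz, Hn, Ht).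
  assert (CX := C1_inv _ _ (arcx_C1 _ a) Hn).
  assert (CY := C1_div _ _ _ _ (arcy_C1 _ a)
     (C1_mult _ _ _ _ (arcx_C1 _ a) (C1_mult _ _ _ _ (arcx_C1 _ a) (C1_const 1))) Hn2).
  cbv beta in CX, CY.
  unshelve eexists (C1_arc (fpol E1) _ _ _ _ CX CY _).
  - intros t Ht. pose proof (arc_on _ a t Ht) as HO'. pose proof (Hn t Ht) as Hnt. cbv beta.
    replace ((ay a t / (ax a t * (ax a t * 1))) ^ 2) with (ay a t ^ 2 / ax a t ^ 4) by (field; auto).
    rewrite HO', fpolE, fpolEi. field. auto.
  - split; [intros t; reflexivity | split; [intros t; reflexivity |]].
    cbn [step_int]. apply CInt_ext. intros t Ht.
    destruct (reg_arc_ode _ _ regular_Ei a t Ht) as [D1 D2].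
    pose proof (Hn t Ht) as Hnt. pose proof (arc_on _ a t Ht) as HO'. rewrite fpolEi in HO'.
    rewrite (reg_arc_form _ _ regular_E _ t (- arc_form a t) Ht).
    + cbn [genus curve_E1 Nat.sub Cpow]. ring.
    + cbn [C1_arc ax ay dax day]. rewrite D1. field. auto.
    + cbn [C1_arc ax ay dax day]. rewrite D1, D2.
      transitivity ((dEi (ax a t) / ax a t ^ 2 - 4 * ay a t ^ 2 / ax a t ^ 3) * arc_form a t);
        [field; auto |].
      rewrite HO'. unfold dE, dEi. field. auto.
Qed.

Definition inf_radicand (u : C) : C := 4 * ab + d ^ 2 * u.
Definition inf_cofactor (u : C) : C := (1 - u) * (1 - lam * u).
Definition d_inf_cofactor (u : C) : C := - (1 - lam * u) - lam * (1 - u).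

(** At infinity s has a pole.  Its inverse p = w rho is regular: p^2 = u/(4 a + d^2 u) and
    w^2 = u (1 - u)(1 - lambda u), so rho is a square root of the inverse of a function which is
    nonzero at u = 0.  The lift is the affine one, written in terms of p. *)
Lemma lift_infinite (a : arc (fpol_inf E1)) (rho drho : R -> C) : isC1 rho drho ->
  (forall t, in01 t -> rho t * rho t * (inf_radicand (ax a t) * inf_cofactor (ax a t)) = 1) ->
  (forall t, in01 t -> drho t * (inf_radicand (ax a t) * inf_cofactor (ax a t)) =
     - rho t * (d ^ 2 * inf_cofactor (ax a t) + inf_radicand (ax a t) * d_inf_cofactor (ax a t)) * ay a t * arc_form a t) ->
  transfers (step_at (istep a) 0%R) (step_at (istep a) 1%R) (step_int 0 (istep a)).
Proof.
  intros CR Er Edr. pose proof hab0 as H0.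
  set (p := fun t => ay a t * rho t).
  assert (CP : isC1 p (fun t => day a t * rho t + ay a t * drho t)) by (apply C1_mult; [apply arcy_C1 | exact CR]).
  assert (Hq : forall t, in01 t -> inf_radicand (ax a t) <> 0).
  { intros t Ht E. apply C1_neq_0. rewrite <- (Er t Ht), E. ring. }
  assert (Hm : forall t, in01 t -> inf_cofactor (ax a t) <> 0).
  { intros t Ht E. apply C1_neq_0. rewrite <- (Er t Ht), E. ring. }
  assert (Er2 : forall t, in01 t -> rho t * rho t = / (inf_radicand (ax a t) * inf_cofactor (ax a t))).
  { intros t Ht. pose proof (Hq t Ht). pose proof (Hm t Ht).
    replace (rho t * rho t) with (rho t * rho t * (inf_radicand (ax a t) * inf_cofactor (ax a t)) / (inf_radicand (ax a t) * inf_cofactor (ax a t))) by (field; auto).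
    rewrite Er by exact Ht. field. auto. }
  assert (Hrn : forall t, in01 t -> rho t <> 0).
  { intros t Ht E. apply C1_neq_0. rewrite <- (Er t Ht), E. ring. }
  assert (Ew : forall t, in01 t -> ay a t ^ 2 = ax a t * inf_cofactor (ax a t)).
  { intros t Ht. rewrite (arc_on _ a t Ht), fpolEi. unfold inf_cofactor. ring. }
  assert (Ep2 : forall t, in01 t -> ax a t * (1 - d ^ 2 * (p t * p t)) = 4 * ab * (p t * p t)).
  { intros t Ht.
    assert (E : p t * p t * inf_radicand (ax a t) = ax a t).
    { unfold p. replace (ay a t * rho t * (ay a t * rho t) * inf_radicand (ax a t)) with
        (ay a t ^ 2 * (rho t * rho t) * inf_radicand (ax a t)) by ring.
      rewrite Ew, Er2 by exact Ht. field. split; [apply Hm | apply Hq]; exact Ht. }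
    transitivity (ax a t - d ^ 2 * ax a t * (p t * p t)); [ring |].
    rewrite <- E at 1. unfold inf_radicand. ring. }
  assert (Hd2 : forall t, in01 t -> 1 - d ^ 2 * (p t * p t) <> 0).
  { intros t Ht E. pose proof (Ep2 t Ht) as E2. rewrite E in E2.
    assert (E3 : p t * p t = 0).
    { replace (p t * p t) with (4 * ab * (p t * p t) / (4 * ab)) by (field; auto). rewrite <- E2. field. auto. }
    rewrite E3 in E. apply C1_neq_0. rewrite <- E. ring. }
  assert (Hd : forall t, in01 t -> 1 - d * p t <> 0).
  { intros t Ht E. apply (Hd2 t Ht). replace (1 - d ^ 2 * (p t * p t)) with ((1 - d * p t) * (1 + d * p t)) by ring.
    rewrite E. ring. }
  assert (Eu : forall t, in01 t -> ax a t = 4 * ab * (p t * p t) / (1 - d ^ 2 * (p t * p t))).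
  { intros t Ht. rewrite <- Ep2 by exact Ht. field. apply Hd2, Ht. }
  assert (Dp : forall t, in01 t -> day a t * rho t + ay a t * drho t =
     4 * ab * rho t * inf_cofactor (ax a t) * arc_form a t / inf_radicand (ax a t)).
  { intros t Ht. destruct (reg_arc_ode _ _ regular_Ei a t Ht) as [_ D2].
    pose proof (Hq t Ht) as Hqt. pose proof (Hm t Ht) as Hmt.
    replace (drho t) with (drho t * (inf_radicand (ax a t) * inf_cofactor (ax a t)) / (inf_radicand (ax a t) * inf_cofactor (ax a t))) by (field; auto).
    rewrite Edr, D2 by exact Ht.
    transitivity (rho t * arc_form a t * (dEi (ax a t) - ay a t ^ 2 *
      (d ^ 2 * inf_cofactor (ax a t) + inf_radicand (ax a t) * d_inf_cofactor (ax a t)) / (inf_radicand (ax a t) * inf_cofactor (ax a t)))); [field; auto |].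
    rewrite Ew by exact Ht.
    transitivity (rho t * arc_form a t * (dEi (ax a t) - ax a t *
      (d ^ 2 * inf_cofactor (ax a t) + inf_radicand (ax a t) * d_inf_cofactor (ax a t)) / inf_radicand (ax a t))); [field; auto |].
    replace (dEi (ax a t)) with (inf_cofactor (ax a t) + ax a t * d_inf_cofactor (ax a t)) by (unfold dEi, inf_cofactor, d_inf_cofactor; ring).
    transitivity (rho t * arc_form a t * inf_cofactor (ax a t) * (inf_radicand (ax a t) - d ^ 2 * ax a t) / inf_radicand (ax a t)); [field; auto |].
    unfold inf_radicand at 1. field. auto. }
  assert (CU := arcx_C1 _ a).
  assert (CM : isC1 (fun t => inf_cofactor (ax a t)) (fun t => d_inf_cofactor (ax a t) * dax a t)).
  { unfold inf_cofactor, d_inf_cofactor.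
    refine (C1_ext _ _ _ _ (fun t => eq_refl) _ _ (C1_mult _ _ _ _
       (C1_minus _ _ _ _ (C1_const 1) CU)
       (C1_minus _ _ _ _ (C1_const 1) (C1_mult _ _ _ _ (C1_const lam) CU)))).
    - intros t _. cbv beta. ring.
    - intros t Ht. apply ccont_mult; [| apply (CU t Ht)].
      assert (CUt : continuous (ax a) t) by (eapply C1_cont; [exact CU | exact Ht]).
      unfold Cminus.
      apply ccont_plus.
      + apply ccont_opp, ccont_plus; [apply ccont_const |].
        apply ccont_opp, ccont_mult; [apply ccont_const | exact CUt].
      + apply ccont_opp, ccont_mult; [apply ccont_const |].
        apply ccont_plus; [apply ccont_const | apply ccont_opp, CUt]. }
  assert (CD := C1_minus _ _ _ _ (C1_const 1) (C1_mult _ _ _ _ (C1_const d) CP)).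
  assert (CX := C1_div _ _ _ _ (C1_mult _ _ _ _ (C1_const ab)
      (C1_plus _ _ _ _ (C1_const 1) (C1_mult _ _ _ _ (C1_const d) CP))) CD Hd).
  assert (Hd3 : forall t, in01 t -> (1 - d * p t) * (1 - d * p t) * (1 - d * p t) <> 0).
  { intros t Ht. repeat apply Cmult_neq_0; apply Hd, Ht. }
  assert (CY := C1_div _ _ _ _ (C1_mult _ _ _ _ (C1_const (8 * ab ^ 3 * d * (ab - 1)))
     (C1_mult _ _ _ _ (C1_mult _ _ _ _ CM CM) (C1_mult _ _ _ _ (C1_mult _ _ _ _ CR CR) CR)))
     (C1_mult _ _ _ _ (C1_mult _ _ _ _ CD CD) CD) Hd3).
  cbv beta in CX, CY.
  unshelve eset (g := C1_arc (fpol V) _ _ _ _ CX CY _).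
  { intros t Ht. cbv beta. pose proof (Hd t Ht) as Hdt. pose proof (Hq t Ht) as Hqt. pose proof (Hm t Ht) as Hmt.
    pose proof (Hd2 t Ht) as Hd2t.
    transitivity ((8 * ab ^ 3 * d * (ab - 1)) ^ 2 * inf_cofactor (ax a t) ^ 4 * (rho t * rho t) ^ 3 / (1 - d * p t) ^ 6);
      [field; auto |].
    rewrite Er2 by exact Ht.
    transitivity ((8 * ab ^ 3 * d * (ab - 1)) ^ 2 * inf_cofactor (ax a t) / inf_radicand (ax a t) ^ 3 / (1 - d * p t) ^ 6); [field; auto |].
    replace (inf_radicand (ax a t)) with (4 * ab / (1 - d ^ 2 * (p t * p t))) by (unfold inf_radicand; rewrite Eu by exact Ht; field; auto).
    rewrite fpolV. unfold inf_cofactor. rewrite Eu by exact Ht.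
    field. auto. }
  assert (Ef : forall t, in01 t -> arc_form g t = (1 - d * p t) * arc_form a t / (2 * ab * (ab - 1))).
  { intros t Ht. pose proof (Hd t Ht) as Hdt. pose proof (Hq t Ht) as Hqt. pose proof (Hm t Ht) as Hmt.
    pose proof (Hd2 t Ht) as Hd2t. pose proof (Hrn t Ht) as Hrt.
    destruct (reg_arc_ode _ _ regular_Ei a t Ht) as [D1 _].
    apply (reg_arc_form _ _ regular_V); [exact Ht | |]; subst g; cbn [C1_arc ax ay dax day]; rewrite Dp by exact Ht.
    - transitivity (8 * ab ^ 2 * d * rho t * inf_cofactor (ax a t) * arc_form a t / (inf_radicand (ax a t) * (1 - d * p t) ^ 2)); [field; auto |].
      transitivity (8 * ab ^ 2 * d * (rho t * rho t) * rho t * inf_cofactor (ax a t) ^ 2 * arc_form a t / (1 - d * p t) ^ 2); [| field; auto].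
      rewrite Er2 by exact Ht. field. auto.
    - replace (drho t) with (drho t * (inf_radicand (ax a t) * inf_cofactor (ax a t)) / (inf_radicand (ax a t) * inf_cofactor (ax a t))) by (field; auto).
      rewrite Edr, D1 by exact Ht.
      assert (Ewp : ay a t = p t * rho t * (inf_radicand (ax a t) * inf_cofactor (ax a t))).
      { unfold p. replace (ay a t * rho t * rho t * (inf_radicand (ax a t) * inf_cofactor (ax a t))) with
          (ay a t * (rho t * rho t * (inf_radicand (ax a t) * inf_cofactor (ax a t)))) by ring.
        rewrite Er by exact Ht. ring. }
      rewrite Ewp.
      set (u := ax a t) in *. set (z := arc_form a t). set (r := rho t) in *. set (P := p t) in *.
      transitivity (8 * ab ^ 3 * d * (ab - 1) * z * (
        (4 * d_inf_cofactor u * P * inf_radicand u * inf_cofactor u ^ 2 * ((r * r) * (r * r))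
         - 3 * inf_cofactor u ^ 2 * ((r * r) * (r * r)) * (d ^ 2 * inf_cofactor u + inf_radicand u * d_inf_cofactor u) * P) / (1 - d * P) ^ 3
        + 12 * ab * d * inf_cofactor u ^ 3 * ((r * r) * (r * r)) / inf_radicand u / (1 - d * P) ^ 4)); [field; auto |].
      unfold r. rewrite Er2 by exact Ht. fold u.
      transitivity (8 * ab ^ 3 * d * (ab - 1) * z * (
        (4 * d_inf_cofactor u * P / inf_radicand u - 3 * (d ^ 2 * inf_cofactor u + inf_radicand u * d_inf_cofactor u) * P / inf_radicand u ^ 2) / (1 - d * P) ^ 3
        + 12 * ab * d * inf_cofactor u / inf_radicand u ^ 3 / (1 - d * P) ^ 4)); [field; auto |].
      replace (inf_radicand u) with (4 * ab / (1 - d ^ 2 * (P * P))) by (unfold inf_radicand, u; rewrite Eu by exact Ht; unfold P; field; auto).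
      unfold dV, inf_cofactor, d_inf_cofactor. cbv zeta. unfold u. rewrite Eu by exact Ht. fold P. field. auto. }
  assert (Ephi : forall t, in01 t -> phi1 alpha beta (Affine (ax g t) (ay g t)) = step_at (istep a) t).
  { intros t Ht. pose proof (Hd t Ht) as Hdt. pose proof (Hq t Ht) as Hqt. pose proof (Hm t Ht) as Hmt.
    pose proof (Hd2 t Ht) as Hd2t. pose proof (Hrn t Ht) as Hrt.
    subst g. cbn [C1_arc ax ay dax day step_at]. unfold of_inf_chart.
    destruct (Ceq_dec (ax a t) 0) as [E | E].
    - assert (Ew0 : ay a t = 0).
      { apply NNPP. intros Hn. apply (Cmult_neq_0 _ _ Hn Hn).
        replace (ay a t * ay a t) with (ay a t ^ 2) by ring. rewrite Ew by exact Ht. rewrite E. ring. }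
      assert (Ep0 : p t = 0) by (unfold p; rewrite Ew0; ring).
      rewrite Ep0. replace (ab * (1 + d * 0) / (1 - d * 0)) with ab by (field; intros E'; apply C1_neq_0; rewrite <- E'; ring).
      apply phi1_ab.
    - assert (Hp0 : p t <> 0).
      { intros E'. apply E. rewrite Eu by exact Ht. rewrite E'. field. }
      assert (Hw0 : ay a t <> 0) by (intros E'; apply Hp0; unfold p; rewrite E'; ring).
      assert (Exab : ab * (1 + d * p t) / (1 - d * p t) - ab = 2 * ab * d * p t / (1 - d * p t)) by (field; repeat split; auto).
      rewrite phi1_affine.
      + rewrite Exab. f_equal.
        * rewrite Eu by exact Ht. field; repeat split; auto.
        * cbn [genus curve_E1].
          transitivity (inf_cofactor (ax a t) ^ 2 * rho t ^ 3 / p t ^ 3); [field; repeat split; auto |].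
          unfold p. transitivity (inf_cofactor (ax a t) ^ 2 / ay a t ^ 3); [field; repeat split; auto |].
          replace (inf_cofactor (ax a t)) with (ay a t ^ 2 / ax a t) by (rewrite Ew by exact Ht; field; auto).
          field; repeat split; auto.
      + intros E'. apply Hp0.
        replace (p t) with ((2 * ab * d * p t / (1 - d * p t)) * (1 - d * p t) / (2 * ab * d)) by (field; repeat split; auto).
        rewrite <- Exab, E'. field; repeat split; auto. }
  apply (transfers_of_lift (istep a) g).
  - apply Ephi; lra.
  - apply Ephi; lra.
  - intros t Ht. rewrite Ef by exact Ht. cbn [step_form genus curve_E1 Nat.sub Cpow].
    subst g. cbn [C1_arc ax ay dax day]. pose proof (Hd t Ht) as Hdt. field; repeat split; auto.
Qed.

Lemma inf_product_C1 f df : isC1 f df ->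
  isC1 (fun t => inf_radicand (f t) * inf_cofactor (f t)) (fun t => (d ^ 2 * inf_cofactor (f t) + inf_radicand (f t) * d_inf_cofactor (f t)) * df t).
Proof.
  intros H. unfold inf_radicand, inf_cofactor, d_inf_cofactor.
  refine (C1_ext _ _ _ _ (fun t => eq_refl) _ _ (C1_mult _ _ _ _
     (C1_plus _ _ _ _ (C1_const (4 * ab)) (C1_mult _ _ _ _ (C1_const (d ^ 2)) H))
     (C1_mult _ _ _ _
       (C1_minus _ _ _ _ (C1_const 1) H)
       (C1_minus _ _ _ _ (C1_const 1) (C1_mult _ _ _ _ (C1_const lam) H))))).
  - intros t _. cbv beta. ring.
  - intros t Ht. apply ccont_mult; [| apply (H t Ht)].
    assert (Ht' : continuous f t) by (eapply C1_cont; [exact H | exact Ht]).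
    assert (C1' : continuous (fun t => 1 - f t) t).
    { apply ccont_plus; [apply ccont_const | apply ccont_opp, Ht']. }
    assert (C2' : continuous (fun t => 1 - lam * f t) t).
    { apply ccont_plus; [apply ccont_const | apply ccont_opp, ccont_mult; [apply ccont_const | exact Ht']]. }
    apply ccont_plus.
    + apply ccont_mult; [apply ccont_const |]. apply ccont_mult; assumption.
    + apply ccont_mult.
      * apply ccont_plus; [apply ccont_const | apply ccont_mult; [apply ccont_const | exact Ht']].
      * apply ccont_plus; [apply ccont_opp; exact C2' |].
        apply ccont_opp, ccont_mult; [apply ccont_const | exact C1'].
Qed.

Lemma nbhd_infinity : exists eps, (0 < eps)%R /\ forall a : arc (fpol_inf E1), ax a 0%R = 0 ->
    (forall t, in01 t -> (Cmod (ax a t) < eps)%R) ->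
    transfers (step_at (istep a) 0%R) (step_at (istep a) 1%R) (step_int 0 (istep a)).
Proof.
  pose proof hab0 as H0.
  set (G := fun u => inf_radicand u * inf_cofactor u).
  assert (G0 : G 0 = 4 * ab) by (unfold G, inf_radicand, inf_cofactor; ring).
  assert (HG : G 0 <> 0) by (rewrite G0; apply Cmult_neq_0; [apply C4_neq_0 | exact H0]).
  assert (HC : continuous G (RtoC 0)).
  { unfold G, inf_radicand, inf_cofactor, Cminus.
    assert (HI : continuous (fun x : C => x) (RtoC 0)) by apply continuous_id.
    apply ccont_mult; [apply ccont_plus; [apply ccont_const | apply ccont_mult; [apply ccont_const | exact HI]] |].
    apply ccont_mult; apply ccont_plus; try apply ccont_const; apply ccont_opp; [exact HI |].
    apply ccont_mult; [apply ccont_const | exact HI]. }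
  destruct (ratio_near G 0 HC HG) as [eps [He H]].
  exists eps. split; [exact He |]. intros a E0 Ha.
  destruct (exists_sqrt (/ (4 * ab))) as [r0 Hr0].
  assert (Er0 : r0 * r0 = / G 0) by (rewrite G0, <- Hr0; ring).
  assert (Hp : forall t, in01 t -> (0 < Re (G (ax a t) / G 0))%R).
  { intros t Ht. apply H. replace (ax a t - 0) with (ax a t) by ring. apply Ha, Ht. }
  set (q := fun t => G (ax a t) / G 0).
  assert (CQ := C1_mult _ _ _ _ (inf_product_C1 _ _ (arcx_C1 _ a)) (C1_const (/ G 0))). cbv beta in CQ.
  assert (CS := C1_psqrt q _ CQ Hp).
  assert (Hqn : forall t, in01 t -> psqrt (q t) <> 0) by (intros t Ht; apply psqrt_neq0, Hp, Ht).
  assert (Hqq : forall t, in01 t -> psqrt (q t) * psqrt (q t) = q t) by (intros t Ht; apply psqrt_sqr, Hp, Ht).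
  assert (HGt : forall t, in01 t -> G (ax a t) <> 0).
  { intros t Ht E. apply (re_pos_neq0 _ (Hp t Ht)). rewrite E. unfold Cdiv. ring. }
  assert (CR := C1_mult _ _ _ _ (C1_const r0) (C1_inv _ _ CS Hqn)). cbv beta in CR.
  apply (lift_infinite a _ _ CR).
  - intros t Ht. pose proof (Hqn t Ht). pose proof (HGt t Ht).
    transitivity (r0 * r0 / (psqrt (q t) * psqrt (q t)) * G (ax a t)); [unfold G; field; auto |].
    rewrite Hqq, Er0 by exact Ht. unfold q. field. auto.
  - intros t Ht. pose proof (Hqn t Ht) as Hn. pose proof (HGt t Ht) as HGn.
    destruct (reg_arc_ode _ _ regular_Ei a t Ht) as [D1 _]. rewrite D1.
    change (inf_radicand (ax a t) * inf_cofactor (ax a t)) with (G (ax a t)).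
    set (k := d ^ 2 * inf_cofactor (ax a t) + inf_radicand (ax a t) * d_inf_cofactor (ax a t)).
    transitivity (- r0 * k * ay a t * arc_form a t * G (ax a t) / G 0 / (psqrt (q t) * psqrt (q t)) / psqrt (q t)).
    + field. auto.
    + rewrite Hqq by exact Ht. unfold q at 1. field. auto.
Qed.

(** * Transfer along arbitrary paths *)

Lemma locally_Cmod (z : C) eps : (0 < eps)%R -> locally z (fun w : C => (Cmod (w - z) < eps)%R).
Proof.
  intros He. assert (He2 : (0 < eps / 2)%R) by lra.
  exists (mkposreal _ He2). intros w [B1 B2]. 
  eapply Rle_lt_trans; [apply Cmod_le_parts |].
  change (Rabs (Re (w - z)) < eps / 2)%R in B1. change (Rabs (Im (w - z)) < eps / 2)%R in B2. lra.
Qed.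

Lemma cont_close (f : R -> C) t eps : continuous f t -> (0 < eps)%R ->
  exists dl, (0 < dl)%R /\ forall s, (Rabs (s - t) < dl)%R -> (Cmod (f s - f t) < eps)%R.
Proof.
  intros H He. apply (cont_near f t (fun w => (Cmod (w - f t) < eps)%R) H). apply locally_Cmod, He.
Qed.

Lemma reparam_near t0 t u dl : in01 u -> (Rabs (t - t0) < dl)%R ->
  (Rabs (reparam t0 t u - t0) < dl)%R.
Proof.
  intros Hu H. unfold reparam. replace (t0 + (t - t0) * u - t0)%R with ((t - t0) * u)%R by ring.
  rewrite Rabs_mult, (Rabs_pos_eq u) by lra. pose proof (Rabs_pos (t - t0)). nra.
Qed.

Lemma reparam_0 p q : reparam p q 0 = p.
Proof. unfold reparam. ring. Qed.

Lemma reparam_1 p q : reparam p q 1 = q.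
Proof. unfold reparam. ring. Qed.

Lemma local_affine (a : arc (fpol E1)) t0 : in01 t0 ->
  exists dl, (0 < dl)%R /\ forall t, in01 t -> (Rabs (t - t0) < dl)%R ->
    transfers (step_at (astep a) t0) (step_at (astep a) t) (IntC (step_form 0 (astep a)) t0 t).
Proof.
  intros Ht0. destruct (nbhd_affine (ax a t0) (ay a t0) (arc_on _ a t0 Ht0)) as [eps [He H]].
  destruct (cont_close (ax a) t0 eps) as [d1 [Hd1 H1]]; [eapply C1_cont; [apply arcx_C1 | exact Ht0] | exact He |].
  destruct (cont_close (ay a) t0 eps) as [d2 [Hd2 H2]]; [eapply C1_cont; [apply arcy_C1 | exact Ht0] | exact He |].
  exists (Rmin d1 d2). split; [apply Rmin_glb_lt; assumption |]. intros t Ht Hlt.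
  destruct (sub_affine E1 a t0 t E1_wf Ht0 Ht) as [b [Bx [By Bi]]].
  rewrite <- Bi.
  replace (step_at (astep a) t0) with (step_at (astep b) 0%R) by (cbn [step_at]; rewrite Bx, By, reparam_0; reflexivity).
  replace (step_at (astep a) t) with (step_at (astep b) 1%R) by (cbn [step_at]; rewrite Bx, By, reparam_1; reflexivity).
  apply H.
  - rewrite Bx, reparam_0. reflexivity.
  - rewrite By, reparam_0. reflexivity.
  - intros u Hu. rewrite Bx, By. pose proof (reparam_near t0 t u _ Hu Hlt) as Hr. split.
    + apply H1. eapply Rlt_le_trans; [exact Hr | apply Rmin_l].
    + apply H2. eapply Rlt_le_trans; [exact Hr | apply Rmin_r].
Qed.

(** At parameters with u different from 0 the arc is moved to the affine chart, where branch points
    have been treated. *)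
Lemma local_infinite (a : arc (fpol_inf E1)) t0 : in01 t0 ->
  exists dl, (0 < dl)%R /\ forall t, in01 t -> (Rabs (t - t0) < dl)%R ->
    transfers (step_at (istep a) t0) (step_at (istep a) t) (IntC (step_form 0 (istep a)) t0 t).
Proof.
  intros Ht0.
  assert (Cx : continuous (ax a) t0) by (eapply C1_cont; [apply arcx_C1 | exact Ht0]).
  assert (Cy : continuous (ay a) t0) by (eapply C1_cont; [apply arcy_C1 | exact Ht0]).
  destruct (Ceq_dec (ax a t0) 0) as [E | E].
  - destruct nbhd_infinity as [eps [He H]].
    destruct (cont_close (ax a) t0 eps Cx He) as [d1 [Hd1 H1]].
    exists d1. split; [exact Hd1 |]. intros t Ht Hlt.
    destruct (sub_infinite E1 a t0 t E1_wf Ht0 Ht) as [b [Bx [By Bi]]].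
    rewrite <- Bi.
    replace (step_at (istep a) t0) with (step_at (istep b) 0%R) by (cbn [step_at]; rewrite Bx, By, reparam_0; reflexivity).
    replace (step_at (istep a) t) with (step_at (istep b) 1%R) by (cbn [step_at]; rewrite Bx, By, reparam_1; reflexivity).
    apply H.
    + rewrite Bx, reparam_0. exact E.
    + intros u Hu. rewrite Bx. pose proof (H1 _ (reparam_near t0 t u _ Hu Hlt)) as Hr.
      rewrite E in Hr. replace (ax a (reparam t0 t u)) with (ax a (reparam t0 t u) - 0) by ring. exact Hr.
  - assert (HY : (ay a t0 / ax a t0 ^ 2) ^ 2 = fpol E1 (/ ax a t0)).
    { replace ((ay a t0 / ax a t0 ^ 2) ^ 2) with (ay a t0 ^ 2 / ax a t0 ^ 4) by (field; auto).
      rewrite (arc_on _ a t0 Ht0), fpolE, fpolEi. field. auto. }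
    destruct (nbhd_affine _ _ HY) as [eps [He H]].
    destruct (cont_near (ax a) t0 (fun w => w <> 0) Cx (locally_neq0 _ E)) as [d0 [Hd0 H0]].
    destruct (cont_close (fun t => / ax a t) t0 eps) as [d1 [Hd1 H1]]; [apply ccont_inv; assumption | exact He |].
    destruct (cont_close (fun t => ay a t / ax a t ^ 2) t0 eps) as [d2 [Hd2 H2]].
    { unfold Cdiv. apply ccont_mult; [exact Cy |]. apply (ccont_inv (fun t => ax a t ^ 2)); [apply Cpow_nz, E |].
      apply ccont_mult; [exact Cx |]. apply ccont_mult; [exact Cx | apply ccont_const]. }
    { exact He. }
    exists (Rmin d0 (Rmin d1 d2)). split; [repeat apply Rmin_glb_lt; assumption |]. intros t Ht Hlt.
    assert (Hlts : (Rabs (t - t0) < d0 /\ Rabs (t - t0) < d1 /\ Rabs (t - t0) < d2)%R).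
    { repeat split; eapply Rlt_le_trans; try exact Hlt.
      - apply Rmin_l.
      - eapply Rle_trans; [apply Rmin_r | apply Rmin_l].
      - eapply Rle_trans; [apply Rmin_r | apply Rmin_r]. }
    destruct Hlts as [L0 [L1 L2]].
    destruct (sub_infinite E1 a t0 t E1_wf Ht0 Ht) as [b [Bx [By Bi]]].
    destruct (chart_change b) as [c [Ex [Ey Ei]]].
    { intros u Hu. rewrite Bx. apply H0. apply reparam_near; assumption. }
    rewrite <- Bi, <- Ei.
    assert (ES : forall v, ax a v <> 0 -> step_at (istep a) v = Affine (/ ax a v) (ay a v / ax a v ^ 2)).
    { intros v Hv. cbn [step_at]. unfold of_inf_chart. destruct (Ceq_dec (ax a v) 0); [contradiction | reflexivity]. }
    replace (step_at (istep a) t0) with (step_at (astep c) 0%R).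
    2:{ rewrite ES by exact E. cbn [step_at]. rewrite Ex, Ey, Bx, By, reparam_0. reflexivity. }
    replace (step_at (istep a) t) with (step_at (astep c) 1%R).
    2:{ rewrite ES by (apply H0, L0). cbn [step_at]. rewrite Ex, Ey, Bx, By, reparam_1. reflexivity. }
    apply H.
    + rewrite Ex, Bx, reparam_0. reflexivity.
    + rewrite Ey, Bx, By, reparam_0. reflexivity.
    + intros u Hu. rewrite Ex, Ey, Bx, By. split.
      * apply H1. apply reparam_near; assumption.
      * apply H2. apply reparam_near; assumption.
Qed.

Lemma transfers_step (s : step E1) : transfers (step_at s 0%R) (step_at s 1%R) (step_int 0 s).
Proof.
  rewrite step_int_form, CInt_IntC.
  assert (HI : icont (step_form 0 s)) by (apply step_form_icont, E1_wf).
  apply (local_equivalence (fun p q => transfers (step_at s p) (step_at s q) (IntC (step_form 0 s) p q))).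
  - intros t Ht. rewrite IntC_point. apply transfers_refl.
  - intros p q Hp Hq H. rewrite IntC_swap by exact HI. apply transfers_sym, H.
  - intros p q r Hp Hq Hr H1 H2. rewrite <- (IntC_Chasles _ p q r HI).
    apply transfers_trans with (step_at s q); [apply step_on_curve; [apply E1_wf | exact Hq] | exact H1 | exact H2].
  - intros t0 Ht0. destruct s as [a | a]; [apply local_affine, Ht0 | apply local_infinite, Ht0].
Qed.

Lemma transfers_path (g : path E1) P Q : joins g P Q -> transfers P Q (path_int 0 g).
Proof.
  revert P. induction g as [|s g IH]; intros P H.
  - destruct H as [_ <-]. apply transfers_refl.
  - destruct H as [<- H]. apply (transfers_trans _ (step_at s 1%R) _ (step_int 0 s) (path_int 0 g)).
    + apply step_on_curve; [apply E1_wf | lra].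
    + apply transfers_step.
    + apply IH, H.
Qed.

Local Notation Om := (@Omega1 alpha beta).

(** A closed path transfers the zero divisor. *)
Lemma psi_lift_periods z : periods Om z -> periods om (psi_lift z).
Proof.
  assert (D : forall w : C2, w ~~ zero (G := C2) -> periods om w).
  { intros w Hw. unfold cong in Hw. replace w with (minus w (zero (G := C2))); [exact Hw |].
    apply injective_projections; simpl; unfold minus, plus, opp, zero; simpl; unfold plus, opp; simpl; ring. }
  induction 1 as [z [g [P [Hg ->]]] | | z z' _ IH _ IH' | z _ IH].
  - apply D. rewrite <- psi_lift_zero. pose proof (joins_on_curve_l _ _ _ _ E1_wf Hg) as HP.
    apply (transfers_unique P P); [exact HP | exact HP | apply transfers_path, Hg | apply transfers_refl].
  - apply D. apply cong_eq, psi_lift_zero.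
  - change (periods om (psi_lift (z + z'))). rewrite psi_lift_plus. apply generated_plus; assumption.
  - change (periods om (psi_lift (- z))). rewrite psi_lift_opp. apply generated_opp; assumption.
Qed.

Lemma psi_lift_cong z w : @cong E1 C_AbelianGroup Om z w -> psi_lift z ~~ psi_lift w.
Proof.
  unfold cong. intros H. apply psi_lift_periods in H.
  replace (minus (G := C2) (psi_lift z) (psi_lift w)) with (psi_lift (minus (G := C_AbelianGroup) z w)); [exact H |].
  change (psi_lift (z + - w) = minus (G := C2) (psi_lift z) (psi_lift w)). rewrite psi_lift_plus, psi_lift_opp. reflexivity.
Qed.

Lemma Om_app g h : Om (g ++ h) = plus (G := C_AbelianGroup) (Om g) (Om h).
Proof. unfold Omega1. apply path_int_app. Qed.

Lemma Om_rev (g g' : path E1) : (forall k, path_int k g' = - path_int k g) -> Om g' = opp (G := C_AbelianGroup) (Om g).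
Proof. intros E. unfold Omega1. apply E. Qed.

Lemma abel_inv_spec (v : C) (p := proj_E1 alpha beta v) :
  on_curve E1 (abel_inv Om p) /\ abel Om (abel_inv Om p) = p.
Proof.
  unfold abel_inv. apply epsilon_spec.
  destruct (all_integrals lam lam_NoDup v) as [g [S [Hg Ig]]].
  exists S. split; [apply (joins_on_curve_r _ _ _ _ Hg) |].
  unfold abel, p, proj_E1. apply proj_cong.
  eapply cong_trans; [apply (integral_joins Om E1_wf Om_app Om_rev g Infinity S); [exact I | exact Hg] |].
  apply cong_eq. exact Ig.
Qed.

(** If the chosen fibre is (S1, S2) and S1 is fixed by [sigma], then S2 = S1, so that S2 = [sigma S1]
    in all cases. *)
Lemma fibre_spec S : on_curve E1 S ->
  let T := fibre V (phi1 alpha beta) S in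
  on_curve V (fst T) /\ phi1 alpha beta (fst T) = S /\ snd T = sigma (fst T).
Proof.
  intros HS. cbv zeta.
  assert (H : on_curve V (fst (fibre V (phi1 alpha beta) S)) /\ on_curve V (snd (fibre V (phi1 alpha beta) S)) /\
    forall P, on_curve V P -> (phi1 alpha beta P = S <->
      P = fst (fibre V (phi1 alpha beta) S) \/ P = snd (fibre V (phi1 alpha beta) S))).
  { unfold fibre. 
    apply (epsilon_spec (inhabits (Infinity, Infinity)) (fun T : point * point =>
      on_curve V (fst T) /\ on_curve V (snd T) /\
      forall P, on_curve V P -> (phi1 alpha beta P = S <-> P = fst T \/ P = snd T))).
    destruct (phi1_surj S HS) as [A [HA EA]]. exists (A, sigma A). cbn [fst snd].
    split; [exact HA | split; [apply sigma_on, HA |]].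
    intros P HP. split.
    - intros E. apply fibre_phi1; [exact HA | exact HP | congruence].
    - intros [-> | ->]; [exact EA | rewrite phi1_sigma; assumption]. }
  set (T := fibre V (phi1 alpha beta) S) in *. destruct H as [H1 [H2 H3]].
  assert (E1' : phi1 alpha beta (fst T) = S) by (apply H3; auto).
  assert (E2' : phi1 alpha beta (snd T) = S) by (apply H3; auto).
  split; [exact H1 | split; [exact E1' |]].
  assert (Es : phi1 alpha beta (sigma (fst T)) = S) by (rewrite phi1_sigma; assumption).
  destruct (proj1 (H3 _ (sigma_on _ H1)) Es) as [E | E]; [| symmetry; exact E].
  destruct (fibre_phi1 (fst T) (snd T) H1 H2) as [E3 | E3]; [congruence | congruence | exact E3].
Qed.

Lemma pullback_psi_lift (v : C) : sigma base = chi base ->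
  pullback om (phi1 alpha beta) base (abel_inv Om (proj_E1 alpha beta v)) = proj (periods om) (psi_lift v).
Proof.
  intros HchiO. destruct (abel_inv_spec v) as [HS ES].
  set (S := abel_inv Om (proj_E1 alpha beta v)) in *.
  destruct (fibre_spec S HS) as [HT [ET Es]].
  unfold pullback. set (T := fibre V (phi1 alpha beta) S) in *.
  apply proj_cong. rewrite Es, <- HchiO. change (fibre_integral (fst T) ~~ psi_lift v).
  assert (HC : conn E1 Infinity S).
  { apply connected; [exact E1_wf | discriminate | exact I | exact HS]. }
  pose proof (path_between_joins (X := E1) Infinity S HC) as Hg.
  assert (Hv : psi_lift (Om (path_between E1 Infinity S)) ~~ psi_lift v).
  { apply psi_lift_cong. apply cong_proj. exact ES. }
  pose proof (transfers_path _ _ _ Hg base (fst T) Hbase HT Hbase_phi ET) as HTR.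
  assert (Hbase0 : fibre_integral base ~~ zero (G := C2)).
  { unfold fibre_integral. eapply cong_trans.
    - apply cong_plus; apply loop_integral; auto using V_wf, om_app, om_rev, sigma_base_on.
    - apply cong_eq. apply plus_zero_r. }
  eapply cong_trans; [| exact Hv].
  eapply cong_trans; [| exact HTR].
  eapply cong_trans; [| apply cong_minus; [apply cong_refl | apply cong_sym, Hbase0]].
  apply cong_eq. apply injective_projections; simpl; unfold minus, plus, opp, zero; simpl; unfold plus, opp; simpl; ring.
Qed.

End Geometry.

(** * The two halves of the theorem *)

Lemma parameters_nonzero (alpha beta : C) (ha0 : alpha ^ 2 <> 0) (hb0 : beta ^ 2 <> 0)
    (hab : alpha ^ 2 <> beta ^ 2) (hab1 : alpha ^ 2 * beta ^ 2 <> 1) :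
  alpha <> 0 /\ beta <> 0 /\ alpha - beta <> 0 /\ alpha + beta <> 0 /\
  alpha * beta - 1 <> 0 /\ alpha * beta + 1 <> 0.
Proof.
  assert (E1 : alpha ^ 2 = (alpha - beta) * (alpha + beta) + beta ^ 2) by ring.
  assert (E2 : alpha ^ 2 * beta ^ 2 = (alpha * beta - 1) * (alpha * beta + 1) + 1) by ring.
  repeat split; intros E.
  - apply ha0. rewrite E. ring.
  - apply hb0. rewrite E. ring.
  - apply hab. rewrite E1, E. ring.
  - apply hab. rewrite E1, E. ring.
  - apply hab1. rewrite E2, E. ring.
  - apply hab1. rewrite E2, E. ring.
Qed.

Lemma psi1_star_proj (alpha beta : C) (csqrt : C -> C)
    (hsqrt : forall z : C, csqrt z ^ 2 = z)
    (ha0 : alpha ^ 2 <> 0) (ha1 : alpha ^ 2 <> 1)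
    (hb0 : beta ^ 2 <> 0) (hb1 : beta ^ 2 <> 1)
    (hab : alpha ^ 2 <> beta ^ 2) (hab1 : alpha ^ 2 * beta ^ 2 <> 1) (v : C) :
  psi1_star alpha beta csqrt (proj_E1 alpha beta v) =
  proj_V alpha beta (psi_tilde (1 / (1 - alpha * beta)) (1 / (alpha * beta * (1 - alpha * beta))) v).
Proof.
  destruct (parameters_nonzero alpha beta ha0 hb0 hab hab1) as [Ha [Hb [Hm [Hp [H1 H2]]]]].
  unfold psi1_star, proj_V. change (psi_tilde _ _ v) with (psi_lift alpha beta v).
  apply pullback_psi_lift; try assumption.
  - unfold O1. cbn [on_curve]. rewrite fpolV.
    transitivity ((alpha * beta) ^ 2 * csqrt (alpha * beta) ^ 2 * (alpha * beta - 1) ^ 2 * (alpha - beta) ^ 2); [ring |].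
    rewrite hsqrt. ring.
  - apply phi1_ab.
  - unfold O1. rewrite sigma_affine; [| assumption | assumption | apply Cmult_neq_0; assumption].
    cbn [chi]. f_equal; field; auto.
Qed.

(** The curves and maps for (alpha, - beta) are only provably equal to those of index 2 for
    (alpha, beta); this carries a statement about pull-backs, which lives in types depending on
    the curves, across such equalities. *)
Lemma psi_transport (alpha beta : C) (V' E' : curve) (phi' : point -> point) (O' : point)
  (f : C -> C2) :
  curve_V alpha beta = V' -> curve_E1 alpha beta = E' -> (forall P, phi1 alpha beta P = phi' P) ->
  forall O, O = O' ->
  (forall v, pullback (X := curve_V alpha beta) (G := C2) (fun g => (path_int 1 g, path_int 0 g)) (phi1 alpha beta) O
     (abel_inv (X := curve_E1 alpha beta) (G := C_AbelianGroup) (fun g => path_int 0 g)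
        (proj (periods (X := curve_E1 alpha beta) (G := C_AbelianGroup) (fun g => path_int 0 g)) v)) =
     proj (periods (X := curve_V alpha beta) (G := C2) (fun g => (path_int 1 g, path_int 0 g))) (f v)) ->
  forall v, pullback (X := V') (G := C2) (fun g => (path_int 1 g, path_int 0 g)) phi' O'
     (abel_inv (X := E') (G := C_AbelianGroup) (fun g => path_int 0 g)
        (proj (periods (X := E') (G := C_AbelianGroup) (fun g => path_int 0 g)) v)) =
     proj (periods (X := V') (G := C2) (fun g => (path_int 1 g, path_int 0 g))) (f v).
Proof.
  intros <- <- Ephi O <-. apply functional_extensionality in Ephi. subst phi'. auto.
Qed.

Theorem proposition5p6 (alpha beta : C) (csqrt : C -> C)
    (hsqrt : forall z : C, csqrt z ^ 2 = z)
    (ha0 : alpha ^ 2 <> 0) (ha1 : alpha ^ 2 <> 1)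
    (hb0 : beta ^ 2 <> 0) (hb1 : beta ^ 2 <> 1)
    (hab : alpha ^ 2 <> beta ^ 2) (hab1 : alpha ^ 2 * beta ^ 2 <> 1) :
  let c1 := 1 / (1 - alpha * beta) in
  let d1 := 1 / (alpha * beta * (1 - alpha * beta)) in
  let c2 := 1 / (1 + alpha * beta) in
  let d2 := - (1 / (alpha * beta * (1 + alpha * beta))) in
  (forall v : C,
     psi1_star alpha beta csqrt (proj_E1 alpha beta v) = proj_V alpha beta (psi_tilde c1 d1 v)) /\
  (forall v : C,
     psi2_star alpha beta csqrt (proj_E2 alpha beta v) = proj_V alpha beta (psi_tilde c2 d2 v)).
Proof.
  cbv zeta. split.
  - intros v. apply psi1_star_proj; assumption.
  - destruct (parameters_nonzero alpha beta ha0 hb0 hab hab1) as [Ha [Hb [_ [Hp [_ H2]]]]].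
    assert (Eb2 : (- beta) ^ 2 = beta ^ 2) by ring.
    assert (H2' : 1 + alpha * beta <> 0) by (intros E; apply H2; rewrite <- E; ring).
    assert (Emul : alpha * - beta = - (alpha * beta)) by ring.
    assert (H2'' : alpha * - beta - 1 <> 0).
    { intros E. apply H2. replace (alpha * beta + 1) with (- (alpha * - beta - 1)) by ring. rewrite E. ring. }
    intros v. unfold psi2_star, proj_V, proj_E2.
    refine (psi_transport alpha (- beta) (curve_V alpha beta) (curve_E2 alpha beta) (phi2 alpha beta)
      (O2 alpha beta csqrt)
      (psi_tilde (1 / (1 + alpha * beta)) (- (1 / (alpha * beta * (1 + alpha * beta))))) _ _ _
      (O1 alpha (- beta) csqrt) _ _ v).
    + unfold curve_V. rewrite Eb2. reflexivity.
    + unfold curve_E1, curve_E2. do 4 f_equal. field. auto.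
    + intros [|x y]; [reflexivity |]. unfold phi1, phi2. rewrite Emul.
      destruct (Ceq_dec x (- (alpha * beta))) as [E | E]; [reflexivity |].
      assert (Hx : x + alpha * beta <> 0).
      { intros E'. apply E. replace x with (x + alpha * beta - alpha * beta) by ring. rewrite E'. ring. }
      f_equal.
      * replace (x - - (alpha * beta)) with (x + alpha * beta) by ring. field. auto.
      * replace (x - - (alpha * beta)) with (x + alpha * beta) by ring. field.
        split; [| split]; auto. rewrite <- Emul. exact H2''.
    + unfold O1, O2. rewrite Emul. f_equal. ring.
    + intros w.
      pose proof (psi1_star_proj alpha (- beta) csqrt hsqrt ha0 ha1) as HH.
      rewrite Eb2 in HH. specialize (HH hb0 hb1 hab hab1 w).
      etransitivity; [exact HH |].
      assert (Hn : alpha * beta <> 0) by (apply Cmult_neq_0; assumption).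
      replace (1 / (1 - alpha * - beta)) with (1 / (1 + alpha * beta)) by (f_equal; ring).
      replace (1 / (alpha * - beta * (1 - alpha * - beta))) with
        (- (1 / (alpha * beta * (1 + alpha * beta)))); [reflexivity |].
      rewrite Emul. replace (1 - - (alpha * beta)) with (1 + alpha * beta) by ring.
      field. repeat split; auto.
Qed.
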